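(* Let $G$ be a finite group all of whose Sylow subgroups are cyclic, and let $\mathcal{H}$ be a reduced set of subgroups of $G$. Then the $G$-lattice $J_{G/\mathcal{H}}$ is quasi-invertible. Moreover, $J_{G/\mathcal{H}}$ is quasi-permutation if and only if $\mathscr{D}_G(\mathcal{H})\cap\mathscr{P}_*(G)=\emptyset$.
   Context: A $G$-lattice is a finitely generated free abelian group with a left $G$-action; $M^\circ:=\mathrm{Hom}_{\mathbb{Z}}(M,\mathbb{Z})$ with $(gf)(x)=f(g^{-1}x)$. Permutation: has a $\mathbb{Z}$-basis permuted by $G$; quasi-permutation: there is an exact sequence $0\to M\to R\to F\to0$ with $R,F$ permutation; quasi-invertible: direct summand of a quasi-permutation lattice. For a set $\mathcal{H}$ of subgroups, $I_{G/\mathcal{H}}:=\ker(\bigoplus_{H\in\mathcal{H}}\mathbb{Z}[G/H]\to\mathbb{Z})$ (sum of augmentation maps) and $J_{G/\mathcal{H}}:=I_{G/\mathcal{H}}^\circ$. A set of subgroups is reduced if no element is contained in a different element. $d_G(\mathcal{H}):=\gcd((G:H)\mid H\in\mathcal{H})$ and $\mathscr{D}_G(\mathcal{H})$ is the set of prime divisors of $d_G(\mathcal{H})$. $\mathscr{P}_*(G)$ is the set of primes $p\mid\#G$ such that a $p$-Sylow subgroup $G_p$ is normal in $G$ and the image of the conjugation map $G\to\mathrm{Aut}(G_p)$, $g\mapsto(h\mapsto ghg^{-1})$, has order at least $3$. *)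

(* Defs.v *)
From mathcomp Require Import all_boot all_order all_algebra all_fingroup all_solvable.
Set Implicit Arguments.
Unset Strict Implicit.
Unset Printing Implicit Defensive.
Import GRing.Theory.
Local Open Scope ring_scope.

(* A G-lattice of rank n is represented by Z^n (column vectors 'cV[int]_n)
   with G acting on the left through integer matrices: g . x = rho g *m x. *)
Section Lattices.
Variable gT : finGroupType.
Variable G : {group gT}.

Definition is_lattice n (rho : gT -> 'M[int]_n) : Prop :=
  rho 1%g = 1%:M /\
  (forall g h, g \in G -> h \in G -> rho (g * h)%g = rho g *m rho h).

Definition is_Ghom m n (rhoM : gT -> 'M[int]_m) (rhoN : gT -> 'M[int]_n)
  (A : 'M[int]_(n, m)) : Prop :=
  forall g, g \in G -> A *m rhoM g = rhoN g *m A.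

(* Permutation lattice: there is a Z-basis (the columns of the unimodular
   matrix B) permuted by G, i.e. B^-1 rho(g) B is a permutation matrix. *)
Definition is_perm_lattice n (rho : gT -> 'M[int]_n) : Prop :=
  is_lattice rho /\
  exists B : 'M[int]_n, B \in unitmx /\
    forall g, g \in G -> is_perm_mx (invmx B *m rho g *m B).

Definition is_quasi_perm n (rho : gT -> 'M[int]_n) : Prop :=
  is_lattice rho /\
  exists r f (rhoR : gT -> 'M[int]_r) (rhoF : gT -> 'M[int]_f)
         (A : 'M[int]_(r, n)) (B : 'M[int]_(f, r)),
    [/\ is_perm_lattice rhoR, is_perm_lattice rhoF,
        is_Ghom rho rhoR A, is_Ghom rhoR rhoF B &
        [/\ (forall x : 'cV[int]_n, A *m x = 0 -> x = 0),
            B *m A = 0,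
            (forall y : 'cV[int]_r, B *m y = 0 ->
                exists x : 'cV[int]_n, y = A *m x) &
            (forall z : 'cV[int]_f, exists y : 'cV[int]_r, z = B *m y)]].

(* Quasi-invertible: direct summand of a quasi-permutation lattice L, i.e.
   there are G-maps i : M -> L and p : L -> M with p o i = id. *)
Definition is_quasi_invertible n (rho : gT -> 'M[int]_n) : Prop :=
  is_lattice rho /\
  exists l (rhoL : gT -> 'M[int]_l) (i : 'M[int]_(l, n)) (p : 'M[int]_(n, l)),
    [/\ is_quasi_perm rhoL, is_Ghom rho rhoL i, is_Ghom rhoL rho p &
        p *m i = 1%:M].

Variable calH : {set {group gT}}.

(* Basis of P := (+)_{H in calH} Z[G/H]: pairs (H, left coset xH). *)
Definition coset_pred (p : {group gT} * {set gT}) : bool :=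
  (p.1 \in calH) && (p.2 \in lcosets p.1 G).
Definition cosetT := {p : {group gT} * {set gT} | coset_pred p}.

Definition cosetT_act (g : gT) (t : cosetT) : cosetT :=
  insubd t ((sval t).1, (g *: (sval t).2)%g).

Definition NP := #|{: cosetT}|.

Definition sigmaP (g : gT) (a : nat) : nat :=
  match (insub a : option 'I_NP) with
  | Some k => val (enum_rank (cosetT_act g (enum_val k)))
  | None => a
  end.

(* I = ker(aug : P -> Z), with Z-basis f_i = e_{i+1} - e_0 (0 <= i < NP-1).
   g f_j = e_{s(j+1)} - e_{s(0)} where e_0 = 0 in terms of the f's. *)
Definition rhoI (g : gT) : 'M[int]_(NP.-1) :=
  \matrix_(i, j) (((sigmaP g j.+1 == i.+1 :> nat) : nat)%:Z
                  - ((sigmaP g 0 == i.+1 :> nat) : nat)%:Z).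

(* J = I^o = Hom(I, Z) with (g f)(x) = f(g^-1 x): in the dual basis the
   matrix of g is the transpose of the matrix of g^-1 on I. *)
Definition rhoJ (g : gT) : 'M[int]_(NP.-1) := (rhoI (g^-1)%g)^T.

Definition dG : nat := \big[gcdn/0%N]_(H in calH) #|G : H|%g.
Definition DG (p : nat) : Prop := prime p /\ (p %| dG)%N.

End Lattices.

Definition Pstar (gT : finGroupType) (G : {group gT}) (p : nat) : Prop :=
  [/\ prime p, (p %| #|G|)%N &
     exists P : {group gT}, [/\ P \in 'Syl_p(G)%g, (P <| G)%g &
        (3 <= #|[set conj_aut P (g^-1)%g | g in G]|)%N]].

Definition reduced_set (gT : finGroupType) (calH : {set {group gT}}) : Prop :=
  forall H K : {group gT}, H \in calH -> K \in calH -> H \subset K -> H = K.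

(* Main.v *)
(* Write Z[X] for the functions on a finite G-set X and J_X for Z[X] modulo constants; the
   lattice of the theorem is J_X with X the disjoint union of the G/H.

   Quasi-invertibility. On a cyclic p-subgroup T the stabilizers in X form a chain, so a point x0
   with maximal stabilizer gives a T-map X -> T x0 and an exact sequence 0 -> J_X -> Z[X] -> Z -> 0
   of T-lattices.  The indices of the Sylow subgroups being coprime, J_X is a direct summand of
   lattices induced from such T.

   Sufficiency. Since G' is cyclic of order prime to the cyclic group G / G', the degree splits as
   d = ab with a dividing #|G : G'| and b dividing #|G'|.  Choose subgroups of index a and b with
   coset spaces A and B.  Conjugacy of p-subgroups of equal order gives equivariant maps between
   Z + Z[X] and Z[A] + Z[B] that are inverse to each other on constants, and Ext^1 vanishes
   between permutation lattices, so it suffices to resolve J_A and J_B.  On A the generator of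
   G / G' gives 0 -> J_A -> Z[A] -> Z -> 0.  On B the group acts through a dihedral group of odd
   degree b, because a generator of G / G' inverts the relevant part of G'; the antisymmetric
   difference v(x c) - v(x c^-1) embeds J_B in Z[B x {+,-}] + Z with quotient Z[{+,-}] + Z[B].

   Necessity. Let p divide d and the Sylow subgroup P be normal.  For the smallest subgroup <s>
   of P contained in no conjugate of an element of calH, taking fixed points modulo p in
   0 -> J_X -> Z[Y] -> Z[W] -> 0 gives 0 -> F_p[Y^s] -> F_p[W^s] -> F_p -> 0.  An element g with
   s^g = s^r acts by r on the last term and by permutation matrices on the others, so comparing
   determinants r = 1 or -1 modulo p, and G acts on P through a group of order at most 2. *)
Require Import Defs.
From mathcomp Require Import all_boot all_order all_algebra all_fingroup all_solvable.
From mathcomp Require Import ring zify.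
Set Implicit Arguments.
Unset Strict Implicit.
Unset Printing Implicit Defensive.
Import GRing.Theory Order.TTheory Num.Theory.

(** * Groups with cyclic Sylow subgroups *)

Section Zgroups.
Local Open Scope group_scope.
Variable gT : finGroupType.
Implicit Types G P : {group gT}.

(** Burnside's fusion argument: [P] and its conjugate by [x] are Sylow subgroups of the centralizer
    of [b ^ x], hence conjugate there by some [c]; then [x * c^-1] normalizes [P], so it centralizes
    [b]. *)
Lemma fused_eq p G P x b : p.-Sylow(G) P -> abelian P -> 'N_G(P) \subset 'C(P) ->
  x \in G -> b \in P -> b ^ x \in P -> b ^ x = b.
Proof.
move=> sylP abP cPN Gx Pb; move Da: (b ^ x) => a Pa.
have sPG := pHall_sub sylP; have Ga := subsetP sPG _ Pa.
have sPC : P \subset 'C_G[a].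
  by rewrite subsetI sPG; apply/subsetP=> y Py; rewrite cent1C; apply/cent1P/(centsP abP).
have sPxC : P :^ x \subset 'C_G[a].
  rewrite subsetI conj_subG //; apply/subsetP=> y; rewrite mem_conjg => Py.
  apply/cent1P/(conjg_inj x^-1); rewrite !conjMg -Da conjgK.
  exact: (centsP abP).
have sCG : 'C_G[a] \subset G by apply: subsetIl.
have sylPC := pHall_subl sPC sCG sylP.
have sylPxC : p.-Sylow('C_G[a]) (P :^ x) by apply: (pHall_subl sPxC sCG); rewrite pHallJ.
have [c /setIP[Gc /cent1P cac] defPx] := Sylow_trans sylPC sylPxC.
have NPxc : x * c^-1 \in 'N_G(P).
  rewrite inE groupM ?groupV //=; apply/normP.
  by rewrite conjsgM -[P :^ x]/(gval (P :^ x)%G) defPx conjsgK.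
have := subsetP cPN _ NPxc; move/centP/(_ b Pb) => cb.
have: b ^ (x * c^-1) = b by rewrite conjgE -cb mulKg.
by rewrite conjgM Da conjgE invgK mulgA cac mulgK.
Qed.

(** The transfer from [G] to [P] kills [G'] and, since fusion in [P] is trivial, sends [g] in [P] to
    its power of exponent [#|G : P|], which is prime to [#|P|]. *)
Lemma Sylow_cent_der1 p G P : p.-Sylow(G) P -> abelian P ->
  'N_G(P) \subset 'C(P) -> P :&: G^`(1) = 1.
Proof.
move=> sylP abP cPN; have sPG := pHall_sub sylP.
have abI : abelian (idm_morphism P @* P) by rewrite im_idm.
have memI u : u \in P -> u \in idm_morphism P @* P by rewrite im_idm.
pose f := Morphism (@transferM _ _ G P (idm_morphism P) abI).
apply/trivgP/subsetP=> g /setIP[Pg Dg]; apply/set1P.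
have Gg := subsetP sPG _ Pg.
have sDK : G^`(1) \subset 'ker f.
  rewrite gen_subG; apply/subsetP=> _ /imset2P[x y Gx Gy ->].
  apply/kerP; rewrite ?groupR // morphR //.
  by apply/eqP/commgP; rewrite /commute; exact: GRing.addrC.
have /kerP-/(_ Gg) := subsetP sDK _ Dg.
pose X := transversal (rcosets P G :* <[g]>) G.
have trX : is_transversal X (rcosets P G :* <[g]>) G.
  exact: transversalP (rcosets_cycle_partition sPG Gg).
have XG x : x \in X -> x \in G by move/(subsetP (transversal_sub trX)).
have gP i : g ^+ i \in P by rewrite groupX.
rewrite /f /= (transfer_cycle_expansion sPG abI Gg trX).
have -> : (\sum_(x in X) restrm (transfer_morph_subproof (idm_morphism P))
     (FiniteModule.fmod abI \o idm_morphism P) (g ^+ #|<[g]> : P :* x| ^ x^-1)%g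
   = FiniteModule.fmod abI g *+ #|G : P|%g)%R.
  rewrite -(sum_index_rcosets_cycle sPG Gg trX) -GRing.sumrMnr.
  apply: eq_bigr => x Xx; rewrite -FiniteModule.fmodX ?memI //=.
  rewrite /restrm /= /idm; congr FiniteModule.fmod.
  apply: (fused_eq sylP abP cPN) => //; first by rewrite groupV XG.
  have := mulg_exp_card_rcosets P g x; rewrite mem_rcoset.
  by rewrite conjgE invgK mulgA.
rewrite -FiniteModule.fmodX ?memI // => /(congr1 (@FiniteModule.fmval _ _ _)).
rewrite FiniteModule.fmodK ?memI //= => g1.
have co: coprime #|P| #|G : P| by rewrite (pnat_coprime (pHall_pgroup sylP)) ?(pHall_pgroup _)
    //; case/and3P: sylP.
by rewrite -(expgK co Pg) g1 expg1n.
Qed.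

(** With R = r^(p^k), the quotient of R^p - 1 by R - 1 is a sum of p terms congruent to 1 modulo p,
    so each p-th power gains one factor p. *)
Lemma expn_one_mod p r k : prime p -> r = 1 %[mod p] -> r ^ (p ^ k) = 1 %[mod p ^ k.+1].
Proof.
move=> pr_p r1; elim: k => [|k /eqP IHk]; first by rewrite expn0 expn1.
have p_gt0 := prime_gt0 pr_p.
have rgt0 : 0 < r by case: r r1 {IHk} => // /eqP; rewrite mod0n modn_small ?prime_gt1.
have Rgt0 : 0 < r ^ (p ^ k) by rewrite expn_gt0 rgt0.
apply/eqP; rewrite eqn_mod_dvd ?expn_gt0 ?rgt0 // (expnSr p k) expnM subn1 predn_exp.
rewrite eqn_mod_dvd // subn1 in IHk.
rewrite (expnSr p k.+1) dvdn_mul // /dvdn -modn_summ.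
have ri j : (r ^ j)%N = 1 %[mod p] by rewrite -modnXm r1 modnXm exp1n.
under eq_bigr do rewrite -expnM ri.
by rewrite modn_summ sum_nat_const card_ord muln1 modnn.
Qed.

Lemma mem_coprime_expg (K : {group gT}) x m n :
  coprime m n -> x ^+ m \in K -> x ^+ n \in K -> x \in K.
Proof.
move=> co Km Kn; case: m => [|m] in co Km *.
  by move: co Kn; rewrite /coprime gcd0n => /eqP->; rewrite expg1.
case: (egcdnP n (ltn0Sn m)) => u v e _; move: e; rewrite (eqP co) => e.
have: x ^+ (u * m.+1) \in K by rewrite mulnC expgM groupX.
rewrite e expgD expg1 mulnC expgM groupMl //.
by rewrite groupX.
Qed.

(** The power of [x] of exponent p^k = [#[z]] centralizes [z], because r^(p^k) is 1 modulo p^k. The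
    power whose exponent is the p'-part of [#[x]] is a p-element of the normalizer, so it lies in
    the abelian group [P]. These exponents are coprime. *)
Lemma Sylow_norm_cent p G P z x r : prime p -> p.-Sylow(G) P -> P :=: <[z]> ->
  x \in 'N_G(P) -> z ^ x = z ^+ r -> r = 1 %[mod p] -> x \in 'C(P).
Proof.
move=> pr_p sylP defP Nx zx r1; have [Gx _] := setIP Nx.
have pP := pHall_pgroup sylP; have sPG := pHall_sub sylP.
have cPP : abelian P by rewrite defP cycle_abelian.
have zxj j : z ^ (x ^+ j) = z ^+ (r ^ j).
  elim: j => [|j IHj]; first by rewrite conjg1.
  by rewrite expgSr conjgM IHj conjXg zx -expgM expnS.
have [k oz] : exists k, #[z] = (p ^ k)%N.
  have /p_natP[k ->] : p.-elt z by rewrite (mem_p_elt pP) ?defP ?cycle_id.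
  by exists k.
have sylPN : p.-Sylow('N_G(P)) P.
  by apply: (pHall_subl _ _ sylP); rewrite ?subsetIl // subsetI sPG normG.
have nPN : P <| 'N_G(P) by rewrite /normal subsetI sPG normG subsetIr.
have cPz : P \subset 'C[z] by rewrite -cent_cycle -defP.
have -> : 'C(P) = 'C[z] by rewrite defP cent_cycle.
apply: (@mem_coprime_expg 'C[z]%G x #[x]`_p^' (p ^ k)).
- by rewrite coprime_sym (@pnat_coprime p) ?part_pnat // pnatX pnat_id.
- apply: (subsetP cPz); rewrite (mem_normal_Hall sylPN nPN) ?groupX //.
  rewrite /p_elt orderXdiv ?dvdn_part // -{1}(partnC p (order_gt0 x)).
  by rewrite mulnK ?part_gt0 ?part_pnat.
apply/cent1P/esym/commgP/conjg_fixP; rewrite zxj.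
apply/eqP; rewrite -[X in _ == X]expg1 eq_expg_mod_order oz.
have /eqP := expn_one_mod k pr_p r1.
case: k {oz} => [|k]; first by rewrite !modn1.
by move=> e; rewrite -(modn_dvdm _ (dvdn_exp2l p (leqnSn k.+1))) (eqP e) modn_dvdm ?dvdn_exp2l.
Qed.

(** For the smallest prime p dividing [#|G|], the order of N_G(P) / C_G(P) divides both [#|G : P|]
    and the totient of [#|P|], so it is 1. Transfer then shows that [P] meets [G'] trivially. *)
Lemma Zgroup_der1_proper G : Zgroup G -> G :!=: 1 -> G^`(1) \proper G.
Proof.
move=> ZG ntG; pose p := pdiv #|G|; have pr_p : prime p by rewrite pdiv_prime ?cardG_gt1.
have [P sylP] := Sylow_exists p G; have sPG := pHall_sub sylP.
have cycP : cyclic P by apply: (forall_inP ZG); apply: p_Sylow sylP.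
have ntP : P :!=: 1.
  by rewrite -cardG_gt1 (card_Hall sylP) p_part_gt1 pi_pdiv cardG_gt1.
have cPN : 'N_G(P) \subset 'C(P).
  have : #|conj_aut P @* 'N_G(P)| = 1%N.
    set m := #|_|; apply/eqP; apply/contraT => m1.
    have mP : m %| totient #|P| by rewrite -(card_Aut_cyclic cycP) cardSg ?Aut_conj_aut.
    have mI : m = #|'N_G(P) : 'C_('N_G(P))(P)|.
      rewrite /m card_morphim ker_conj_aut (setIidPr _) ?subsetIr //.
      by rewrite -indexgI.
    have mG : m %| #|G : P|.
      have sPC : P \subset 'C_('N_G(P))(P) by rewrite !subsetI sPG normG; exact: cyclic_abelian.
      rewrite mI; apply: dvdn_trans (indexgS _ sPC) _.
      by rewrite indexSg ?subsetIl // subsetI sPG normG.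
    have m_gt1 : 1 < m by rewrite ltn_neqAle eq_sym m1 cardG_gt0.
    have pr_q := pdiv_prime m_gt1; have qm := pdiv_dvd m; set q := pdiv m in pr_q qm.
    have qG : q %| #|G : P| := dvdn_trans qm mG.
    have qp : p <= q.
      by apply: pdiv_min_dvd (prime_gt1 pr_q) _; apply: dvdn_trans qG (dvdn_indexg _ _).
    have neq_qp : q != p.
      apply/contraL: (qG) => /eqP->; have [_ _] := and3P sylP.
      by rewrite p'natE.
    have := dvdn_trans qm mP.
    have [_ _ [k ->]] := pgroup_pdiv (pHall_pgroup sylP) ntP.
    rewrite totient_pfactor // Euclid_dvdM // => /orP[|].
      have p1_gt0 : 0 < p.-1 by rewrite -subn1 subn_gt0 prime_gt1.
      move/(dvdn_leq p1_gt0); rewrite leqNgt; case/negP.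
      by rewrite prednK ?prime_gt0.
    by rewrite Euclid_dvdX // dvdn_prime2 // (negPf neq_qp).
  move/card1_trivg => triv; apply/subsetP=> x Nx; have [Gx NPx] := setIP Nx.
  rewrite -ker_conj_aut; apply/kerP => //; apply/set1P.
  by rewrite -[[set 1]]triv mem_morphim.
rewrite properE der_sub /=; apply: contra ntP => sGD.
have := Sylow_cent_der1 sylP (cyclic_abelian cycP) cPN.
by rewrite (setIidPl (subset_trans sPG sGD)) => ->.
Qed.

Lemma Zgroup_solvable G : Zgroup G -> solvable G.
Proof.
have [n] := ubnP #|G|; elim: n => // n IHn in G * => leGn ZG.
have [-> | ntG] := eqVneq G 1%G; first exact: solvable1.
have sDG := Zgroup_der1_proper ZG ntG.
rewrite (series_sol (der_normal 1 G)) (abelian_sol (der_abelian 0 G)) andbT.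
by rewrite IHn ?(ZgroupS (der_sub 1 G)) // (leq_trans (proper_card sDG)).
Qed.

Lemma abelian_Zgroup_cyclic G : Zgroup G -> abelian G -> cyclic G.
Proof. by move=> ZG abG; apply: nil_Zgroup_cyclic (abelian_nil abG). Qed.

Lemma der1_cent_cyclic G (N : {group gT}) : G \subset 'N(N) -> cyclic N ->
  G^`(1) \subset 'C(N).
Proof.
move=> nNG cycN; rewrite gen_subG; apply/subsetP=> _ /imset2P[x y Gx Gy ->].
have Nx := subsetP nNG _ Gx; have Ny := subsetP nNG _ Gy.
suffices: [~ x, y] \in 'ker (conj_aut N) by rewrite ker_conj_aut.
apply/kerP; rewrite ?groupR // morphR //.
by apply/eqP/commgP; apply: (centsP (Aut_cyclic_abelian cycN)); rewrite Aut_aut.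
Qed.
End Zgroups.

Section ZgroupStructure.
Local Open Scope group_scope.
Variable gT : finGroupType.
Implicit Types G P : {group gT}.

(* [G'] acts trivially on the cyclic group [G^(2) / G^(3)], whose automorphism
   group is abelian; as [G' / G^(2)] is cyclic, [G' / G^(3)] is abelian. *)
Lemma Zgroup_der1_cyclic G : Zgroup G -> cyclic G^`(1).
Proof.
move=> ZG; have solG := Zgroup_solvable ZG.
have ZD k : Zgroup G^`(k) by apply: ZgroupS (der_sub k G) ZG.
suffices D2 : G^`(2) = 1.
  by apply: abelian_Zgroup_cyclic (ZD 1%N) _; apply/commG1P.
have nD k : G \subset 'N(G^`(k)) by apply: der_norm.
have cyc_q k : cyclic (G^`(k) / G^`(k.+1)).
  by apply: abelian_Zgroup_cyclic; [apply: morphim_Zgroup; exact: ZD | exact: der_abelian].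
apply/eqP; apply/contraT => nt2.
have := sol_der1_proper solG (der_sub 2 G) nt2.
rewrite properE => /andP[_ /negP[]].
have nD3 : G^`(1) \subset 'N(G^`(3)) := subset_trans (der_sub 1 G) (nD 3).
suffices ab : abelian (G^`(1) / G^`(3)) by apply: der1_min nD3 ab.
have nq : G / G^`(3) \subset 'N(G^`(2) / G^`(3)) by rewrite quotient_norms ?nD.
have cent := der1_cent_cyclic nq (cyc_q 2).
apply: (@cyclic_factor_abelian _ (G^`(2) / G^`(3))%G).
  apply/subsetIP; split; first by apply: quotientS; apply: (der_sub 1 G^`(1)).
  by rewrite centsC /= (quotient_der 1 (nD 3)).
have n32 : G^`(3) <| G^`(1).
  rewrite /normal nD3 andbT; apply: (subset_trans (der_sub 1 G^`(2))).
  exact: (der_sub 1 G^`(1)).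
by rewrite /= (isog_cyclic (third_isog (der_sub 1 G^`(2)) n32 (der_normal 1 G^`(1)))) cyc_q.
Qed.

(** The map y -> [y, x] is an endomorphism of the abelian group [G']. Its image is normal in [G]
    with abelian quotient, hence is all of [G']; so the map is injective, and its kernel is the
    centralizer of [x]. *)
Lemma der1_cent_TI G x : abelian G^`(1) -> G \subset G^`(1) <*> <[x]> -> x \in G ->
  'C_(G^`(1))[x] = 1.
Proof.
move=> abD sG Gx; have nDx : x \in 'N(G^`(1)) := subsetP (der_norm 1 G) _ Gx.
pose f y := [~ y, x].
have fM : {in G^`(1) &, {morph f : y z / y * z}}.
  move=> y z Dy Dz /=; rewrite /f !commgEl conjMg invMg.
  have Dyx : y ^ x \in G^`(1) by rewrite memJ_norm.
  have Dzx : z ^ x \in G^`(1) by rewrite memJ_norm.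
  have cD := centsP abD.
  move: (y ^ x) (z ^ x) Dyx Dzx => u v Du Dv.
  rewrite (cD z^-1 _ y^-1) ?groupV // -!mulgA; congr (_ * _).
  by rewrite mulgA (cD z^-1 _ u) ?groupV // -mulgA.
pose I := (Morphism fM @* G^`(1))%G.
have sID : I \subset G^`(1).
  apply/subsetP=> _ /morphimP[y Dy _ ->].
  by rewrite /= /f commgEl groupM ?groupV // memJ_norm.
have nIx : x \in 'N(I).
  rewrite inE; apply/subsetP=> _ /imsetP[_ /morphimP[y Dy _ ->] ->].
  have Dyx : y ^ x \in G^`(1) by rewrite memJ_norm.
  apply/morphimP; exists (y ^ x) => //; rewrite /= /f conjRg.
  by congr [~ _, _]; rewrite conjgE mulKg.
have nID : G^`(1) \subset 'N(I) := sub_abelian_norm abD sID.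
have nIY : G^`(1) <*> <[x]> \subset 'N(I) by rewrite join_subG nID cycle_subG.
have nIG : G \subset 'N(I) := subset_trans sG nIY.
have sDI : G^`(1) \subset I.
  apply: der1_min nIG _; apply: abelianS (quotientS _ sG) _.
  rewrite quotientY ?cycle_subG // abelianY quotient_abelian // quotient_abelian ?cycle_abelian //=.
  rewrite quotient_cycle // centsC cent_cycle; apply/subsetP=> _ /morphimP[y Ny Dy ->].
  apply/cent1P/commgP; rewrite -morphR //; apply/eqP/coset_id.
  by apply/morphimP; exists y.
have injf : 'injm (Morphism fM).
  by rewrite -card_im_injm eqn_leq leq_morphim //= subset_leq_card.
apply/trivgP; apply: subset_trans injf; apply/subsetP=> y /setIP[Dy /cent1P cyx].
by apply/kerP => //=; apply/eqP/commgP.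
Qed.

Lemma Zgroup_generator G : Zgroup G ->
  exists2 x, x \in G & G :=: G^`(1) <*> <[x]>.
Proof.
move=> ZG; have nDG := der_norm 1 G.
have /cyclicP[X defX] : cyclic (G / G^`(1)).
  by apply: abelian_Zgroup_cyclic; [apply: morphim_Zgroup | exact: (der_abelian 0)].
have : X \in G / G^`(1) by rewrite defX cycle_id.
case/morphimP=> x Nx Gx defx; exists x => //.
apply/eqP; rewrite eqEsubset join_subG der_sub cycle_subG Gx !andbT.
rewrite -(quotientSGK nDG) ?joing_subl // quotientYidl ?cycle_subG //.
by rewrite quotient_cycle // -defx defX.
Qed.

(* If [p] divides both orders, [N_G(P)] acts trivially on the nontrivial quotient
   [P / (P :&: G')] of the cyclic group [P], hence on [P], and Burnside's transfer
   argument gives [P :&: G' = 1]. *)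
Lemma Zgroup_der1_Hall G : Zgroup G -> Hall G G^`(1).
Proof.
move=> ZG; rewrite /Hall der_sub /=; apply/contraT => nco.
have [p pr_p /andP[pD pI]] : exists2 p, prime p & (p %| #|G^`(1)|) && (p %| #|G : G^`(1)|).
  exists (pdiv (gcdn #|G^`(1)| #|G : G^`(1)|)).
    by rewrite pdiv_prime // ltn_neqAle eq_sym nco gcdn_gt0 cardG_gt0.
  by rewrite !(dvdn_trans (pdiv_dvd _)) ?dvdn_gcdl ?dvdn_gcdr.
have [P sylP] := Sylow_exists p G; have sPG := pHall_sub sylP.
have cycP : cyclic P by apply: (forall_inP ZG); apply: p_Sylow sylP.
have [z defP] := cyclicP cycP.
have cPN : 'N_G(P) \subset 'C(P).
  apply/subsetP=> y NPy; have [Gy Ny] := setIP NPy.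
  have Pz : z \in P by rewrite defP cycle_id.
  have /cycleP[r zr] : z ^ y \in <[z]> by rewrite -defP memJ_norm.
  apply: (Sylow_norm_cent pr_p sylP defP NPy zr).
  have [r0 | r0] := posnP r.
    have : z = 1 by apply: (conjg_inj y); rewrite zr r0 conj1g.
    move=> z1; have := card_Hall sylP; rewrite defP z1 cycle1 cards1 => /esym/eqP.
    by rewrite partn_eq1 ?cardG_gt0 // p'natE // (dvdn_trans pD) // cardSg ?der_sub.
  apply/eqP; rewrite eqn_mod_dvd //; apply/contraT => ndv.
  (* If r - 1 is prime to p, then [z, y] = z^(r - 1) generates [P], so [P] lies in [G'], against p
     dividing [#|G : G'|]. *)
  have Dzr : z ^+ (r - 1) \in G^`(1).
    have -> : z ^+ (r - 1) = [~ z, y].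
      by rewrite commgEl zr; apply: (mulgI z); rewrite mulKVg -expgS subn1 prednK.
    by rewrite mem_commg // (subsetP sPG).
  have gen : generator P (z ^+ (r - 1)).
    rewrite defP generator_coprime.
    have /p_natP[k ->] : p.-elt z by rewrite (mem_p_elt (pHall_pgroup sylP)).
    by rewrite coprimeXl // prime_coprime.
  have sPD : P \subset G^`(1) by rewrite (eqP gen) cycle_subG.
  have := indexgS G sPD; case/and3P: sylP => _ _; rewrite p'natE //.
  by move=> /negP np d; case: np; apply: dvdn_trans pI d.
have abP := cyclic_abelian cycP.
have := Sylow_cent_der1 sylP abP cPN; move=> PD1.
have sylPD : p.-Sylow(G^`(1)) (P :&: G^`(1)).
  exact: Hall_setI_normal (der_normal 1 G) sylP.
have := card_Hall sylPD; rewrite /= PD1 cards1 => /esym/eqP.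
by rewrite partn_eq1 ?cardG_gt0 // p'natE // pD.
Qed.
End ZgroupStructure.

(** * Permutation modules *)

Local Open Scope ring_scope.

Section AdditiveMaps.
Variables A B : zmodType.

Definition add_map (f : A -> B) := forall u v, f (u + v) = f u + f v.

Variable f : A -> B.
Hypothesis fD : add_map f.

Lemma add_map0 : f 0 = 0.
Proof. by apply: (addrI (f 0)); rewrite -fD !addr0. Qed.

Lemma add_mapN u : f (- u) = - f u.
Proof. by apply: (addrI (f u)); rewrite -fD !subrr add_map0. Qed.

Lemma add_mapB u v : f (u - v) = f u - f v.
Proof. by rewrite fD add_mapN. Qed.

Lemma add_map_sum I r (P : pred I) F : f (\sum_(i <- r | P i) F i) = \sum_(i <- r | P i) f (F i).
Proof. exact: (big_morph f fD add_map0). Qed.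

Lemma add_map_nat u n : f (u *+ n) = f u *+ n.
Proof. by elim: n => [|n IHn]; rewrite ?mulr0n ?add_map0 // !mulrS fD IHn. Qed.

Lemma add_map_int u n : f (u *~ n) = f u *~ n.
Proof.
by case: n => n; rewrite ?NegzE ?mulrNz ?add_mapN -!pmulrn add_map_nat.
Qed.
End AdditiveMaps.

Section Functions.
Variable X : finType.
Implicit Type v : {ffun X -> int}.

Definition delta (x : X) : {ffun X -> int} := [ffun y => (y == x)%:Z].
Definition cst (n : int) : {ffun X -> int} := [ffun=> n].

Lemma ffun_mulzE v (n : int) x : (v *~ n) x = v x *~ n.
Proof.
by case: n => n; rewrite ?NegzE ?mulrNz ?ffunE -!pmulrn ffunMnE.
Qed.

Lemma ffun_delta v : v = \sum_x delta x *~ v x.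
Proof.
apply/ffunP=> y; rewrite sum_ffunE (bigD1 y) //= ffun_mulzE ffunE eqxx.
rewrite big1 ?addr0 => [|x /negPf ne]; last by rewrite ffun_mulzE ffunE eq_sym ne mul0rz.
by rewrite intz.
Qed.

Lemma cstB m n : cst (m - n) = cst m - cst n.
Proof. by apply/ffunP=> x; rewrite !ffunE. Qed.
End Functions.

Arguments delta {X} x.
Arguments cst X n : clear implicits.

Section Gsets.
Variables (gT : finGroupType) (G : {group gT}).

Record gset := Gset { gcar :> finType; gto : action G gcar }.

(* A right action on X makes Z[X] a left module by (g v)(x) = v(x g). *)
Definition ga (X : gset) (g : gT) (v : {ffun X -> int}) : {ffun X -> int} :=
  [ffun x => v (gto X x g)].

Lemma ga_add X g : add_map (@ga X g).
Proof. by move=> u v; apply/ffunP=> x; rewrite !ffunE. Qed.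

Lemma ga1 X v : @ga X 1%g v = v.
Proof. by apply/ffunP=> x; rewrite ffunE act1. Qed.

Lemma gaM X g h v : g \in G -> h \in G -> @ga X (g * h)%g v = ga g (ga h v).
Proof. by move=> Gg Gh; apply/ffunP=> x; rewrite !ffunE actMin. Qed.

Lemma gaK X g v : g \in G -> @ga X g (ga g^-1%g v) = v.
Proof. by move=> Gg; rewrite -gaM ?groupV // mulgV ga1. Qed.

Lemma gaVK X g v : g \in G -> @ga X g^-1%g (ga g v) = v.
Proof. by move=> Gg; rewrite -gaM ?groupV // mulVg ga1. Qed.

Lemma ga_cst (X : gset) g n : ga g (cst X n) = cst X n.
Proof. by apply/ffunP=> x; rewrite !ffunE. Qed.

Lemma ga_deltaV (X : gset) g x : g \in G -> ga g^-1%g (delta x) = delta (gto X x g).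
Proof.
move=> Gg; apply/ffunP=> y; rewrite !ffunE; congr (nat_of_bool _)%:Z.
by apply/eqP/eqP => [<- | ->]; rewrite ?actKVin ?actKin.
Qed.

Definition ghom (X Y : gset) (f : {ffun X -> int} -> {ffun Y -> int}) :=
  add_map f /\ forall g v, g \in G -> f (ga g v) = ga g (f v).

(* [Z[X] / K] is quasi-permutation: exactness of
   0 -> Z[X] / K -> Z[Y] -> Z[W] -> 0 with Y, W finite G-sets. *)
Definition resolved (X : gset) (K : {ffun X -> int} -> Prop) :=
  exists (Y W : gset) (a : {ffun X -> int} -> {ffun Y -> int})
         (b : {ffun Y -> int} -> {ffun W -> int}),
  [/\ ghom a, ghom b, forall v, a v = 0 <-> K v,
      forall w, b w = 0 <-> exists v, w = a v & forall z, exists w, b w = z].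

Definition is_cst (X : gset) (v : {ffun X -> int}) := exists n, v = cst X n.

(* The rational coboundary is [E / n]; rounding down pointwise commutes with
   the permutation action, so it makes the coboundary integral. *)
Lemma cocycle_coboundary (X : gset) (d : gT -> {ffun X -> int}) :
    (forall g h, g \in G -> h \in G -> d (g * h)%g = d g + ga g (d h)) ->
  exists c, forall g, g \in G -> d g = ga g c - c.
Proof.
move=> dM; pose E := \sum_(g in G) d g; pose n : int := #|G|%:Z.
have n0 : n != 0 by rewrite /n eqz_nat -lt0n cardG_gt0.
have EG h : h \in G -> ga h E = E - d h *~ n.
  move=> Gh; rewrite (add_map_sum (@ga_add X h)).
  rewrite (eq_bigr (fun g => d (h * g)%g - d h)); last first.
    by move=> g Gg; rewrite dM // addrAC subrr add0r.
  rewrite sumrB sumr_const -pmulrn; congr (_ - _).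
  rewrite [RHS](reindex_inj (mulgI h)) /=; apply: eq_bigl => g.
  by rewrite groupMl.
exists [ffun x => - (E x %/ n)%Z] => h Gh; apply/ffunP=> x.
have := congr1 (fun v : {ffun X -> int} => v x) (EG h Gh).
rewrite !ffunE ffun_mulzE => ->.
rewrite mulrzz; have -> : E x - d h x * n = (- d h x) * n + E x by ring.
by rewrite divzMDl //; ring.
Qed.

Lemma ghom_add (X Y : gset) (f g : {ffun X -> int} -> {ffun Y -> int}) :
  ghom f -> ghom g -> ghom (fun v => f v + g v).
Proof.
case=> fD fG [gD gG]; split=> [u v | h v Gh]; first by rewrite fD gD addrACA.
by rewrite fG // gG // ga_add.
Qed.

Lemma ghom_opp (X Y : gset) (f : {ffun X -> int} -> {ffun Y -> int}) :
  ghom f -> ghom (fun v => - f v).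
Proof.
case=> fD fG; split=> [u v | h v Gh]; first by rewrite fD opprD.
by rewrite fG // (add_mapN (@ga_add _ _)).
Qed.

Lemma ghom_comp (X Y W : gset) (f : {ffun X -> int} -> {ffun Y -> int})
    (g : {ffun Y -> int} -> {ffun W -> int}) :
  ghom f -> ghom g -> ghom (g \o f).
Proof.
case=> fD fG [gD gG]; split=> [u v | h v Gh] /=; first by rewrite fD gD.
by rewrite fG // gG.
Qed.

Lemma ghom_id (X : gset) : ghom (@id {ffun X -> int}).
Proof. by []. Qed.

Fact prod_is_action (X Y : gset) :
  is_action G (fun (z : X * Y) g => (gto X z.1 g, gto Y z.2 g)).
Proof.
split=> [g [x y] [x' y'] /= [/act_inj-> /act_inj-> //] | [x y] g h Gg Gh /=].
by rewrite !actMin.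
Qed.
Definition gprod (X Y : gset) : gset := Gset (Action (prod_is_action X Y)).

Fact sum_is_action (X Y : gset) :
  is_action G (fun (z : X + Y) g =>
    match z with inl x => inl (gto X x g) | inr y => inr (gto Y y g) end).
Proof.
split=> [g [x|y] [x'|y'] //= [/act_inj-> //] | [x|y] g h Gg Gh /=];
  by rewrite actMin.
Qed.
Definition gsum (X Y : gset) : gset := Gset (Action (sum_is_action X Y)).

Fact unit_is_action : is_action G (fun (z : unit) (_ : gT) => z).
Proof. by split=> // g []. Qed.
Definition gpt : gset := Gset (Action unit_is_action).

Definition fjoin (X Y : gset) (u : {ffun X -> int}) (v : {ffun Y -> int}) :
  {ffun gsum X Y -> int} := [ffun z : X + Y => match z with inl x => u x | inr y => v y end].
Definition fleft (X Y : gset) (v : {ffun gsum X Y -> int}) : {ffun X -> int} :=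
  [ffun x => v (inl x)].
Definition fright (X Y : gset) (v : {ffun gsum X Y -> int}) : {ffun Y -> int} :=
  [ffun y => v (inr y)].

Lemma fjoinK X Y v : @fjoin X Y (fleft v) (fright v) = v.
Proof. by apply/ffunP=> -[x|y]; rewrite !ffunE. Qed.
Lemma fleftK X Y u v : fleft (@fjoin X Y u v) = u.
Proof. by apply/ffunP=> x; rewrite !ffunE. Qed.
Lemma frightK X Y u v : fright (@fjoin X Y u v) = v.
Proof. by apply/ffunP=> x; rewrite !ffunE. Qed.

Lemma ghom_fleft X Y : ghom (@fleft X Y).
Proof. by split=> [u v | g v Gg]; apply/ffunP=> x; rewrite !ffunE. Qed.
Lemma ghom_fright X Y : ghom (@fright X Y).
Proof. by split=> [u v | g v Gg]; apply/ffunP=> x; rewrite !ffunE. Qed.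

Lemma ghom_fjoin (X Y W : gset) (f : {ffun W -> int} -> {ffun X -> int})
    (g : {ffun W -> int} -> {ffun Y -> int}) :
  ghom f -> ghom g -> ghom (fun w => fjoin (f w) (g w)).
Proof.
case=> fD fG [gD gG]; split=> [u v | h v Gh]; apply/ffunP=> -[x|y];
  by rewrite ?(fD, gD) ?(fG, gG) // !ffunE.
Qed.

Lemma fjoin_eq0 X Y u v : @fjoin X Y u v = 0 <-> u = 0 /\ v = 0.
Proof.
split=> [e | [-> ->]]; last by apply/ffunP=> -[x|y]; rewrite !ffunE.
by rewrite -(fleftK u v) -{2}(frightK u v) e; split; apply/ffunP=> x; rewrite !ffunE.
Qed.

(* Ext^1(Z[F], Z[S']) = 0. *)
Lemma ghom_extend (S R F S' : gset) (q : {ffun S -> int} -> {ffun R -> int})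
    (b : {ffun R -> int} -> {ffun F -> int}) (e : {ffun S -> int} -> {ffun S' -> int}) :
  ghom q -> ghom b -> (forall w, b w = 0 <-> exists v, w = q v) ->
  (forall z, exists w, b w = z) -> ghom e -> (forall s, q s = 0 -> e s = 0) ->
  exists2 E, ghom E & forall s, E (q s) = e s.
Proof.
move=> [qD qG] [bD bG] bq bS [eD eG] qe.
have bq0 s : b (q s) = 0 by apply/bq; exists s.
have /fin_all_exists[r rE] (f : F) : exists w, b w = delta f by apply: bS.
(* An additive section of [b], in general not equivariant; through [Q] it gives [E0], an additive
   extension of [e] along [q]. *)
pose sec (w : {ffun F -> int}) := \sum_f r f *~ w f.
have secD : add_map sec.
  move=> u v; rewrite /sec -big_split; apply: eq_bigr => f _.
  by rewrite ffunE mulrzDr.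
have bsec w : b (sec w) = w.
  rewrite /sec add_map_sum // [RHS]ffun_delta; apply: eq_bigr => f _.
  by rewrite add_map_int // rE.
have /fin_all_exists[s sE] (x : R) : exists s, delta x - sec (b (delta x)) = q s.
  by apply/bq; rewrite (add_mapB bD) bsec subrr.
pose Q (w : {ffun R -> int}) := \sum_x s x *~ w x.
have QD : add_map Q.
  move=> u v; rewrite /Q -big_split; apply: eq_bigr => f _.
  by rewrite ffunE mulrzDr.
have qQ w : q (Q w) = w - sec (b w).
  rewrite /Q (add_map_sum qD) [in RHS](ffun_delta w) (add_map_sum bD) (add_map_sum secD) -sumrB.
  apply: eq_bigr => f _; rewrite (add_map_int qD) (add_map_int bD) (add_map_int secD) -sE.
  by rewrite mulrzBl.
pose E0 w := e (Q w).
have E0D : add_map E0 by move=> u v; rewrite /E0 QD eD.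
have E0q t : E0 (q t) = e t.
  apply/eqP; rewrite -subr_eq0 -(add_mapB eD); apply/eqP/qe.
  by rewrite (add_mapB qD) qQ bq0 add_map0 // subr0 subrr.
(* [D g] measures the failure of [E0] to commute with [g]. It kills the kernel of [b], so it factors
   through Z[F], and [d] is a 1-cocycle with values in Hom(Z[F], Z[S']), that is, in Z[S' x F]. *)
pose D g w := ga g (E0 (ga g^-1%g w)) - E0 w.
have DE g w : D g w = ga g (E0 (ga g^-1%g w)) - E0 w by [].
clearbody D.
have DD g : add_map (D g).
  by move=> u v; rewrite !DE !ga_add !E0D ga_add opprD addrACA.
have D0 g w : g \in G -> b w = 0 -> D g w = 0.
  move=> Gg /bq[t ->]; rewrite DE E0q -qG ?groupV // E0q eG ?groupV // gaK //.
  by rewrite subrr.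
have Db g w w' : g \in G -> b w = b w' -> D g w = D g w'.
  move=> Gg eb; apply/eqP; rewrite -subr_eq0 -(add_mapB (DD g)) D0 //.
  by rewrite (add_mapB bD) eb subrr.
pose d g : {ffun gprod S' F -> int} := [ffun z : S' * F => D g (r z.2) z.1].
have [c cE] : exists c, forall g, g \in G -> d g = ga g c - c.
  apply: cocycle_coboundary => g h Gg Gh; apply/ffunP=> -[y f]; rewrite !ffunE /=.
  have <- : D h (ga g^-1%g (r f)) = D h (r (gto F f g)).
    by apply: Db => //; rewrite bG ?groupV // !rE ga_deltaV.
  rewrite !DE invMg !gaM ?groupV // !ffunE; ring.
(* [C] is the map Z[F] -> Z[S'] with matrix [c]; subtracting [C o b] restores equivariance and
   changes nothing on the image of [q]. *)
pose C (w : {ffun F -> int}) : {ffun S' -> int} := [ffun y => \sum_f c (y, f) * w f].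
have CD : add_map C.
  move=> u v; apply/ffunP=> y; rewrite !ffunE -big_split; apply: eq_bigr => f _.
  by rewrite !ffunE mulrDr.
exists (fun w => E0 w - C (b w)); last first.
  by move=> t; rewrite E0q bq0 add_map0 // subr0.
split=> [u v | g v Gg]; first by rewrite E0D bD CD opprD addrACA.
have : D g (ga g v) = ga g (C (b v)) - C (b (ga g v)).
  rewrite (@Db g _ (sec (b (ga g v)))) ?bsec // /sec add_map_sum //.
  apply/ffunP=> y; rewrite sum_ffunE !ffunE.
  have -> : \sum_f c (gto S' y g, f) * b v f
          = \sum_f c (gto S' y g, gto F f g) * (b (ga g v)) f.
    rewrite (reindex_inj (@act_inj _ _ _ (gto F) g)) /=; apply: eq_bigr => f _.
    by rewrite bG // ffunE.
  rewrite -sumrB; apply: eq_bigr => f _.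
  rewrite add_map_int // ffun_mulzE -mulrBl mulrzz; congr (_ * _).
  by have := congr1 (fun u : {ffun gprod S' F -> int} => u (y, f)) (cE g Gg); rewrite !ffunE.
rewrite DE gaVK // (add_mapB (@ga_add _ g)) => /eqP; rewrite subr_eq => /eqP->.
by rewrite [RHS]addrC -(addrA (ga g _)) addKr addrC.
Qed.

(** 1 - psi phi kills every [s] with [q s = 0], so it extends along [q] to an equivariant [E]. With
    u -> (u - phi psi u, q psi u) and (u, w) -> (E w - psi u, b w), the sequence 0 -> Z[U]/KU ->
    Z[U] + Z[R] -> Z[S] + Z[F] -> 0 is exact. *)
Lemma resolved_transfer (S U : gset) (KS : {ffun S -> int} -> Prop)
    (KU : {ffun U -> int} -> Prop) (phi : {ffun S -> int} -> {ffun U -> int})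
    (psi : {ffun U -> int} -> {ffun S -> int}) :
  ghom phi -> ghom psi ->
  (forall s, KS s -> KU (phi s) /\ psi (phi s) = s) ->
  (forall u, KU u -> KS (psi u) /\ phi (psi u) = u) ->
  resolved KS -> resolved KU.
Proof.
move=> phiH psiH KSU KUS [R [F [q [b [qH bH q0 bq bS]]]]].
have [phiD _] := phiH; have [psiD _] := psiH; have [qD _] := qH; have [bD _] := bH.
have bq0 s : b (q s) = 0 by apply/bq; exists s.
have eH : ghom (fun s => s - psi (phi s)).
  by apply: ghom_add (ghom_opp _); [apply: ghom_id | apply: ghom_comp phiH psiH].
have e0 s : q s = 0 -> s - psi (phi s) = 0.
  by move/q0/KSU=> [_ ->]; rewrite subrr.
have [E EH Eq] := ghom_extend qH bH bq bS eH e0; have [ED _] := EH.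
exists (gsum U R), (gsum S F), (fun u => fjoin (u - phi (psi u)) (q (psi u))),
  (fun w => fjoin (E (fright w) - psi (fleft w)) (b (fright w))).
split.
- apply: ghom_fjoin; last exact: ghom_comp psiH qH.
  by apply: ghom_add (ghom_opp _); [apply: ghom_id | apply: ghom_comp psiH phiH].
- apply: ghom_fjoin; last exact: ghom_comp (ghom_fright _ _) bH.
  apply: ghom_add; first exact: ghom_comp (ghom_fright _ _) EH.
  by apply: ghom_opp; apply: ghom_comp (ghom_fleft _ _) psiH.
- move=> u; rewrite fjoin_eq0; split=> [[u0 qu] | Ku].
    by move/q0/KSU: qu => [+ _]; rewrite -(subr0_eq u0).
  have [Kp e] := KUS u Ku; rewrite e subrr; split=> //; exact/q0.
- move=> w; rewrite fjoin_eq0; split=> [[Ew /bq[s ws]] | [u ->]].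
    move: Ew; rewrite ws Eq => Ew.
    have es : s = psi (fleft w + phi s).
      by rewrite psiD -[LHS](subrK (psi (phi s))) (subr0_eq Ew).
    exists (fleft w + phi s); rewrite -es addrK -ws fjoinK //.
  rewrite fleftK frightK Eq (add_mapB psiD) bq0; split=> //.
  by rewrite opprB addrA subrK subrr.
move=> z; have [r br] := bS (fright z).
pose s := fleft z - E r.
exists (fjoin (- phi s) (r + q s)); rewrite fleftK frightK ED bD bq0 addr0 br Eq (add_mapN psiD).
by rewrite opprK addrA subrK /s addrCA subrr addr0 fjoinK.
Qed.
End Gsets.

(** * Equivariant choices and maps *)

(** A value fixed by the stabilizer of an orbit representative propagates along the orbit without
    ambiguity. *)
Lemma equivariant_choice (gT : finGroupType) (D H : {group gT}) (T : finType)
    (to : action D T) (Q : Type) (qa : Q -> gT -> Q) (P : T -> Q -> Prop) :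
  H \subset D ->
  (forall q g h, g \in H -> h \in H -> qa q (g * h)%g = qa (qa q g) h) ->
  (forall t q g, g \in H -> P t q -> P (to t g) (qa q g)) ->
  (forall t, exists q, P t q /\ forall g, g \in H -> to t g = t -> qa q g = q) ->
  exists f : T -> Q, (forall t, P t (f t)) /\
    forall t g, g \in H -> f (to t g) = qa (f t) g.
Proof.
move=> /subsetP sHD qaM PH exq.
have /fin_all_exists[q qP] := exq.
pose rep t := odflt t [pick s in orbit to H t].
have repO t : exists2 g, g \in H & to (rep t) g = t.
  rewrite /rep; case: pickP => [s /orbitP[g Hg <-] /= | /(_ t)].
    by exists g^-1%g; rewrite ?groupV ?actKin ?sHD.
  by rewrite /= orbit_refl.
have repA t g : g \in H -> rep (to t g) = rep t.
  move=> Hg; rewrite /rep; have -> : orbit to H (to t g) = orbit to H t.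
    by rewrite orbit_act_in //; apply/subsetP.
  by case: pickP => // /(_ t); rewrite /= orbit_refl.
have /fin_all_exists2[k Hk kE] := repO.
exists (fun t => qa (q (rep t)) (k t)); split=> [t | t g Hg].
  by have := PH _ _ _ (Hk t) (qP (rep t)).1; rewrite kE.
rewrite repA // -qaM //; set k' := k _; set s := rep t.
have Hk' : k' \in H := Hk _.
have e : to s k' = to s (k t * g)%g.
  by rewrite actMin ?sHD // /s /k' kE -(repA t g Hg) kE.
have -> : (k t * g = (k t * g * k'^-1) * k')%g by rewrite mulgKV.
rewrite [RHS]qaM ?groupM ?groupV //; congr (qa _ _).
by rewrite (qP s).2 ?groupM ?groupV // actMin ?sHD ?groupM ?groupV // -e actKin ?sHD.
Qed.

Lemma dvdn_logn m n : (0 < m)%N -> (0 < n)%N ->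
  (forall p, prime p -> (logn p m <= logn p n)%N) -> (m %| n)%N.
Proof.
move=> m0 n0 le_mn; apply/dvdn_partP => // p; rewrite mem_primes => /andP[pr_p _].
by rewrite p_part pfactor_dvdn // le_mn.
Qed.

Lemma bezout_family (I : finType) (m : I -> nat) :
  exists u : I -> int, \sum_i u i * (m i)%:Z = (\big[gcdn/0%N]_i m i)%:Z.
Proof.
apply: (big_ind (fun d : nat => exists u : I -> int, \sum_i u i * (m i)%:Z = d%:Z)).
- by exists (fun _ => 0); rewrite big1 // => i _; rewrite mul0r.
- move=> d1 d2 [u1 e1] [u2 e2]; have [a [b e]] := Bezoutz d1%:Z d2%:Z.
  exists (fun i => a * u1 i + b * u2 i).
  under eq_bigr do rewrite mulrDl -!mulrA.
  by rewrite big_split /= -!mulr_sumr e1 e2 e.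
move=> i _; exists (fun j => (j == i)%:Z); rewrite (bigD1 i) //= eqxx mul1r.
by rewrite big1 ?addr0 // => j /negPf->; rewrite mul0r.
Qed.

Lemma dvdn_biggcd_inf (I : finType) (m : I -> nat) i : (\big[gcdn/0%N]_j m j %| m i)%N.
Proof. by rewrite (bigD1 i) //= dvdn_gcdl. Qed.

Section Hom.
Variables (gT : finGroupType) (G : {group gT}).
Hypothesis ZG : Zgroup G.
Local Notation stab X x := ('C_G[x | gto X])%g.

Lemma mem_stab (X : gset G) (x : X) g :
  (g \in stab X x) = (g \in G) && (gto X x g == x).
Proof. by rewrite !inE sub1set inE; case: (g \in G). Qed.

(* Cyclic Sylow subgroups: any two p-subgroups of G are comparable up to conjugacy. *)
Lemma Zgroup_orbit_logn (X : gset G) (S : {group gT}) (x : X) p :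
  S \subset G -> prime p -> exists x' : X,
   (logn p #|orbit (gto X) S x'| <= logn p #|S| - logn p #|stab X x|)%N.
Proof.
move=> sSG pr_p; have [S2 sylS2] := Sylow_exists p S.
have [S1 sylS1] := Sylow_exists p 'C_G[x | gto X]%G.
have sS2G := subset_trans (pHall_sub sylS2) sSG.
have [P sylP sS2P] := Sylow_superset sS2G (pHall_pgroup sylS2).
have sS1G : S1 \subset G := subset_trans (pHall_sub sylS1) (subsetIl _ _).
have [g Gg sS1P] := Sylow_Jsub sylP sS1G (pHall_pgroup sylS1).
have cycP : cyclic P by apply: (forall_inP ZG); apply: p_Sylow sylP.
exists (gto X x g).
have sS1C : (S1 :^ g \subset stab X (gto X x g))%g.
  by rewrite astab1_act_in // -{1}(conjGid Gg) -conjIg conjSg (pHall_sub sylS1).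
rewrite (card_orbit_in _ _ sSG).
set C := 'C_S[_ | _]%g.
have cS : (#|S| = #|C| * #|S : C|%g)%N by rewrite Lagrange ?subsetIl.
have lS : logn p #|S| = (logn p #|C| + logn p #|S :
    C|%g)%N by rewrite cS lognM ?cardG_gt0 ?indexg_gt0.
have lS2 : logn p #|S2| = logn p #|S| by rewrite (card_Hall sylS2) p_part pfactorK.
have lS1 : logn p #|S1| = logn p #|stab X x| by rewrite (card_Hall sylS1) p_part pfactorK.
suffices : (logn p #|S2| <= logn p #|C|)%N \/ (logn p #|S1| <= logn p #|C|)%N by lia.
have pS2 := pHall_pgroup sylS2; have pS1 := pHall_pgroup sylS1.
have [k2 e2] := p_natP pS2; have [k1 e1] := p_natP pS1.
have [le21 | lt12] := leqP k2 k1.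
  left; apply: dvdn_leq_log; rewrite ?cardG_gt0 // cardSg // subsetI (pHall_sub sylS2).
  have : S2 \subset (S1 :^ g)%G.
    by rewrite -(cardSg_cyclic cycP) // cardJg e1 e2 dvdn_exp2l.
  by move/subset_trans/(_ sS1C); rewrite subsetI => /andP[].
right; rewrite -(cardJg S1 g); apply: dvdn_leq_log; rewrite ?cardG_gt0 // cardSg //.
have : (S1 :^ g)%G \subset S2.
  by rewrite -(cardSg_cyclic cycP) //= cardJg e1 e2 dvdn_exp2l // ltnW.
move/subset_trans/(_ (pHall_sub sylS2)) => sS; rewrite subsetI sS.
by move: sS1C; rewrite subsetI => /andP[].
Qed.

(** Indicator functions of [S]-orbits are invariant with total the orbit size, and Bezout combines
    them into one whose total is the gcd of the sizes. This gcd divides [c], one prime at a time by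
    [Zgroup_orbit_logn]. *)
Lemma exists_invariant_weight (X : gset G) (S : {group gT}) (c : nat) :
  S \subset G -> (0 < c)%N ->
  (forall p, prime p -> exists x : X, (logn p #|S| <= logn p #|stab X x| + logn p c)%N) ->
  exists w : {ffun X -> int}, \sum_x w x = c%:Z /\ forall g, g \in S -> ga g w = w.
Proof.
move=> sSG c0 hyp; pose m (x : X) := #|orbit (gto X) S x|.
have m0 x : (0 < m x)%N by apply/card_gt0P; exists x; apply: orbit_refl.
have [u ue] := bezout_family m; set d := \big[_/_]_i _ in ue.
have dc : (d %| c)%N.
  apply: dvdn_logn => // [|p pr_p]; have [x0 _] := hyp 2 isT.
    by apply: dvdn_gt0 (m0 x0) (dvdn_biggcd_inf m x0).
  have [x le_x] := hyp p pr_p; have [x' le_x'] := Zgroup_orbit_logn x sSG pr_p.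
  apply: leq_trans (dvdn_leq_log p (m0 x') (dvdn_biggcd_inf m x')) _.
  rewrite /m; lia.
have [k ck] := dvdnP dc.
exists [ffun y => \sum_x k%:Z * u x * (y \in orbit (gto X) S x)%:Z]; split.
  under eq_bigr do rewrite ffunE.
  rewrite exchange_big /= ck PoszM -ue mulr_sumr; apply: eq_bigr => x _.
  rewrite -mulr_sumr -mulrA; congr (_ * (_ * _)).
  rewrite (eq_bigr (fun y => if y \in orbit (gto X) S x then 1 else 0)); last by move=> y _;
      case: ifP.
  by rewrite -big_mkcond /= sumr_const natz.
move=> g Sg; apply/ffunP=> y; rewrite !ffunE; apply: eq_bigr => x _.
congr (_ * (nat_of_bool _)%:Z).
by apply: orbit_actr_in.
Qed.

(** The row of the matrix at [x2] is a weight on [X1] of total [c], invariant under the stabilizer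
    of [x2]; [equivariant_choice] assembles the rows. *)
Lemma exists_ghom_cst (X1 X2 : gset G) (c : nat) : (0 < c)%N ->
  (forall (x2 : X2) p, prime p ->
     exists x1 : X1, (logn p #|stab X2 x2| <= logn p #|stab X1 x1| + logn p c)%N) ->
  exists2 f : {ffun X1 -> int} -> {ffun X2 -> int},
    ghom f & forall n, f (cst X1 n) = cst X2 (c%:Z * n).
Proof.
move=> c0 hyp.
have [] := @equivariant_choice gT G G X2 (gto X2) {ffun X1 -> int} (fun w g => ga g^-1%g w)
   (fun _ w => \sum_x w x = c%:Z) (subxx _).
- by move=> w g h Gg Gh; rewrite invMg gaM ?groupV.
- move=> _ w g Gg <-; rewrite [RHS](reindex_inj (@act_inj _ _ _ (gto X1) g^-1%g)) /=.
  by apply: eq_bigr => x _; rewrite ffunE.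
- move=> x2; have [w [sw iw]] := exists_invariant_weight (subsetIl G 'C[x2 | gto X2]%g :
    'C_G[_ | _]%G \subset G) c0 (hyp x2).
  exists w; split=> // g Gg gx; apply: iw; rewrite groupV.
  by rewrite mem_stab Gg gx /=.
move=> k [sk kG].
exists (fun v => [ffun x2 => \sum_x1 k x2 x1 * v x1]); last first.
  move=> n; apply/ffunP=> x2; rewrite !ffunE; under eq_bigr do rewrite ffunE.
  by rewrite -mulr_suml sk.
split=> [u v | g v Gg]; apply/ffunP=> x2; rewrite !ffunE.
  by rewrite -big_split /=; apply: eq_bigr => x _; rewrite ffunE mulrDr.
rewrite (reindex_inj (@act_inj _ _ _ (gto X1) g^-1%g)) /=.
apply: eq_bigr => x _; rewrite kG // !ffunE actKVin //.
Qed.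
End Hom.

(** * Cyclic and dihedral coset spaces *)

(* With s acting on functions by (s v)(x) = v(s x), the function u = sum_(i < m) i s^i z
   satisfies s u - u = m z, and rounding u / m down commutes with s. *)
Lemma cyclic_coboundary (X : finType) (s : X -> X) m (z : {ffun X -> int}) :
  (0 < m)%N -> (forall x, z (iter m s x) = z x) ->
  (forall x, \sum_(i < m) z (iter i s x) = 0) ->
  exists z' : {ffun X -> int}, (forall x, z' (s x) - z' x = z x) /\
    forall t : X -> X, (forall x i, z (iter i s (t x)) = z (iter i s x)) ->
    forall x, z' (t x) = z' x.
Proof.
move=> m0 sm zs; pose u x := \sum_(i < m) i%:Z * z (iter i s x).
exists [ffun x => (u x %/ m%:Z)%Z]; split=> [x | t zt x]; last first.
  by rewrite !ffunE; congr (_ %/ _)%Z; apply: eq_bigr => i _; rewrite zt.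
have us : u (s x) = z x * m%:Z + u x.
  have := telescope_sumr (fun i => i%:Z * z (iter i s x)) (leq0n m).
  rewrite sm mul0r subr0 big_mkord sumrB -/(u x) => /eqP; rewrite subr_eq => /eqP e.
  rewrite mulrC -e -[LHS]addr0 -[X in _ + X](zs (s x)) -big_split /=.
  by apply: eq_bigr => i _; rewrite -iterSr /= -addn1 PoszD; ring.
by rewrite !ffunE us divzMDl; [ring | rewrite eqz_nat -lt0n].
Qed.

Section Cyclic.
Variables (gT : finGroupType) (G : {group gT}).
Implicit Types X Y : gset G.

Lemma iter_gto X (c : gT) i x : c \in G -> iter i (fun y => gto X y c) x = gto X x (c ^+ i)%g.
Proof.
move=> Gc; elim: i => [|i IHi] /=; first by rewrite act1.
by rewrite IHi expgSr actMin ?groupX.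
Qed.

Definition cycle_trans X (c : gT) := forall x y : X, exists i, y = gto X x (c ^+ i)%g.

Lemma cycle_trans_invariant X c (v : {ffun X -> int}) : c \in G -> cycle_trans X c ->
  (forall x, v (gto X x c) = v x) -> is_cst v.
Proof.
move=> Gc trc vc; case: (pickP (fun _ : X => true)) => [x0 _ | noX]; last first.
  by exists 0; apply/ffunP=> x; have := noX x.
exists (v x0); apply/ffunP=> x; rewrite ffunE; have [i ->] := trc x0 x.
by rewrite -iter_gto //; elim: i => //= i IHi; rewrite vc.
Qed.

(** The norm of [w] over the powers of [c] is invariant under [c], hence constant, and has total
    zero; so it vanishes, and [cyclic_coboundary] applies. *)
Lemma cycle_trans_coboundary X c (w : {ffun X -> int}) : c \in G -> cycle_trans X c ->
  \sum_x w x = 0 -> exists v : {ffun X -> int}, forall x, v (gto X x c) - v x = w x.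
Proof.
move=> Gc trc w0; have m0 := order_gt0 c.
have [|x|v [vE _]] := @cyclic_coboundary X (fun x => gto X x c) #[c]%g w m0; last by exists v.
  by move=> x; rewrite iter_gto // expg_order act1.
pose n : {ffun X -> int} := [ffun x => \sum_(i < #[c]%g) w (gto X x (c ^+ i)%g)].
have [k nk] : is_cst n.
  apply: (@cycle_trans_invariant X c) => // y; rewrite !ffunE.
  rewrite -[in RHS](prednK m0) -[in LHS](prednK m0) big_ord_recr big_ord_recl /= addrC.
  congr (_ + _); last first.
    by apply: eq_bigr => i _; rewrite -actMin ?groupX // -expgS.
  by rewrite -actMin ?groupX // -expgS prednK // expg_order ?expg0 !act1.
have : \sum_y n y = 0.
  under eq_bigr do rewrite ffunE.
  rewrite exchange_big /= big1 // => i _.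
  by rewrite -[RHS]w0 [RHS](reindex_inj (@act_inj _ _ _ (gto X) (c ^+ i)%g)).
rewrite nk; under eq_bigr do rewrite ffunE.
rewrite sumr_const => /eqP; rewrite mulrn_eq0 => /orP[/eqP X0|/eqP k0].
  by have /card0_eq/(_ x) := X0.
under eq_bigr do rewrite iter_gto //.
by have := congr1 (fun f : {ffun X -> int} => f x) nk; rewrite !ffunE k0.
Qed.

Definition ztotal X (v : {ffun X -> int}) : int := \sum_x v x.

Lemma ztotalD X : add_map (@ztotal X).
Proof. by move=> u v; rewrite /ztotal -big_split; apply: eq_bigr => x _; rewrite ffunE. Qed.

Lemma ztotal_ga X g v : @ztotal X (ga g v) = ztotal v.
Proof.
rewrite [RHS](reindex_inj (@act_inj _ _ _ (gto X) g)) /=.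
by apply: eq_bigr => x _; rewrite ffunE.
Qed.

Lemma ztotal_delta X (x : X) : ztotal (delta x) = 1.
Proof.
rewrite /ztotal (bigD1 x) //= ffunE eqxx big1 ?addr0 // => y /negPf ne.
by rewrite ffunE ne.
Qed.

Lemma ztotal_cst X n : ztotal (cst X n) = #|X|%:Z * n.
Proof. by rewrite /ztotal; under eq_bigr do rewrite ffunE; rewrite sumr_const -mulr_natl natz. Qed.

Lemma ghom_ztotal X : ghom (fun v : {ffun X -> int} => cst (gpt G) (ztotal v)).
Proof.
split=> [u v | g v Gg]; apply/ffunP=> z; rewrite !ffunE; last by rewrite ztotal_ga.
by rewrite ztotalD.
Qed.

Lemma ghom_cst_pt X : ghom (fun v : {ffun gpt G -> int} => cst X (v tt)).
Proof. by split=> [u v | g v Gg]; apply/ffunP=> z; rewrite !ffunE. Qed.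

Lemma ghom_scale X Y (f : {ffun X -> int} -> {ffun Y -> int}) (n : int) :
  ghom f -> ghom (fun v => f v *~ n).
Proof.
move=> [fD fG]; split=> [u v | g v Gg]; first by rewrite fD mulrzDl.
by rewrite fG // (add_map_int (@ga_add _ _ _ _)).
Qed.

Lemma ghom_ga X c : c \in G -> (forall g x, g \in G -> gto X (gto X x c) g = gto X (gto X x g) c) ->
  ghom (@ga _ _ X c).
Proof.
move=> Gc cX; split=> [|g v Gg]; first exact: ga_add.
by apply/ffunP=> x; rewrite !ffunE cX.
Qed.

(** Commuting with [G], the operator [c - 1] gives 0 -> J_X -> Z[X] -> Z -> 0, whose last map is the
    total. *)
Lemma resolved_cyclic X (x0 : X) c : c \in G -> cycle_trans X c ->
  (forall g x, g \in G -> gto X (gto X x c) g = gto X (gto X x g) c) ->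
  resolved (@is_cst _ _ X).
Proof.
move=> Gc trc cX; exists X, (gpt G), (fun v => ga c v - v), (fun v => cst (gpt G) (ztotal v)).
split; last 3 first.
- move=> v; split=> [/subr0_eq e | [n ->]]; last by rewrite ga_cst subrr.
  apply: (@cycle_trans_invariant X c) => // x.
  by have := congr1 (fun f : {ffun X -> int} => f x) e; rewrite ffunE.
- move=> w; split=> [/(congr1 (fun f : {ffun gpt G -> int} => f tt)) | [v ->]].
    rewrite !ffunE => /(cycle_trans_coboundary Gc trc)[v vE]; exists v.
    by apply/ffunP=> x; rewrite !ffunE -vE.
  by apply/ffunP=> z; rewrite !ffunE (add_mapB (@ztotalD X)) ztotal_ga subrr.
- move=> z; exists (delta x0 *~ z tt); apply/ffunP=> -[]; rewrite ffunE.
  by rewrite (add_map_int (@ztotalD X)) ztotal_delta intz.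
- apply: ghom_add (ghom_opp (@ghom_id _ _ X)); exact: ghom_ga.
exact: ghom_ztotal.
Qed.

Lemma resolved_sum X Y KX KY : @resolved _ G X KX -> @resolved _ G Y KY ->
  resolved (fun v : {ffun gsum X Y -> int} => KX (fleft v) /\ KY (fright v)).
Proof.
move=> [X1 [X2 [a [b [aH bH a0 ab bS]]]]] [Y1 [Y2 [a' [b' [aH' bH' a0' ab' bS']]]]].
exists (gsum X1 Y1), (gsum X2 Y2), (fun v => fjoin (a (fleft v)) (a' (fright v))),
  (fun v => fjoin (b (fleft v)) (b' (fright v))); split.
- by apply: ghom_fjoin; [apply: ghom_comp aH | apply: ghom_comp aH'];
    [apply: ghom_fleft | apply: ghom_fright].
- by apply: ghom_fjoin; [apply: ghom_comp bH | apply: ghom_comp bH'];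
    [apply: ghom_fleft | apply: ghom_fright].
- by move=> v; rewrite fjoin_eq0 a0 a0'.
- move=> w; rewrite fjoin_eq0 ab ab'; split=> [[[v e] [v' e']] | [v ->]].
    by exists (fjoin v v'); rewrite fleftK frightK -e -e' fjoinK.
  by rewrite fleftK frightK; split; [exists (fleft v) | exists (fright v)].
move=> z; have [w e] := bS (fleft z); have [w' e'] := bS' (fright z).
by exists (fjoin w w'); rewrite fleftK frightK e e' fjoinK.
Qed.

(** Every function on a point is constant, so the summand of the point contributes nothing to the
    quotient. *)
Lemma resolved_pt_sum X :
  resolved (fun v : {ffun gsum (gpt G) X -> int} => is_cst (fleft v) /\ is_cst (fright v)) ->
  resolved (@is_cst _ _ X).
Proof.
move=> [Y [W [a [b [aH bH a0 ab bS]]]]].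
have jH : ghom (fun v : {ffun X -> int} => fjoin (0 : {ffun gpt G -> int}) v).
  apply: (@ghom_fjoin _ _ (gpt G) X X (fun=> 0)); last exact: ghom_id.
  by split=> [u v | g v Gg]; rewrite ?addr0 // (add_map0 (@ga_add _ _ _ _)).
have c0 (u : {ffun gpt G -> int}) : is_cst u.
  by exists (u tt); apply/ffunP=> -[]; rewrite ffunE.
exists Y, W, (a \o fun v : {ffun X -> int} => fjoin (0 : {ffun gpt G -> int}) v), b; split=> //.
- exact: ghom_comp jH aH.
- by move=> v /=; rewrite a0 fleftK frightK; split=> [[]|].
move=> w; rewrite ab; split=> [[v ->] | [v ->]]; last by exists (fjoin 0 v).
exists (fright v); have [aD _] := aH; apply/subr0_eq; rewrite /= -(add_mapB aD); apply/a0.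
split=> //; exists 0; apply/ffunP=> x; rewrite !ffunE subrr //.
Qed.
End Cyclic.

Section Dihedral.
Variables (gT : finGroupType) (G : {group gT}) (X : gset G) (x0 : X) (c : gT).
Hypotheses (Gc : c \in G) (oddc : odd #[c]%g) (trc : cycle_trans X c).
Hypothesis cX : forall g, g \in G ->
  (forall x, gto X (gto X x c) g = gto X (gto X x g) c) \/
  (forall x, gto X (gto X x c) g = gto X (gto X x g) c^-1%g).

(** Tells whether [g] commutes with [c] on [X] or only inverts it; [true] is the sign +1, and
    equality of booleans is multiplication of signs. *)
Let sgn g := [forall x, gto X (gto X x c) g == gto X (gto X x g) c].
Let pw (s : bool) x := gto X x (if s then c else c^-1%g).

Let pwK s x : pw s (pw (~~ s) x) = x.
Proof. by case: s; rewrite /pw /= ?actKVin ?actKin. Qed.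

Let sgnN g : g \in G -> ~~ sgn g -> forall x, gto X (gto X x c) g = gto X (gto X x g) c^-1%g.
Proof. by move=> Gg; case: (cX Gg) => // cg; rewrite /sgn; case: forallP => // -[] x;
    rewrite cg. Qed.

Let pwg g s x : g \in G -> gto X (pw s x) g = pw (s == sgn g) (gto X x g).
Proof.
move=> Gg; have base y : gto X (pw true y) g = pw (sgn g) (gto X y g).
  have [/forallP/(_ y)/eqP -> // | ns] := boolP (sgn g).
  by rewrite /pw sgnN.
case: s; first by rewrite base; case: (sgn g).
rewrite -{2}(pwK true x) base /=.
by case: (sgn g) => /=; [rewrite (pwK false) | rewrite (pwK true)].
Qed.

(** [c ^+ 2] generates [<[c]>] since the order is odd: an odd exponent is first increased by [#[c]],
    then halved. *)
Let trc2 : cycle_trans X (c ^+ 2)%g.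
Proof.
move=> x y; have [i ->] := trc x y.
exists (if odd i then (i + #[c]%g)./2 else i./2); rewrite -expgM mul2n.
case: ifP => oi; last by rewrite halfK oi subn0.
by rewrite halfK oddD oi oddc subn0 expgD expg_order mulg1.
Qed.

(** If [c] and [c^-1] agree at one point, then [c ^+ 2] fixes it, hence by transitivity every point;
    so [c] and [c^-1] agree on [X], and [sgn g] would be true. *)
Let ncc g x : g \in G -> ~~ sgn g -> pw true x != pw false x.
Proof.
move=> Gg ns; apply/eqP=> e; case/negP: (ns).
have e2 : gto X x (c ^+ 2)%g = x.
  by rewrite expgS expg1 actMin // -[gto X x c]/(pw true x) e; apply: (pwK true).
have fix2 y : gto X y (c ^+ 2)%g = y.
  have [i ->] := trc2 x y.
  by rewrite -actMin ?groupX // -expgSr expgS actMin ?groupX // e2.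
apply/forallP=> y; rewrite (sgnN Gg ns); apply/eqP/(act_inj (gto X) c).
by rewrite actKVin // -actMin // -expgS fix2.
Qed.

Let sgnM g h : g \in G -> h \in G -> sgn (g * h)%g = (sgn g == sgn h).
Proof.
move=> Gg Gh.
have e x : pw (sgn (g * h)%g) (gto X x (g * h)%g) = pw (sgn g == sgn h) (gto X x (g * h)%g).
  rewrite -(pwg true) ?groupM // actMin // pwg // pwg // -actMin //.
have [//|/negP ne] := boolP (sgn (g * h)%g == (sgn g == sgn h)); first by move/eqP.
have [k Gk nk] : exists2 k, k \in G & ~~ sgn k.
  case: (boolP (sgn g)) => sg; last by exists g.
  case: (boolP (sgn h)) => sh; last by exists h.
  by exists (g * h)%g; [rewrite groupM | move: ne; rewrite sg sh eqxx; case: (sgn _) => // []].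
have /eqP[] := ncc (gto X x0 (g * h)%g) Gk nk.
by have := e x0; case: (sgn (g * h)%g) (sgn g == sgn h) ne => [] [] // _ ->.
Qed.

Fact sign_is_action : is_action G (fun (s : bool) g => if g \in G then s == sgn g else s).
Proof.
split=> [g s t | s g h Gg Gh]; first by case: ifP => _ //; case: s t (sgn g) => [] [] [].
by rewrite Gg Gh groupM // sgnM //; case: s (sgn g) (sgn h) => [] [] [].
Qed.
Let E := Gset (Action sign_is_action).

Lemma resolved_dihedral : resolved (@is_cst _ _ X).
Proof.
have Xodd : odd #|X|.
  have eX : orbit (gto X) <[c]>%g x0 = [set: X].
    apply/setP=> x; rewrite inE; have [i ->] := trc x0 x.
    by apply: mem_orbit; apply: mem_cycle.
  have sc : <[c]>%g \subset G by rewrite cycle_subG.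
  rewrite -cardsT -eX card_orbit_in //.
  by apply: dvdn_odd oddc; rewrite dvdn_indexg.
(* The choice 2k - #|X| = 1 gives exactness over the integers: the total of [b1 w] minus that of
   [b2 w] is (2k - #|X|) w(tt) = w(tt), so the extra coordinate is determined by the image. *)
pose k := (#|X|.+1)./2; have kX : (2%:Z * k%:Z = #|X|%:Z + 1).
  by rewrite -PoszM -[1]/(1%:Z) -PoszD /k mul2n halfK /= Xodd subn0 addn1.
pose a1 (v : {ffun X -> int}) : {ffun gprod X E -> int} :=
  [ffun z : X * bool => v (pw z.2 z.1) - v (pw (~~ z.2) z.1)].
have a1H : ghom a1.
  split=> [u v | g v Gg]; apply/ffunP=> -[x s]; rewrite !ffunE /=; first ring.
  rewrite Gg !pwg //; congr (_ - v (pw _ _)).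
  by case: s; case: (sgn g).
pose b1 (w : {ffun gsum (gprod X E) (gpt G) -> int}) : {ffun E -> int} :=
  [ffun s : bool => \sum_x w (inl (x, s)) + k%:Z * w (inr tt)].
pose b2 (w : {ffun gsum (gprod X E) (gpt G) -> int}) : {ffun X -> int} :=
  [ffun x => w (inl (x, true)) + w (inl (x, false)) + w (inr tt)].
have b1H : ghom b1.
  split=> [u v | g v Gg]; apply/ffunP=> s; rewrite !ffunE /=.
    under eq_bigr do rewrite ffunE.
    by rewrite big_split /=; ring.
  rewrite [in RHS](reindex_inj (@act_inj _ _ _ (gto X) g)) /=.
  by congr (_ + _); apply: eq_bigr => x _; rewrite ffunE.
have b2H : ghom b2.
  split=> [u v | g v Gg]; apply/ffunP=> x; rewrite !ffunE /=; first ring.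
  by rewrite Gg; case: (sgn g) => //=; rewrite [X in X + _]addrC.
exists (gsum (gprod X E) (gpt G)), (gsum E X), (fun v => fjoin (a1 v) (0 : {ffun gpt G -> int})),
  (fun w => fjoin (b1 w) (b2 w)).
split.
- apply: ghom_fjoin a1H _.
  by split=> [u v | g v Gg]; rewrite ?addr0 // (add_map0 (@ga_add _ _ _ _)).
- exact: ghom_fjoin.
- move=> v; rewrite fjoin_eq0; split=> [[e _] | [n ->]]; last first.
    by split=> //; apply/ffunP=> z; rewrite !ffunE subrr.
  apply: (@cycle_trans_invariant _ _ X (c ^+ 2)%g) => [||x]; rewrite ?groupX //.
  have := congr1 (fun f : {ffun gprod X E -> int} => f (pw true x, true)) e.
  rewrite !ffunE /= (pwK false) => /subr0_eq <-.
  by rewrite expgS expg1 actMin.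
- move=> w; rewrite fjoin_eq0; split=> [[e1 e2] | [v ->]]; last first.
    split; apply/ffunP=> z; rewrite !ffunE; last by rewrite /=; ring.
    under eq_bigr do rewrite !ffunE.
    have sumpw s : \sum_x v (pw s x) = \sum_x v x.
      by rewrite [RHS](reindex_inj (@act_inj _ _ _ (gto X) (if s then c else c^-1%g))).
    by rewrite sumrB mulr0 addr0 /= !sumpw subrr.
  have E1 s : \sum_x w (inl (x, s)) = - (k%:Z * w (inr tt)).
    have := congr1 (fun f : {ffun E -> int} => f s) e1; rewrite !ffunE => /eqP.
    by rewrite addr_eq0 => /eqP.
  have E2 x : w (inl (x, false)) = - w (inl (x, true)) - w (inr tt).
    have := congr1 (fun f : {ffun X -> int} => f x) e2; rewrite !ffunE => e.
    by rewrite -[LHS]subr0 -e; ring.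
  have w0 : w (inr tt) = 0.
    have := E1 false; under eq_bigr do rewrite E2.
    rewrite sumrB sumrN E1 sumr_const -mulr_natl natz.
    move=> e; have -> : w (inr tt) = (2%:Z * k%:Z - #|X|%:Z) * w (inr tt) by rewrite kX; ring.
    by move/eqP: e; rewrite -subr_eq0 => /eqP <-; ring.
  have [|v vE] := @cycle_trans_coboundary _ _ X (c ^+ 2)%g [ffun x => w (inl (x, true))]
     (groupX 2 Gc) trc2.
    by under eq_bigr do rewrite ffunE; rewrite E1 w0 mulr0 oppr0.
  (* The shift by [c] turns v(x c^2) - v(x) into the antisymmetric difference computed by [a1]. *)
  exists (ga c v); rewrite -[LHS]fjoinK; congr fjoin; last first.
    by apply/ffunP=> -[]; rewrite !ffunE.
  have vE' x : w (inl (x, true)) = v (gto X (pw true x) c) - v x.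
    by have := vE x; rewrite ffunE expgS expg1 actMin.
  apply/ffunP=> -[x s]; rewrite !ffunE /=.
  have pc y : gto X (pw false y) c = y by rewrite /pw actKVin.
  by case: s; rewrite /= ?E2 vE' pc ?w0 ?subr0 ?opprB.
move=> z; pose e s := z (inl s); pose w x := z (inr x).
(* [t] is the forced extra coordinate. The negative copy is concentrated at [x0], where [e'] yields
   the required value at [false]; [b2] then forces the positive copy. *)
pose t := e true + e false - \sum_x w x.
have tE : \sum_x w x = e true + e false - t by rewrite /t; ring.
clearbody t; pose e' := e false - k%:Z * t.
exists (fjoin ([ffun y : X * bool => if y.2 then w y.1 - t - (y.1 == x0)%:Z * e'
    else (y.1 == x0)%:Z * e'] : {ffun gprod X E -> int}) (cst (gpt G) t)).
have sx0 : \sum_x (x == x0)%:Z * e' = e'.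
  by rewrite (bigD1 x0) //= eqxx mul1r big1 ?addr0 // => x /negPf->; rewrite mul0r.
apply/ffunP=> -[s|x]; rewrite !ffunE /=; last by rewrite /w; ring.
under eq_bigr do rewrite !ffunE /=.
case: s; last by rewrite sx0 /e' /e; ring.
rewrite !sumrB sx0 sumr_const -mulr_natl natz.
rewrite (_ : #|X|%:Z = 2%:Z * k%:Z - 1); last by rewrite kX addrK.
rewrite tE /e' /e; ring.
Qed.
End Dihedral.

(** * Reduction to two coset spaces of coprime sizes *)

Section Coprime.
Variables (gT : finGroupType) (G : {group gT}).
Hypothesis ZG : Zgroup G.
Local Notation stab X x := ('C_G[x | gto X])%g.
Variables (X A B : gset G).
Hypotheses (sA : forall x : A, (#|stab A x| * #|A| = #|G|)%N).
Hypotheses (sB : forall x : B, (#|stab B x| * #|B| = #|G|)%N).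
Hypotheses (A0 : (0 < #|A|)%N) (B0 : (0 < #|B|)%N) (coAB : coprime #|A| #|B|).
(** With [Xge], this says prime by prime that the gcd of the indices of the stabilizers in [X] is
    the product of [#|A|] and [#|B|]. *)
Hypothesis Xle : forall (x : X) p, prime p ->
  (logn p #|stab X x| + logn p (#|A| * #|B|) <= logn p #|G|)%N.
Hypothesis Xge : forall p, prime p -> exists x : X,
  (logn p #|G| <= logn p #|stab X x| + logn p (#|A| * #|B|))%N.

(* On the invariants Z^2 of Z[A] + Z[B] and of Z + Z[X], [phi] and [psi] are given by
   the mutually inverse matrices [[a u, - b v], [1, 1]] and [[1, b v], [-1, a u]],
   where a = #|A|, b = #|B| and a u + b v = 1. *)
Lemma resolved_coprime :
  resolved (@is_cst _ _ A) -> resolved (@is_cst _ _ B) -> resolved (@is_cst _ _ X).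
Proof.
move=> rA rB; apply: resolved_pt_sum.
have lnA p x : logn p #|G| = (logn p #|stab A x| + logn p #|A|)%N.
  by rewrite -(sA x) lognM ?cardG_gt0.
have lnB p x : logn p #|G| = (logn p #|stab B x| + logn p #|B|)%N.
  by rewrite -(sB x) lognM ?cardG_gt0.
have lnM p : logn p (#|A| * #|B|) = (logn p #|A| + logn p #|B|)%N by rewrite lognM.
have [xA _] := card_gt0P A0; have [xB _] := card_gt0P B0.
have [fAX fAXH fAXc] : exists2 f : {ffun A -> int} -> {ffun X -> int},
    ghom f & forall n, f (cst A n) = cst X (1%:Z * n).
  apply: (exists_ghom_cst ZG) => // x p pr_p; exists xA.
  by have := Xle x pr_p; rewrite lnM (lnA p xA); lia.
have [fBX fBXH fBXc] : exists2 f : {ffun B -> int} -> {ffun X -> int},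
    ghom f & forall n, f (cst B n) = cst X (1%:Z * n).
  apply: (exists_ghom_cst ZG) => // x p pr_p; exists xB.
  by have := Xle x pr_p; rewrite lnM (lnB p xB); lia.
have [fXA fXAH fXAc] : exists2 f : {ffun X -> int} -> {ffun A -> int},
    ghom f & forall n, f (cst X n) = cst A (#|B|%:Z * n).
  apply: (exists_ghom_cst ZG) => // x p pr_p; have [y] := Xge pr_p; exists y.
  by have := lnA p x; have := lnM p; lia.
have [fXB fXBH fXBc] : exists2 f : {ffun X -> int} -> {ffun B -> int},
    ghom f & forall n, f (cst X n) = cst B (#|A|%:Z * n).
  apply: (exists_ghom_cst ZG) => // x p pr_p; have [y] := Xge pr_p; exists y.
  by have := lnB p x; have := lnM p; lia.
have [u [v uv]] := Bezoutz #|A|%:Z #|B|%:Z.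
have {}uv : u * #|A|%:Z + v * #|B|%:Z = 1 by rewrite uv /gcdz /= (eqP coAB).
pose phi (s : {ffun gsum A B -> int}) : {ffun gsum (gpt G) X -> int} :=
  fjoin (cst (gpt G) (ztotal (fleft s)) *~ u - cst (gpt G) (ztotal (fright s)) *~ v)
        (fAX (fleft s) + fBX (fright s)).
pose psi (t : {ffun gsum (gpt G) X -> int}) : {ffun gsum A B -> int} :=
  fjoin (cst A (fleft t tt) + fXA (fright t) *~ v)
        (fXB (fright t) *~ u - cst B (fleft t tt)).
have cstZ (Y : gset G) m n : cst Y m *~ n = cst Y (m * n).
  by apply/ffunP=> y; rewrite ffun_mulzE !ffunE mulrzz.
have cstD (Y : gset G) m n : cst Y m + cst Y n = cst Y (m + n).
  by apply/ffunP=> y; rewrite !ffunE.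
have phiE m n : phi (fjoin (cst A m) (cst B n)) =
    fjoin (cst (gpt G) (#|A|%:Z * m * u - #|B|%:Z * n * v)) (cst X (m + n)).
  by rewrite /phi !fleftK !frightK !ztotal_cst !cstZ -cstB fAXc fBXc cstD !mul1r.
have psiE m n : psi (fjoin (cst (gpt G) m) (cst X n)) =
    fjoin (cst A (m + #|B|%:Z * n * v)) (cst B (#|A|%:Z * n * u - m)).
  by rewrite /psi !fleftK !frightK fXAc fXBc !cstZ cstD ffunE -cstB.
apply: (@resolved_transfer _ _ _ _ _ _ phi psi) (resolved_sum rA rB).
- apply: ghom_fjoin; apply: ghom_add.
  + by apply: ghom_scale; apply: ghom_comp (ghom_fleft _ _) (ghom_ztotal A).
  + by apply: ghom_opp; apply: ghom_scale; apply: ghom_comp (ghom_fright _ _) (ghom_ztotal B).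
  + exact: ghom_comp (ghom_fleft _ _) fAXH.
  + exact: ghom_comp (ghom_fright _ _) fBXH.
- apply: ghom_fjoin; apply: ghom_add.
  + exact: ghom_comp (ghom_fleft _ _) (ghom_cst_pt A).
  + by apply: ghom_scale; apply: ghom_comp (ghom_fright _ _) fXAH.
  + by apply: ghom_scale; apply: ghom_comp (ghom_fright _ _) fXBH.
  + by apply: ghom_opp; apply: ghom_comp (ghom_fleft _ _) (ghom_cst_pt B).
- move=> s [[m sm] [n sn]]; rewrite -(fjoinK s) sm sn phiE psiE fleftK frightK.
  split; first by split; [exists (#|A|%:Z * m * u - #|B|%:Z * n * v) | exists (m + n)].
  congr (fjoin (cst A _) (cst B _)).
    by rewrite -[RHS]mulr1 -uv; ring.
  by rewrite -[RHS]mulr1 -uv; ring.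
move=> s [[m sm] [n sn]]; rewrite -(fjoinK s) sm sn psiE phiE fleftK frightK.
split; first by split; [exists (m + #|B|%:Z * n * v) | exists (#|A|%:Z * n * u - m)].
congr (fjoin (cst _ _) (cst X _)).
  by rewrite -[RHS]mulr1 -uv; ring.
by rewrite -[RHS]mulr1 -uv; ring.
Qed.
End Coprime.

(** * The obstruction at a normal Sylow subgroup *)

(** For the exact sequence 0 -> F^m -> F^n -> F -> 0 given by [A] and [C], the matrix [B = (A v)] is
    invertible and conjugates [P] to a block triangular matrix with diagonal blocks [Q] and [mu]. *)
Lemma det_exact_ratio (F : fieldType) n m (A : 'M[F]_(n, m)) (C : 'rV[F]_n)
    (v : 'cV[F]_n) (P : 'M[F]_n) (Q : 'M[F]_m) mu :
  (forall x : 'cV_m, A *m x = 0 -> x = 0) ->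
  (forall e : 'cV_n, C *m e = 0 -> exists x, e = A *m x) ->
  C *m A = 0 -> C *m v = 1%:M -> P *m A = A *m Q -> C *m P = mu *: C ->
  \det P = \det Q * mu.
Proof.
move=> injA exA CA Cv PA CP.
pose B := row_mx A v.
have injB (x : 'cV_(m + 1)) : B *m x = 0 -> x = 0.
  rewrite -[x]vsubmxK mul_row_col => e.
  have d0 : dsubmx x = 0.
    have := congr1 (mulmx C) e.
    by rewrite mulmxDr !mulmxA CA mul0mx add0r Cv mul1mx mulmx0.
  move: e; rewrite d0 mulmx0 addr0 => /injA->; exact: col_mx0.
have [B' BB'] : exists B', B *m B' = 1%:M.
  have /fin_all_exists[a aE] (j : 'I_n) : exists x, col j (1%:M - v *m C) = A *m x.
    by apply: exA; rewrite colE mulmxA mulmxBr mulmx1 mulmxA Cv mul1mx subrr mul0mx.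
  exists (col_mx (\matrix_(i, j) a j i 0) C).
  suffices -> : B *m col_mx (\matrix_(i, j) a j i 0) C = (1%:M - v *m C) + v *m C by rewrite subrK.
  rewrite mul_row_col; congr (_ + _); apply/matrixP=> i j.
  have := congr1 (fun M : 'cV_n => M i 0) (aE j); rewrite [col _ _ _ _]mxE => ->.
  by rewrite !mxE; apply: eq_bigr => k _; rewrite !mxE.
have B'B : B' *m B = 1%:M.
  apply/eqP; rewrite -subr_eq0; apply/eqP/matrixP=> i j.
  have : col j (B' *m B - 1%:M) = 0.
    by apply: injB; rewrite colE mulmxA mulmxBr mulmxA BB' mul1mx mulmx1 subrr mul0mx.
  by move/(congr1 (fun M : 'cV_(m + 1) => M i 0)); rewrite !mxE.
have en : n = (m + 1)%N.
  apply/eqP; rewrite eqn_leq -{1}(mxrank1 F n) -BB' (leq_trans (mxrankM_maxl _ _)) ?rank_leq_col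
      //=.
  by rewrite -{1}(mxrank1 F (m + 1)) -B'B (leq_trans (mxrankM_maxl _ _)) ?rank_leq_col.
clear injB; subst n.
have [d dE] : exists d, P *m v - mu *: v = A *m d.
  by apply: exA; rewrite mulmxBr mulmxA CP -scalemxAl -scalemxAr subrr.
have PB : P *m B = B *m block_mx Q d 0 mu%:M.
  rewrite mul_mx_row mul_row_block mulmx0 addr0 PA -dE; congr row_mx.
  by rewrite mul_mx_scalar subrK.
have detB : \det B != 0.
  by apply/eqP=> B0; have := congr1 determinant BB';
      rewrite det_mulmx B0 mul0r det1 => /esym/eqP; rewrite oner_eq0.
have := congr1 determinant PB; rewrite !det_mulmx det_ublock det_scalar1 mulrC.
by move/(mulfI detB).
Qed.

(** Permutation matrices have determinant 1 or -1, so [det_exact_ratio] makes [l] a quotient of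
    signs. *)
Lemma perm_ratio_sqr1 (F : fieldType) (I K : finType) (tI : {perm I}) (tK : {perm K})
    (Phi : K -> I -> F) (c : K -> F) (l : F) :
  (forall a : I -> F, (forall k, \sum_i Phi k i * a i = 0) -> forall i, a i = 0) ->
  (forall e : K -> F, \sum_k c k * e k = 0 -> exists a :
      I -> F, forall k, e k = \sum_i Phi k i * a i) ->
  (forall i, \sum_k c k * Phi k i = 0) ->
  (exists e : K -> F, \sum_k c k * e k = 1) ->
  (forall k i, Phi (tK k) (tI i) = Phi k i) ->
  (forall k, c (tK k) = l * c k) -> l ^+ 2 = 1.
Proof.
move=> inj mid comp [e0 e0E] PhiE cE.
pose A := \matrix_(k < #|K|, i < #|I|) Phi (enum_val k) (enum_val i).
pose C := \row_(k < #|K|) c (enum_val k).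
pose v := \col_(k < #|K|) e0 (enum_val k).
have rperm_inj (T : finType) (t : {perm T}) : injective (fun k :
    'I_#|T| => enum_rank (t (enum_val k))).
  by move=> k k' /enum_rank_inj/perm_inj/enum_val_inj.
pose sK := perm (@rperm_inj K tK); pose sI := perm (@rperm_inj I tI).
have sumK (T : finType) (f : T -> F) : \sum_(k < #|T|) f (enum_val k) = \sum_k f k.
  by rewrite [RHS](reindex _ (onW_bij _ (enum_val_bij T))).
have CsK : C *m perm_mx sK^-1%g = l *: C.
  rewrite -col_permE; apply/rowP=> k; rewrite !mxE permE enum_rankK; exact: cE.
have AsK : perm_mx sK^-1%g *m A = A *m perm_mx sI^-1%g.
  apply: (can_inj (mulKmx (unitmx_perm F sK))); rewrite !mulmxA -perm_mxM mulgV perm_mx1 mul1mx.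
  rewrite -row_permE -col_permE; apply/matrixP=> k i; rewrite !mxE !permE !enum_rankK.
  by rewrite PhiE.
have e : \det (perm_mx sK^-1%g : 'M[F]__) = \det (perm_mx sI^-1%g) * l; last first.
  have := congr1 (fun x => x ^+ 2) e.
  by rewrite !det_perm exprMn !sqrr_sign mul1r.
apply: (@det_exact_ratio F _ _ A C v) => //.
- move=> x Ax; apply/colP=> i; rewrite mxE -[i]enum_valK.
  apply: (inj (fun i => x (enum_rank i) 0)) => k.
  have := congr1 (fun M : 'cV_#|K| => M (enum_rank k) 0) Ax; rewrite !mxE => e.
  by rewrite -sumK -[RHS]e; apply: eq_bigr => j _; rewrite !mxE enum_valK enum_rankK.
- move=> e Ce; have [|a aE] := mid (fun k => e (enum_rank k) 0).
    have := congr1 (fun M : 'M_1 => M 0 0) Ce; rewrite !mxE => E.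
    by rewrite -sumK -[RHS]E; apply: eq_bigr => j _; rewrite !mxE enum_valK.
  exists (\col_i a (enum_val i)); apply/colP=> k; rewrite -[k]enum_valK aE !mxE -[LHS]sumK.
  by apply: eq_bigr => j _; rewrite !mxE enum_rankK.
- apply/rowP=> i; rewrite !mxE -[RHS](comp (enum_val i)) -[RHS]sumK.
  by apply: eq_bigr => j _; rewrite !mxE.
- apply/rowP=> i; rewrite !mxE ord1 eqxx -[RHS]e0E -[RHS]sumK.
  by apply: eq_bigr => j _; rewrite !mxE.
Qed.

(** * Traces for a cyclic p-group over its subgroup of p-th powers *)

Section Trace.
Variables (gT : finGroupType) (G : {group gT}) (p : nat) (s : gT).
Hypotheses (pr_p : prime p) (Gs : s \in G) (ps : (p.-elt s)%g).
Implicit Type Y : gset G.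

(** On functions invariant under [s ^+ p], this is the norm for [<[s]> / <[s ^+ p]>], which has
    order [p] when [s] is nontrivial; [pinv] is this invariance. *)
Definition ptrace Y (v : {ffun Y -> int}) : {ffun Y -> int} := \sum_(i < p) ga (s ^+ i)%g v.
Definition pinv Y (v : {ffun Y -> int}) := ga (s ^+ p)%g v = v.

Lemma ptraceD Y : add_map (@ptrace Y).
Proof. by move=> u v; rewrite /ptrace -big_split; apply: eq_bigr => i _; rewrite ga_add. Qed.

Lemma ghom_ptrace Y Y' (f : {ffun Y -> int} -> {ffun Y' -> int}) v :
  ghom f -> f (ptrace v) = ptrace (f v).
Proof.
by case=> fD fG; rewrite /ptrace add_map_sum //; apply: eq_bigr => i _; rewrite fG ?groupX.
Qed.

Lemma ghom_pinv Y Y' (f : {ffun Y -> int} -> {ffun Y' -> int}) v :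
  ghom f -> pinv v -> pinv (f v).
Proof. by case=> fD fG vp; rewrite /pinv -fG ?groupX // vp. Qed.

Lemma pinvD Y (u v : {ffun Y -> int}) : pinv u -> pinv v -> pinv (u + v).
Proof. by rewrite /pinv ga_add => -> ->. Qed.

Lemma pinvN Y (v : {ffun Y -> int}) : pinv v -> pinv (- v).
Proof. by rewrite /pinv (add_mapN (@ga_add _ _ _ _)) => ->. Qed.

Lemma inv_pinv Y (v : {ffun Y -> int}) : ga s v = v -> pinv v.
Proof.
move=> vs; rewrite /pinv; elim: p => [|k IHk]; first by rewrite ga1.
by rewrite expgS gaM ?groupX // IHk.
Qed.

Lemma ptrace_succ Y (v : {ffun Y -> int}) :
  ga s (ptrace v) - ptrace v = ga (s ^+ p)%g v - v.
Proof.
rewrite /ptrace (add_map_sum (@ga_add _ _ _ s)) -sumrB.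
have := telescope_sumr (fun i => ga (s ^+ i)%g v) (leq0n p).
rewrite ga1 big_mkord => <-; apply: eq_bigr => i _.
by rewrite -gaM ?groupX // -expgS.
Qed.

Lemma ptrace_inv Y (v : {ffun Y -> int}) : pinv v -> ga s (ptrace v) = ptrace v.
Proof. by move=> vp; apply/subr0_eq; rewrite ptrace_succ vp subrr. Qed.

Lemma ptrace_pinv Y (v : {ffun Y -> int}) : pinv v -> pinv (ptrace v).
Proof. by move/ptrace_inv/inv_pinv. Qed.

Lemma ptrace_fix Y (v : {ffun Y -> int}) y : gto Y y s = y -> ptrace v y = p%:Z * v y.
Proof.
move=> ys; have yi i : gto Y y (s ^+ i)%g = y.
  by rewrite -iter_gto //; elim: i => //= i ->.
rewrite /ptrace sum_ffunE; under eq_bigr do rewrite ffunE yi.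
by rewrite sumr_const card_ord -mulr_natl natz.
Qed.

(** [cyclic_coboundary] with m = p solves the equation, and its second clause, applied to [s ^+ p],
    keeps the solution invariant. *)
Lemma ptrace_eq0 Y (z : {ffun Y -> int}) : pinv z -> ptrace z = 0 ->
  exists2 z', pinv z' & ga s z' - z' = z.
Proof.
move=> zp z0.
have zE x i : z (gto Y (gto Y x (s ^+ p)%g) (s ^+ i)%g) = z (gto Y x (s ^+ i)%g).
  rewrite -actMin ?groupX // -expgD addnC expgD actMin ?groupX //.
  by have := congr1 (fun f : {ffun Y -> int} => f (gto Y x (s ^+ i)%g)) zp; rewrite ffunE.
have [||z' [zz zt]] := @cyclic_coboundary Y (fun x => gto Y x s) p z (prime_gt0 pr_p).
- by move=> x; have := zE x 0%N; rewrite iter_gto // expg0 !act1.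
- move=> x; have := congr1 (fun f : {ffun Y -> int} => f x) z0;
    rewrite /ptrace sum_ffunE ffunE => e.
  by rewrite -[RHS]e; apply: eq_bigr => i _; rewrite iter_gto // ffunE.
exists z'; last by apply/ffunP=> x; rewrite !ffunE zz.
by apply/ffunP=> x; rewrite ffunE; apply: (zt (fun x => gto Y x (s ^+ p)%g)) => y i;
    rewrite !iter_gto.
Qed.

Lemma fix_of_power Y (y : Y) i : ~~ (p %| i)%N -> gto Y y (s ^+ i)%g = y -> gto Y y s = y.
Proof.
move=> npi yi; have [k ok] := p_natP ps.
suffices : s \in 'C_G[y | gto Y]%G by rewrite mem_stab Gs => /eqP.
apply: (@mem_coprime_expg _ _ s i #[s]%g).
- by rewrite ok coprime_sym coprimeXl // prime_coprime.
- by rewrite /= mem_stab groupX //= yi.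
by rewrite expg_order group1.
Qed.

(** At a fixed point the trace multiplies by [p]. Any other orbit of [s] splits into [p] orbits of
    [s ^+ p], permuted cyclically, and [v] restricted to one of them has trace [v] there. *)
Lemma ptrace_surj Y (v : {ffun Y -> int}) : ga s v = v ->
  (forall y, gto Y y s = y -> (p%:Z %| v y)%Z) ->
  exists2 z, pinv z & ptrace z = v.
Proof.
move=> vs vp; pose H := <[s]>%g; have sHG : H \subset G by rewrite cycle_subG.
have vi y i : v (gto Y y (s ^+ i)%g) = v y.
  rewrite -iter_gto //; elim: i => //= i IHi.
  by rewrite -IHi; have := congr1 (fun f :
      {ffun Y -> int} => f (iter i (fun x => gto Y x s) y)) vs; rewrite ffunE.
pose rep y := odflt y [pick t in orbit (gto Y) H y].
have repE y : exists j, y = gto Y (rep y) (s ^+ j)%g.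
  rewrite /rep; case: pickP => [t /orbitP[h Hh <-] | /(_ y)]; last by rewrite /= orbit_refl.
  have /cycleP[j e] : (h^-1 \in H)%g by rewrite groupV.
  by exists j; rewrite -e actKin // (subsetP sHG).
have repA y i : rep (gto Y y (s ^+ i)%g) = rep y.
  rewrite /rep (_ : orbit _ _ _ = orbit (gto Y) H y); last by rewrite orbit_act_in ?mem_cycle.
  by case: pickP => // /(_ y); rewrite /= orbit_refl.
pose N := <[(s ^+ p)%g]>%g.
have fixA y i : (gto Y (gto Y y (s ^+ i)%g) s == gto Y y (s ^+ i)%g) = (gto Y y s == y).
  by rewrite -actMin ?groupX // -expgSr expgS actMin ?groupX // (inj_eq (@act_inj _ _ _ _ _)).
pose z : {ffun Y -> int} := [ffun y => if gto Y y s == y then (v y %/ p%:Z)%Z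
  else if y \in orbit (gto Y) N (rep y) then v y else 0].
have sNG : N \subset G by rewrite cycle_subG groupX.
exists z.
  apply/ffunP=> y; rewrite !ffunE fixA vi repA.
  by rewrite orbit_actr_in // cycle_id.
apply/ffunP=> y; have [/eqP fy | nfy] := boolP (gto Y y s == y).
  rewrite ptrace_fix // ffunE fy eqxx mulrC divzK //; exact: vp.
have [j yj] := repE y.
have nfr : ~~ (gto Y (rep y) s == rep y) by rewrite -(fixA _ j) -yj.
have orbE i : (gto Y y (s ^+ i)%g \in orbit (gto Y) N (rep y)) = (p %| j + i)%N.
  rewrite {1}yj -actMin ?groupX // -expgD; apply/orbitP/idP=> [[_ /cycleP[k ->]] | /dvdnP[k ->]].
    rewrite -expgM => e; apply/contraT => nd; case/negP: nfr; apply/eqP.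
    have [le | lt] := leqP (p * k) (j + i).
      apply: (@fix_of_power _ _ (j + i - p * k)%N).
        by rewrite dvdn_subl // ?dvdn_mulr.
      apply: (@act_inj _ _ _ (gto Y) (s ^+ (p * k))%g).
      by rewrite -actMin ?groupX // -expgD subnK.
    apply: (@fix_of_power _ _ (p * k - (j + i))%N).
      by rewrite dvdn_subr ?(ltnW lt) // dvdn_mulr.
    apply: (@act_inj _ _ _ (gto Y) (s ^+ (j + i))%g).
    by rewrite -actMin ?groupX // -expgD subnK ?(ltnW lt).
  by exists ((s ^+ p) ^+ k)%g; rewrite ?mem_cycle // -expgM mulnC.
rewrite /ptrace sum_ffunE.
have p0 := prime_gt0 pr_p.
(* The only i below p with p dividing j + i; the outer reduction serves the case where p divides
   j. *)
have i0p : ((p - j %% p) %% p < p)%N by rewrite ltn_mod.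
have dvE (i : 'I_p) : (p %| j + i)%N = (i == Ordinal i0p).
  rewrite -val_eqE /= /dvdn -modnDml; have := ltn_mod j p; rewrite p0.
  move: (j %% p)%N => r lt_r; have lt_i := ltn_ord i.
  have [-> | r0] := posnP r; first by rewrite add0n subn0 modnn modn_small.
  rewrite [in RHS]modn_small; last by lia.
  have [lt | le] := ltnP (r + i) p; first by rewrite modn_small //; lia.
  by rewrite -(subnK le) modnDr modn_small; lia.
rewrite (eq_bigr (fun i => if i == Ordinal i0p then v y else 0)).
  by rewrite -big_mkcond big_pred1_eq.
by move=> i _; rewrite !ffunE fixA (negPf nfy) repA orbE vi dvE.
Qed.
End Trace.

Lemma sum_blocks (V : zmodType) (F : nat -> V) r n :
  \sum_(i < n) \sum_(j < r) F (r * i + j)%N = \sum_(k < r * n) F k.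
Proof.
elim: n => [|n IHn]; first by rewrite muln0 !big_ord0.
by rewrite big_ord_recr IHn mulnSr big_split_ord /=.
Qed.

Lemma Fp_int_eq0 p (n : int) : prime p -> (n%:~R == 0 :> 'F_p) = (p%:Z %| n)%Z.
Proof.
move=> pr_p; rewrite dvdzE.
by case: n => n; rewrite ?NegzE ?abszN ?mulrNz ?oppr_eq0 -pmulrn -(dvdn_pcharf (pchar_Fp pr_p)).
Qed.

(** * The connecting map from the invariants of Z[W] to Z/p *)

Section Connecting.
Variables (gT : finGroupType) (G : {group gT}) (p : nat) (s : gT).
Hypotheses (pr_p : prime p) (Gs : s \in G) (ps : (p.-elt s)%g).
Variables (X Y W : gset G) (a : {ffun X -> int} -> {ffun Y -> int})
  (b : {ffun Y -> int} -> {ffun W -> int}).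
Hypotheses (aH : ghom a) (bH : ghom b) (a0 : forall v, a v = 0 <-> is_cst v)
  (ba : forall w, b w = 0 <-> exists v, w = a v) (bS : forall z, exists w, b w = z).
Variable x0 : X.
Hypotheses (x0p : gto X x0 (s ^+ p)%g = x0) (nofix : forall x, gto X x s <> x).

Let aD := aH.1.
Let bD := bH.1.
Let gaB h (Z : gset G) := add_mapB (@ga_add _ _ Z h).

Let ba0 v : b (a v) = 0. Proof. by apply/ba; exists v. Qed.

Let a_cst n : a (cst X n) = 0. Proof. by apply/a0; exists n. Qed.

Lemma invariant_preimage h x : h \in G -> ga h (a x) = a x -> ga h x = x.
Proof.
move=> Gh e; have /a0[n En] : a (ga h x - x) = 0 by rewrite (add_mapB aD) aH.2 // e subrr.
apply/subr0_eq; rewrite En; have := congr1 (@ztotal _ _ X) En.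
rewrite (add_mapB (@ztotalD _ _ X)) ztotal_ga subrr ztotal_cst => /esym/eqP.
rewrite mulf_eq0 eqz_nat => /orP[/eqP/card0_eq/(_ x0)//|/eqP->].
by apply/ffunP=> y; rewrite !ffunE.
Qed.

Lemma telescope_ga (Z : gset G) h (v : {ffun Z -> int}) n : h \in G ->
  \sum_(i < n) ga (h ^+ i)%g (ga h v - v) = ga (h ^+ n)%g v - v.
Proof.
move=> Gh; have := telescope_sumr (fun i => ga (h ^+ i)%g v) (leq0n n).
rewrite ga1 big_mkord => <-; apply: eq_bigr => i _.
by rewrite gaB -gaM ?groupX // -expgSr.
Qed.

(** H^1 of [<[s ^+ p]>] with values in J_X vanishes because [s ^+ p] fixes [x0]: subtracting the
    constant [x x0] from [x] gives a representative of zero norm, hence a coboundary. *)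
Lemma lift_pinv w : pinv p s w -> exists2 y, pinv p s y & b y = w.
Proof.
move=> wp; set h := (s ^+ p)%g; have Gh : h \in G by rewrite groupX.
have [y0 by0] := bS w.
have /ba[x ex] : b (ga h y0 - y0) = 0 by rewrite (add_mapB bD) bH.2 // by0 wp subrr.
have /a0[n En] : a (\sum_(i < #[h]%g) ga (h ^+ i)%g x) = 0.
  rewrite (add_map_sum aD) -[RHS](subrr y0) -{1}(ga1 y0) -(expg_order h) -telescope_ga // ex.
  by apply: eq_bigr => i _; rewrite aH.2 ?groupX.
have x0h i : gto X x0 (h ^+ i)%g = x0 by rewrite -iter_gto //; elim: i => //= i ->.
have nE : n = #[h]%g%:Z * x x0.
  have := congr1 (fun f : {ffun X -> int} => f x0) En; rewrite sum_ffunE ffunE => <-.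
  rewrite (eq_bigr (fun=> x x0)); last by move=> i _; rewrite ffunE x0h.
  by rewrite sumr_const card_ord -mulr_natl natz.
have [||z' [zE _]] := @cyclic_coboundary X (fun y => gto X y h) #[h]%g (x - cst X (x x0))
    (order_gt0 h).
- by move=> y; rewrite iter_gto // expg_order act1.
- move=> y; have := congr1 (fun f : {ffun X -> int} => f y) En; rewrite sum_ffunE ffunE => e.
  rewrite (eq_bigr (fun i : 'I__ => ga (h ^+ i)%g x y - x x0)).
    by rewrite sumrB e nE sumr_const card_ord -mulr_natl natz subrr.
  by move=> i _; rewrite !ffunE iter_gto.
exists (y0 - a z'); last by rewrite (add_mapB bD) ba0 subr0.
have zE' : ga h z' - z' = x - cst X (x x0) by apply/ffunP=> y; rewrite !ffunE zE !ffunE.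
have e1 : ga h y0 = y0 + a x by rewrite -ex addrC subrK.
have e2 : ga h (a z') = a z' + a x.
  by rewrite -aH.2 // -[ga h z'](subrK z') zE' aD (add_mapB aD) a_cst subr0 addrC.
by rewrite /pinv -/h gaB e1 e2 opprD addrACA subrr addr0.
Qed.

(* The connecting map sends the <s>-invariant w to the class of c in
   H^2(<s> / <s ^+ p>, Z) = Z / p; y and x are the successive lifts. *)
Definition conn w y x c := [/\ pinv p s y, b y = w, ga s y - y = a x & ptrace p s x = cst X c].

Lemma conn_pinv w y x c : conn w y x c -> pinv p s x.
Proof.
case=> yp _ e _; apply: invariant_preimage; rewrite ?groupX // -e gaB yp -gaM ?groupX //.
by rewrite -expgSr expgS gaM ?groupX // yp.
Qed.

Lemma conn_inv w y x c : conn w y x c -> ga s w = w.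
Proof. by case=> _ <- e _; apply/subr0_eq; rewrite -bH.2 // -(add_mapB bD) e ba0. Qed.

Lemma conn_exists w : ga s w = w -> exists y x c, conn w y x c.
Proof.
move=> ws; have [y yp yw] := lift_pinv (inv_pinv p Gs ws).
have /ba[x ex] : b (ga s y - y) = 0 by rewrite (add_mapB bD) bH.2 // yw ws subrr.
have /a0[c ec] : a (ptrace p s x) = 0.
  by rewrite (ghom_ptrace _ Gs x aH) -ex /ptrace telescope_ga // yp subrr.
by exists y, x, c.
Qed.

Lemma conn_add w y x c w' y' x' c' :
  conn w y x c -> conn w' y' x' c' -> conn (w + w') (y + y') (x + x') (c + c').
Proof.
case=> yp yw e ec [yp' yw' e' ec']; split.
- exact: pinvD.
- by rewrite bD yw yw'.
- by rewrite ga_add opprD addrACA e e' aD.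
by rewrite ptraceD ec ec'; apply/ffunP=> z; rewrite !ffunE.
Qed.

Lemma conn_int w y x c n : conn w y x c -> conn (w *~ n) (y *~ n) (x *~ n) (c * n).
Proof.
case=> yp yw e ec; split.
- by rewrite /pinv (add_map_int (@ga_add _ _ _ _)) yp.
- by rewrite (add_map_int bD) yw.
- by rewrite (add_map_int (@ga_add _ _ _ _)) -mulrzBl e (add_map_int aD).
rewrite (add_map_int (@ptraceD _ _ _ _ X)) ec; apply/ffunP=> z.
by rewrite ffun_mulzE !ffunE mulrzz.
Qed.

Lemma ptrace_cst (Z : gset G) n : ptrace p s (cst Z n) = cst Z (p%:Z * n).
Proof.
rewrite /ptrace; under eq_bigr do rewrite ga_cst.
rewrite sumr_const card_ord; apply/ffunP=> z; rewrite ffunMnE !ffunE.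
by rewrite -mulr_natl natz.
Qed.

(** Together with additivity, this makes [c] modulo [p] depend only on [w]. Here [x] is
    [ga s x1 - x1], of trace zero, plus a constant n, of trace p n. *)
Lemma conn_zero y x c : conn 0 y x c -> (p%:Z %| c)%Z.
Proof.
case=> yp /ba[x1 ex1] e ec; subst y.
have x1p : pinv p s x1 by apply: invariant_preimage; rewrite ?groupX.
have /a0[n En] : a (x - (ga s x1 - x1)) = 0.
  by rewrite !(add_mapB aD) -e aH.2 // subrr.
have := congr1 (fun f : {ffun X -> int} => f x0) ec.
rewrite -(subrK (ga s x1 - x1) x) En ptraceD ptrace_cst /ptrace telescope_ga // x1p.
by rewrite !ffunE subrr addr0 => <-; rewrite dvdz_mulr ?dvdzz.
Qed.

(** Exactness at Z[W]: for c = p k, the function x - k has trace zero, so it is a difference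
    [ga s z' - z'], and [y - a z'] is an invariant lift. *)
Lemma conn_dvd w y x c : conn w y x c -> (p%:Z %| c)%Z ->
  exists2 u, ga s u = u & b u = w.
Proof.
move=> C /dvdzP[k ck]; have xp := conn_pinv C; case: C => yp yw e ec.
have [||z' _ zE] := @ptrace_eq0 _ _ p s pr_p Gs X (x - cst X k).
- by apply: pinvD => //; apply: pinvN; rewrite /pinv ga_cst.
- rewrite (add_mapB (@ptraceD _ _ _ _ X)) ec ptrace_cst ck.
  by apply/ffunP=> z; rewrite !ffunE mulrC subrr.
exists (y - a z'); last by rewrite (add_mapB bD) ba0 subr0.
have e1 : ga s y = y + a x by rewrite -e addrC subrK.
have e2 : ga s (a z') = a z' + a x.
  by rewrite -aH.2 // -[ga s z'](subrK z') zE aD (add_mapB aD) a_cst subr0 addrC.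
by rewrite gaB e1 e2 opprD addrACA subrr addr0.
Qed.

Lemma conn_ptrace z : pinv p s z -> exists y, conn (ptrace p s z) y 0 0.
Proof.
move=> zp; have [y yp yz] := lift_pinv zp; exists (ptrace p s y); split.
- exact: ptrace_pinv.
- by rewrite (ghom_ptrace _ Gs _ bH) yz.
- by rewrite ptrace_inv // subrr (add_map0 aD).
by rewrite (add_map0 (@ptraceD _ _ _ _ X)); apply/ffunP=> y'; rewrite !ffunE.
Qed.

(** As [s] fixes no point of [X], the constant 1 is the trace of some [x]; then [a x] has trace zero
    and is the coboundary of some [y]. *)
Lemma conn_one : exists w y x, conn w y x 1.
Proof.
have [|y /nofix//|x xp xt] := @ptrace_surj _ _ p s pr_p Gs ps X (cst X 1); first by rewrite ga_cst.
have [||y yp ye] := @ptrace_eq0 _ _ p s pr_p Gs Y (a x).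
- exact: ghom_pinv.
- by rewrite -(ghom_ptrace _ Gs _ aH) xt a_cst.
by exists (b y), y, x.
Qed.

Variables (g : gT) (r : nat).
Hypotheses (Gg : g \in G) (sg : (s ^ g = s ^+ r)%g).

Let sgX i : (s ^+ i * g = g * s ^+ (r * i))%g.
Proof. by rewrite expgM -sg -conjXg -conjgC. Qed.

(** Since s g = g s^r, the lift g y has coboundary g(s^r y - y). So [x] is replaced by g applied to
    the sum of s^j x over j < r, and the constant is multiplied by r. *)
Lemma conn_conj w y x c : conn w y x c -> exists y' x', conn (ga g w) y' x' (r%:Z * c).
Proof.
move=> C; have xp := conn_pinv C; case: C => yp yw e ec.
exists (ga g y), (ga g (\sum_(j < r) ga (s ^+ j)%g x)); split.
- rewrite /pinv -gaM ?groupX // sgX gaM ?groupX //; congr (ga g _).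
  rewrite mulnC expgM; elim: {1}r => [|k IHk]; first by rewrite ga1.
  by rewrite expgS gaM ?groupX // IHk.
- by rewrite bH.2 // yw.
- rewrite -gaM // -[s in (s * g)%g]expg1 sgX muln1 gaM ?groupX // -gaB aH.2 //; congr (ga g _).
  rewrite (add_map_sum aD) -telescope_ga //.
  by apply: eq_bigr => j _; rewrite e aH.2 ?groupX.
have -> : ptrace p s (ga g (\sum_(j < r) ga (s ^+ j)%g x)) =
   ga g (\sum_(i < p) \sum_(j < r) ga (s ^+ (r * i + j))%g x).
  rewrite /ptrace [RHS](add_map_sum (@ga_add _ _ _ g)); apply: eq_bigr => i _.
  rewrite -gaM ?groupX // sgX gaM ?groupX // (add_map_sum (@ga_add _ _ _ _)); congr (ga g _).
  by apply: eq_bigr => j _; rewrite expgD gaM ?groupX.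
(* Regroups p blocks of length r as r blocks of length p, each equal to the trace of [x]. *)
rewrite (sum_blocks (fun k => ga (s ^+ k)%g x)) (mulnC r p) -(sum_blocks (fun k => ga (s ^+ k)%g
    x)).
rewrite (eq_bigr (fun=> cst X c)); last first.
  move=> i _; rewrite -ec; apply: eq_bigr => j _; rewrite addnC expgD gaM ?groupX //.
  congr (ga _ _); rewrite expgM; elim: (nat_of_ord i) => [|k IHk]; first by rewrite ga1.
  by rewrite expgS gaM ?groupX // IHk.
rewrite sumr_const card_ord; apply/ffunP=> z; rewrite ffunE ffunMnE !ffunE.
by rewrite -mulr_natl natz.
Qed.
End Connecting.

(** * Invariants modulo traces, and fixed points *)

Section FixedPoints.
Variables (gT : finGroupType) (G : {group gT}) (p : nat) (s : gT).
Hypotheses (pr_p : prime p) (Gs : s \in G) (ps : (p.-elt s)%g).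

Implicit Type Y : gset G.

Definition fixpt (Y : gset G) := {y : Y | gto Y y s == y}.

Definition mk_fixpt Y (y : Y) (fy : gto Y y s == y) : fixpt Y := exist _ y fy.

Lemma fixptE Y (y : fixpt Y) : gto Y (val y) s = val y.
Proof. exact/eqP/(valP y). Qed.

Lemma ga_delta_fix Y (y : fixpt Y) : ga s (delta (val y)) = delta (val y).
Proof.
rewrite -{1}[s]invgK ga_deltaV ?groupV //; congr delta.
by rewrite -{1}(fixptE y) actKin.
Qed.

Lemma fix_sum_inv Y (f : fixpt Y -> int) :
  ga s (\sum_y delta (val y) *~ f y) = \sum_y delta (val y) *~ f y.
Proof.
rewrite (add_map_sum (@ga_add _ _ _ _)); apply: eq_bigr => y _.
by rewrite (add_map_int (@ga_add _ _ _ _)) ga_delta_fix.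
Qed.

Lemma fix_sumE Y (f : fixpt Y -> int) y : (\sum_y delta (val y) *~ f y :
    {ffun Y -> int}) (val y) = f y.
Proof.
rewrite sum_ffunE (bigD1 y) //= ffun_mulzE ffunE eqxx intz big1 ?addr0 // => z nz.
by rewrite ffun_mulzE ffunE val_eqE eq_sym (negPf nz) mul0rz.
Qed.

(** Removing the values at fixed points leaves an invariant function vanishing there, which is a
    trace by [ptrace_surj]. So invariants modulo traces are described by F_p[Y^s]. *)
Lemma invariant_decomp Y (u : {ffun Y -> int}) : ga s u = u ->
  exists2 z, pinv p s z & u = \sum_(y : fixpt Y) delta (val y) *~ u (val y) + ptrace p s z.
Proof.
move=> us; set v := \sum_y _.
have [||z zp zE] := @ptrace_surj _ _ p s pr_p Gs ps Y (u - v).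
- by rewrite (add_mapB (@ga_add _ _ _ _)) us fix_sum_inv.
- move=> y /eqP fy; rewrite 2!ffunE -[y]/(val (mk_fixpt fy)) fix_sumE subrr.
  exact: dvdz0.
by exists z => //; rewrite zE addrC subrK.
Qed.
End FixedPoints.

(* Reducing fixed points of s modulo p turns 0 -> J -> Z[Y] -> Z[W] -> 0 into an exact
   sequence 0 -> F_p[Y^s] -> F_p[W^s] -> F_p -> 0 on which g acts by permutations of
   determinant 1 or -1 on the first two terms and by r on the last. *)
Lemma resolved_conj_sqr1 (gT : finGroupType) (G : {group gT}) (p : nat) (s g : gT) (r : nat)
    (X : gset G) (x0 : X) :
  prime p -> s \in G -> (p.-elt s)%g -> g \in G -> (s ^ g = s ^+ r)%g ->
  gto X x0 (s ^+ p)%g = x0 -> (forall x, gto X x s <> x) ->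
  resolved (@is_cst _ _ X) -> (r%:R : 'F_p) ^+ 2 = 1.
Proof.
move=> pr_p Gs ps Gg sg x0p nofix [Y [W [a [b [aH bH a0 ba bS]]]]].
have GV : g^-1%g \in G by rewrite groupV.
have [aD bD] := (aH.1, bH.1).
pose cn := conn p s a b.
have /fin_all_exists[c cE] (w : fixpt s W) : exists c, exists y x, cn (delta (val w)) y x c.
  have [y [x [c ?]]] := conn_exists Gs aH bH a0 ba bS x0p (ga_delta_fix Gs w).
  by exists c, y, x.
have pF : p%:~R = 0 :> 'F_p by apply/eqP; rewrite Fp_int_eq0 // dvdzz.
(* Modulo [p] a trace vanishes at fixed points, so on invariants [b] is given there by its matrix
   between fixed points. *)
have Phi_eval (u : {ffun Y -> int}) (w : fixpt s W) : ga s u = u ->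
  (b u (val w))%:~R = \sum_(y : fixpt s Y) (b (delta (val y)) (val w))%:~R * (u (val y))%:~R :>
      'F_p.
  move=> /(invariant_decomp pr_p Gs ps)[z zp {1}->].
  rewrite bD ffunE (add_map_sum bD) sum_ffunE (ghom_ptrace _ Gs _ bH).
  rewrite (ptrace_fix _ Gs) ?fixptE // rmorphD rmorphM /= pF mul0r addr0 rmorph_sum /=.
  by apply: eq_bigr => y _; rewrite (add_map_int bD) ffun_mulzE mulrzz rmorphM.
(* Traces have class zero, so the connecting class of an invariant is the linear form with
   coefficients [c] in its values at fixed points. *)
have c_eval w y x n : cn w y x n ->
    n%:~R = \sum_(k : fixpt s W) (w (val k))%:~R * (c k)%:~R :> 'F_p.
  move=> C; have ws := conn_inv Gs bH ba C.
  have [z zp wE] := invariant_decomp pr_p Gs ps ws.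
  have [y1 C1] := conn_ptrace Gs aH bH a0 ba bS x0p zp.
  have [y2 [x2 C2]] : exists y2 x2, cn (\sum_(k : fixpt s W) delta (val k) *~ w (val k)) y2 x2
       (\sum_(k : fixpt s W) c k * w (val k)).
    have /fin_all_exists[y' yE] := cE; have /fin_all_exists[x' xE] := yE.
    exists (\sum_k y' k *~ w (val k)), (\sum_k x' k *~ w (val k)).
    elim: (index_enum _) => [|k l IH]; rewrite ?big_nil ?big_cons.
      split; rewrite ?(add_map0 (@ga_add _ _ _ _)) ?(add_map0 bD) ?(add_map0 aD) ?subrr //.
        by rewrite /pinv (add_map0 (@ga_add _ _ _ _)).
      by rewrite (add_map0 (@ptraceD _ _ _ _ X)); apply/ffunP=> t; rewrite !ffunE.
    exact: (conn_add aH bH (conn_int aH bH _ (xE k)) IH).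
  have C3 := conn_add aH bH C (conn_int aH bH (-1) (conn_add aH bH C2 C1)).
  move: C3; rewrite -wE mulrN1z subrr => /(conn_zero Gs aH a0 ba x0).
  rewrite -Fp_int_eq0 // rmorphD rmorphM /= rmorphD /= addr0 mulrN1 subr_eq0 => /eqP->.
  by rewrite rmorph_sum; apply: eq_bigr => k _; rewrite rmorphM mulrC.
pose lift (e : 'F_p) : int := (e : nat)%:Z.
have liftK e : (lift e)%:~R = e by rewrite /lift -pmulrn natr_Zp.
have fixg (Z : gset G) (y : fixpt s Z) : gto Z (gto Z (val y) g^-1%g) s == gto Z (val y) g^-1%g.
  have ei i : gto Z (val y) (s ^+ i)%g = val y.
    by rewrite -iter_gto //; elim: i => //= i ->; rewrite fixptE.
  have -> : gto Z (gto Z (val y) g^-1%g) s = gto Z (gto Z (val y) (s ^+ r)%g) g^-1%g.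
    by rewrite -!actMin ?groupX // -sg conjgE -!mulgA mulgV mulg1.
  by rewrite ei.
have tg_inj (Z : gset G) : injective (fun y : fixpt s Z => mk_fixpt (fixg Z y)).
  by move=> y z [/act_inj e]; apply: val_inj.
have dg (Z : gset G) (y : Z) : ga g (delta y) = delta (gto Z y g^-1%g).
  by rewrite -{1}[g]invgK ga_deltaV.
apply: (@perm_ratio_sqr1 _ _ _ (perm (tg_inj Y)) (perm (tg_inj W))
  (fun w y => (b (delta (val y)) (val w))%:~R) (fun k => (c k)%:~R)).
(* Injectivity: [b u] is the trace of some [z], which lifts to [z']. Then [u] minus the trace of
   [z'] is [a x1] with [x1] invariant, hence a trace as [s] fixes no point of [X]; so [u] is a trace
   and vanishes modulo [p] at fixed points. *)
- move=> e e0 i; pose u : {ffun Y -> int} := \sum_(y : fixpt s Y) delta (val y) *~ lift (e y).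
  have us : ga s u = u by apply: fix_sum_inv.
  have bus : ga s (b u) = b u by rewrite -bH.2 // us.
  have [|z zp zE] := ptrace_surj pr_p Gs ps bus.
    move=> w /eqP fw; rewrite -Fp_int_eq0 //.
    rewrite (Phi_eval u (mk_fixpt fw) us) -[X in _ == X](e0 (mk_fixpt fw)) /=.
    by apply/eqP; apply: eq_bigr => y _; rewrite fix_sumE liftK.
  have [z' zp' bz] := lift_pinv Gs aH bH a0 ba bS x0p zp.
  have /ba[x1 x1E] : b (u - ptrace p s z') = 0.
    by rewrite (add_mapB bD) (ghom_ptrace _ Gs _ bH) bz zE subrr.
  have x1s : ga s x1 = x1.
    apply: (invariant_preimage aH a0 x0 Gs); rewrite -x1E (add_mapB (@ga_add _ _ _ _)) us.
    by rewrite ptrace_inv.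
  have [|x2 xp2 x2E] := ptrace_surj pr_p Gs ps x1s; first by move=> x /nofix.
  have : u (val i) = p%:Z * (z' + a x2) (val i).
    rewrite -(ptrace_fix _ Gs) ?fixptE // ptraceD -(ghom_ptrace _ Gs _ aH) x2E -x1E.
    by rewrite addrC subrK.
  move/(congr1 (fun n : int => n%:~R : 'F_p)); rewrite rmorphM /= pF mul0r.
  by rewrite fix_sumE liftK.
- move=> e e0; pose w : {ffun W -> int} := \sum_(k : fixpt s W) delta (val k) *~ lift (e k).
  have ws : ga s w = w by apply: fix_sum_inv.
  have [y [x [n C]]] := conn_exists Gs aH bH a0 ba bS x0p ws.
  have pn : (p%:Z %| n)%Z.
    rewrite -Fp_int_eq0 // (c_eval _ _ _ _ C) -[X in _ == X]e0; apply/eqP.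
    by apply: eq_bigr => k _; rewrite fix_sumE liftK mulrC.
  have [u us bu] := conn_dvd pr_p Gs aH bH a0 ba x0 C pn.
  exists (fun i => (u (val i))%:~R) => k.
  by rewrite -Phi_eval // bu fix_sumE liftK.
- move=> i; have C : cn (b (delta (val i))) (delta (val i)) 0 0.
    split; rewrite ?(add_map0 aD) //.
    + by apply: inv_pinv; rewrite ?ga_delta_fix.
    + by rewrite ga_delta_fix // subrr.
    by rewrite (add_map0 (@ptraceD _ _ _ _ X)); apply/ffunP=> y'; rewrite !ffunE.
  by have := c_eval _ _ _ _ C; rewrite mulr0z => e; rewrite [RHS]e; apply: eq_bigr => k _;
      rewrite mulrC.
- have [w [y [x C]]] := conn_one pr_p Gs ps b aH a0 nofix.
  exists (fun k => (w (val k))%:~R); have := c_eval _ _ _ _ C; rewrite mulr1z => e; rewrite [RHS]e.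
  by apply: eq_bigr => k _; rewrite mulrC.
- move=> k i; rewrite !permE /= -dg bH.2 // ffunE actKVin //.
move=> k; rewrite permE /=; have [y [x C]] := cE k.
have [y' [x' C']] := conn_conj Gs aH bH a0 x0 Gg sg C.
have := c_eval _ _ _ _ C'; rewrite rmorphM /= -pmulrn => ->.
rewrite dg (bigD1 (mk_fixpt (fixg W k))) //= ffunE eqxx mul1r big1 ?addr0 // => k' nk.
rewrite ffunE (_ : (_ == _) = false) ?mul0r //; apply: negbTE.
by apply: contra nk => /eqP e; apply/eqP/val_inj.
Qed.

(** * Cyclic p-subgroups *)

Section LocalResolution.
Variables (gT : finGroupType) (G : {group gT}) (X : gset G).

Definition apply_kernel (k : {ffun X * X -> int}) (v : X -> int) x :=
  \sum_x' k (x, x') * v x'.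

(* 0 -> Z -> Z[X] -k-> Z[X] -m-> Z -> 0 is exact, the first map being the diagonal. *)
Definition exact_kernel (km : {ffun X * X -> int} * {ffun X -> int}) :=
  [/\ forall v : X -> int, (forall x, apply_kernel km.1 v x = 0) <-> (forall x x', v x = v x'),
      forall w : X -> int, \sum_x km.2 x * w x = 0 <->
         (exists v : X -> int, forall x, w x = apply_kernel km.1 v x)
    & exists w : X -> int, \sum_x km.2 x * w x = 1].

Definition kernel_act (km : {ffun X * X -> int} * {ffun X -> int}) (g : gT) :
    {ffun X * X -> int} * {ffun X -> int} :=
  ([ffun z => km.1 (gto X z.1 g^-1%g, gto X z.2 g^-1%g)], [ffun x => km.2 (gto X x g^-1%g)]).

Lemma exact_kernel_act km g : g \in G -> exact_kernel km -> exact_kernel (kernel_act km g).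
Proof.
move=> Gg [k0 km0 m1]; have GV : g^-1%g \in G by rewrite groupV.
have sumg (f : X -> int) : \sum_x f x = \sum_x f (gto X x g).
  by rewrite (reindex_inj (@act_inj _ _ _ (gto X) g)).
have kE v x : apply_kernel (kernel_act km g).1 v x
   = apply_kernel km.1 (fun y => v (gto X y g)) (gto X x g^-1%g).
  rewrite /apply_kernel sumg; apply: eq_bigr => x' _.
  by rewrite ffunE /= actKin.
have mE w : \sum_x (kernel_act km g).2 x * w x = \sum_x km.2 x * w (gto X x g).
  by rewrite sumg; apply: eq_bigr => x _; rewrite ffunE actKin.
split.
- move=> v; split=> [e x x' | e x].
    have := (k0 (fun y => v (gto X y g))).1; move=> /(_ _ (gto X x g^-1%g) (gto X x' g^-1%g)).
    rewrite !actKVin //; apply=> y.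
    by have := e (gto X y g); rewrite kE actKin.
  by rewrite kE; apply: (k0 _).2 => y y'; apply: e.
- move=> w; rewrite mE km0; split=> [[v vE] | [v vE]].
    exists (fun x => v (gto X x g^-1%g)) => x;
        rewrite kE -[w x](congr1 w (actKVin (gto X) Gg x)) vE.
    by apply: eq_bigr => y _; rewrite actKin.
  by exists (fun x => v (gto X x g)) => x; rewrite vE kE actKin.
have [w wE] := m1; exists (fun x => w (gto X x g^-1%g)); rewrite mE -[RHS]wE.
by apply: eq_bigr => x _; rewrite actKin.
Qed.

(** Subgroups of a cyclic p-group form a chain, so the largest stabilizer, that of [x0], contains
    all others and there is an equivariant [rho] from [X] to the orbit [O] of [x0]. The kernel is
    [s - 1] on [O] and v(x) - v(rho x) off [O], and [m] is the total over [O]; off [O] the equations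
    are solved at once, and on [O] the situation is cyclic. *)
Lemma exists_exact_kernel (x1 : X) (T : {group gT}) : T \subset G -> cyclic T -> (p_group T)%g ->
  exists km, exact_kernel km /\ forall g, g \in T -> kernel_act km g = km.
Proof.
move=> sTG cycT pT; have sT := subsetP sTG; have [s defT] := cyclicP cycT.
have Ts : s \in T by rewrite defT cycle_id.
have Gs := sT _ Ts.
pose st x := 'C_T[x | gto X]%G.
have [x0 _ x0max] := @arg_maxnP X x1 predT (fun x => #|st x|) isT.
have stx0 x : st x \subset st x0.
  rewrite -(cardSg_cyclic cycT) ?subsetIl //.
  have /p_natP[i ei] : (pdiv #|T|).-nat #|st x| := pgroupS (subsetIl _ _) pT.
  have /p_natP[j ej] : (pdiv #|T|).-nat #|st x0| := pgroupS (subsetIl _ _) pT.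
  rewrite ei ej; have := x0max x isT; rewrite /= ei ej => le.
  have [T1 | T1] := leqP #|T| 1.
    have /eqP-> : #|T| == 1%N by rewrite eqn_leq T1 cardG_gt0.
    by rewrite (_ : pdiv 1 = 1%N) ?exp1n //.
  have p1 : (1 < pdiv #|T|)%N by rewrite prime_gt1 ?pdiv_prime.
  by rewrite dvdn_Pexp2l // -(leq_exp2l _ _ p1).
pose O := orbit (gto X) T x0.
have OA x g : g \in T -> (gto X x g \in O) = (x \in O) by move=> Tg; apply: orbit_actr_in.
have [rho [rhoO rhoT]] : exists rho : X -> X,
    (forall x, rho x \in O) /\ forall x g, g \in T -> rho (gto X x g) = gto X (rho x) g.
  apply: (@equivariant_choice gT G T X (gto X) X (gto X) (fun _ y => y \in O)) => //.
  - by move=> y g h Tg Th; rewrite actMin ?sT.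
  - by move=> _ y g Tg; rewrite OA.
  move=> x; exists x0; split=> [|g Tg gx]; first exact: orbit_refl.
  have : g \in st x by rewrite inE Tg /= inE sT //= inE sub1set inE gx.
  by move/(subsetP (stx0 x)); rewrite !inE sub1set inE => /and3P[_ _ /eqP].
pose k : {ffun X * X -> int} := [ffun z => if z.1 \in O
  then (z.2 == gto X z.1 s)%:Z - (z.2 == z.1)%:Z else (z.2 == z.1)%:Z - (z.2 == rho z.1)%:Z].
pose m : {ffun X -> int} := [ffun x => (x \in O)%:Z].
have sumd (v : X -> int) y : \sum_x (x == y)%:Z * v x = v y.
  by rewrite (bigD1 y) //= eqxx mul1r big1 ?addr0 // => x /negPf->; rewrite mul0r.
have kE v x : apply_kernel k v x = if x \in O then v (gto X x s) - v x else v x - v (rho x).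
  rewrite /apply_kernel; under eq_bigr do rewrite ffunE /=.
  by case: ifP => _; under eq_bigr do rewrite mulrBl; rewrite sumrB !sumd.
have mE w : \sum_x m x * w x = \sum_(x in O) w x.
  rewrite [RHS]big_mkcond; apply: eq_bigr => x _; rewrite ffunE.
  by case: ifP => _; rewrite ?mul1r ?mul0r.
have Oi x : x \in O -> exists i, x = gto X x0 (s ^+ i)%g.
  case/orbitP=> g; rewrite defT => /cycleP[i ->] <-; by exists i.
exists (k, m); split; last first.
  move=> g Tg; have TV : g^-1%g \in T by rewrite groupV.
  have inj := @act_inj _ _ _ (gto X) g^-1%g.
  congr (_, _); apply/ffunP=> z; rewrite !ffunE /=; last by rewrite OA.
  rewrite OA // rhoT // !(inj_eq inj).
  have -> : gto X (gto X z.1 g^-1%g) s = gto X (gto X z.1 s) g^-1%g.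
    rewrite -!actMin ?sT //; congr (gto X _ _).
    by move: TV Ts; rewrite defT => /cycleP[i ->] _; rewrite -expgS -expgSr.
  by rewrite (inj_eq inj).
split=> /=.
- move=> v; split=> [e | e x]; last by rewrite kE; case: ifP => _; apply/eqP; rewrite subr_eq0;
    apply/eqP/e.
  have eO x : x \in O -> v x = v x0.
    move=> Ox; have [i ->] := Oi x Ox; elim: i => [|i IHi]; first by rewrite act1.
    have Oxi : gto X x0 (s ^+ i)%g \in O by rewrite OA ?groupX // orbit_refl.
    have := e (gto X x0 (s ^+ i)%g); rewrite kE Oxi => /subr0_eq e1.
    by rewrite expgSr actMin ?groupX // e1 IHi.
  suffices ex x : v x = v x0 by move=> x x'; rewrite !ex.
  have [Ox | nOx] := boolP (x \in O); first exact: eO.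
  by have := e x; rewrite kE (negPf nOx) => /subr0_eq->; apply: eO.
- move=> w; rewrite mE; split=> [w0 | [v vE]]; last first.
    rewrite (eq_bigr (fun x => v (gto X x s) - v x)); last by move=> x Ox; rewrite vE kE Ox.
    rewrite sumrB [X in _ - X](reindex_inj (@act_inj _ _ _ (gto X) s)) /=.
    by rewrite [X in _ - X](eq_bigl (mem O)) ?subrr // => x; rewrite /= OA.
  pose z : {ffun X -> int} := [ffun x => if x \in O then w x else 0].
  pose nz x := \sum_(i < #[s]%g) z (gto X x (s ^+ i)%g).
  have nzs x : nz (gto X x s) = nz x.
    have m0 := order_gt0 s; rewrite /nz -[in RHS](prednK m0) -[in LHS](prednK m0).
    rewrite big_ord_recr big_ord_recl /= addrC; congr (_ + _).
      by rewrite -actMin ?groupX // -expgS prednK // expg_order ?expg0 !act1.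
    by apply: eq_bigr => i _; rewrite -actMin ?groupX // -expgS.
  have nzO x : x \in O -> nz x = nz x0.
    by move=> /Oi[i ->]; rewrite -iter_gto //; elim: i => //= i IHi; rewrite nzs.
  have nz0 : nz x0 = 0.
    have : \sum_(x in O) nz x = 0.
      rewrite exchange_big /= big1 // => i _; rewrite -[RHS]w0.
      rewrite [RHS](reindex_inj (@act_inj _ _ _ (gto X) (s ^+ i)%g)) /=.
      rewrite [RHS](eq_bigl (mem O)); last by move=> x; rewrite /= OA ?groupX.
      by apply: eq_bigr => x Ox; rewrite ffunE OA ?groupX // Ox.
    rewrite (eq_bigr (fun=> nz x0)); last by move=> x /nzO.
    rewrite sumr_const => /eqP; rewrite mulrn_eq0 => /orP[|/eqP//].
    by rewrite cards_eq0 => /eqP/setP/(_ x0); rewrite inE orbit_refl.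
  have [||v' [v'E _]] := @cyclic_coboundary X (fun x => gto X x s) #[s]%g z (order_gt0 s).
  + by move=> x; rewrite iter_gto // expg_order act1.
  + move=> x; rewrite (eq_bigr (fun i : 'I__ => z (gto X x (s ^+ i)%g))); last first.
      by move=> i _; rewrite iter_gto.
    rewrite -/(nz x); have [/nzO-> // | nOx] := boolP (x \in O).
    by rewrite /nz big1 // => i _; rewrite ffunE OA ?groupX // (negPf nOx).
  exists (fun x => if x \in O then v' x else w x + v' (rho x)) => x; rewrite kE OA // rhoO.
  by case: (boolP (x \in O)) => Ox /=; rewrite ?addrK // v'E ffunE Ox.
exists (fun x => (x == x0)%:Z); rewrite mE (bigD1 x0) ?orbit_refl //= eqxx.
by rewrite big1 ?addr0 // => x /andP[_ /negPf->].
Qed.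
End LocalResolution.

(** The quotient is a family of copies of J_X over [Y]. The stabilizer of each [y] leaves some exact
    kernel invariant, and [equivariant_choice] makes these kernels compatible with [G]. *)
Lemma resolved_family (gT : finGroupType) (G : {group gT}) (Y X : gset G) (x1 : X) :
  (forall y : Y, cyclic 'C_G[y | gto Y]%g /\ p_group 'C_G[y | gto Y]%g) ->
  resolved (fun v : {ffun gprod Y X -> int} => forall y x x', v (y, x) = v (y, x')).
Proof.
move=> stabY.
have [] := @equivariant_choice gT G G Y (gto Y) _ (@kernel_act _ _ X) (fun _ km => exact_kernel
    km) (subxx _).
- move=> km g h Gg Gh; congr (_, _); apply/ffunP=> z; rewrite !ffunE /= invMg;
    by rewrite !actMin ?groupV.
- by move=> _ km g Gg; apply: exact_kernel_act.
- move=> y; have [cy py] := stabY y.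
  have [|km [ek ik]] := @exists_exact_kernel _ _ X x1 'C_G[y | gto Y]%G _ cy py;
      first exact: subsetIl.
  by exists km; split=> // g Gg gy; apply: ik; rewrite mem_stab Gg gy /=.
move=> km [ek kmG].
pose a (v : {ffun gprod Y X -> int}) : {ffun gprod Y X -> int} :=
  [ffun z : Y * X => apply_kernel (km z.1).1 (fun x => v (z.1, x)) z.2].
pose b (w : {ffun gprod Y X -> int}) : {ffun Y -> int} :=
  [ffun y => \sum_x (km y).2 x * w (y, x)].
exists (gprod Y X), Y, a, b; split.
- split=> [u v | g v Gg]; apply/ffunP=> -[y x]; rewrite !ffunE /= /apply_kernel.
    by rewrite -big_split; apply: eq_bigr => x' _; rewrite ffunE mulrDr.
  rewrite kmG // [RHS](reindex_inj (@act_inj _ _ _ (gto X) g)) /=.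
  by apply: eq_bigr => x' _; rewrite !ffunE /= !actKin.
- split=> [u v | g v Gg]; apply/ffunP=> y; rewrite !ffunE.
    by rewrite -big_split; apply: eq_bigr => x' _; rewrite ffunE mulrDr.
  rewrite kmG // [RHS](reindex_inj (@act_inj _ _ _ (gto X) g)) /=.
  by apply: eq_bigr => x' _; rewrite !ffunE /= !actKin.
- move=> v; split=> [e y | e].
    have [k0 _ _] := ek y; apply: (k0 (fun x => v (y, x))).1 => x.
    by have := congr1 (fun f : {ffun gprod Y X -> int} => f (y, x)) e; rewrite !ffunE.
  by apply/ffunP=> -[y x]; rewrite !ffunE; have [k0 _ _] := ek y; apply: (k0 _).2 => *; apply: e.
- move=> w; split=> [e | [v ->]].
    have /fin_all_exists[v vE] y : exists v :
        X -> int, forall x, w (y, x) = apply_kernel (km y).1 v x.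
      have [_ km0 _] := ek y; apply: (km0 (fun x => w (y, x))).1.
      by have := congr1 (fun f : {ffun Y -> int} => f y) e; rewrite !ffunE.
    exists [ffun z : Y * X => v z.1 z.2]; apply/ffunP=> -[y x]; rewrite !ffunE vE.
    by apply: eq_bigr => x' _; rewrite ffunE.
  apply/ffunP=> y; rewrite !ffunE; have [_ km0 _] := ek y.
  rewrite (eq_bigr (fun x => (km y).2 x * apply_kernel (km y).1 (fun x => v (y, x)) x)).
    by apply/(km0 _); exists (fun x => v (y, x)).
  by move=> x _; rewrite ffunE.
move=> z; have /fin_all_exists[w wE] y : exists w : X -> int, \sum_x (km y).2 x * w x = 1.
  by have [] := ek y.
exists [ffun t : Y * X => w t.1 t.2 * z t.1]; apply/ffunP=> y; rewrite !ffunE.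
under eq_bigr do rewrite ffunE /= mulrA.
by rewrite -mulr_suml wE mul1r.
Qed.

(** * Integral matrices *)

Definition mx_of n m (f : 'cV[int]_n -> 'cV[int]_m) : 'M[int]_(m, n) :=
  \matrix_(i, j) f (delta_mx j 0) i 0.

Lemma mx_ofE n m (f : 'cV[int]_n -> 'cV[int]_m) v : add_map f -> mx_of f *m v = f v.
Proof.
move=> fD; have -> : f v = \sum_j f (delta_mx j 0) *~ v j 0.
  rewrite -[in LHS](_ : \sum_j delta_mx j 0 *~ v j 0 = v).
    by rewrite (add_map_sum fD); apply: eq_bigr => j _; rewrite (add_map_int fD).
  rewrite [RHS]matrix_sum_delta; apply: eq_bigr => j _; rewrite big_ord1.
  by rewrite -scaler_int intz.
apply/colP=> i; rewrite mxE summxE; apply: eq_bigr => j _.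
by rewrite -scaler_int intz !mxE mulrC.
Qed.

Lemma mulmx_ext n m (A B : 'M[int]_(m, n)) : (forall v : 'cV_n, A *m v = B *m v) -> A = B.
Proof.
move=> e; apply/matrixP=> i j; have := congr1 (fun M : 'cV_m => M i 0) (e (delta_mx j 0)).
by rewrite -!colE !mxE.
Qed.

Section Models.
Variables (gT : finGroupType) (G : {group gT}).

Definition models n (rho : gT -> 'M[int]_n) (Y : gset G)
    (enc : {ffun Y -> int} -> 'cV[int]_n) (dec : 'cV[int]_n -> {ffun Y -> int}) :=
  [/\ add_map enc, add_map dec, cancel enc dec, cancel dec enc
    & forall g c, g \in G -> dec (rho g *m c) = ga g (dec c)].

Lemma models_enc n rho Y enc dec : @models n rho Y enc dec ->
  forall g v, g \in G -> rho g *m enc v = enc (ga g v).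
Proof. by case=> _ _ ed de dG g v Gg; rewrite -[LHS]de dG // ed. Qed.

Lemma gset_perm_lattice (Y : gset G) : exists rho enc dec,
  is_perm_lattice G rho /\ @models #|Y| rho Y enc dec.
Proof.
have inj g : injective (fun k : 'I_#|Y| => enum_rank (gto Y (enum_val k) g)).
  by move=> k k' /enum_rank_inj/act_inj/enum_val_inj.
pose s g := perm (inj g); pose rho g : 'M[int]_#|Y| := perm_mx (s g).
exists rho, (fun v : {ffun Y -> int} => \col_(k < #|Y|) v (enum_val k)),
    (fun c => [ffun y => c (enum_rank y) 0]); split.
  split; last first.
    exists 1%:M; split=> [|g Gg]; first exact: unitmx1.
    by rewrite invmx1 mul1mx mulmx1 perm_mx_is_perm.
  split=> [|g h Gg Gh].
    rewrite /rho (_ : s 1%g = 1%g) ?perm_mx1 //; apply/permP=> k.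
    by rewrite permE act1 enum_valK perm1.
  rewrite /rho -perm_mxM; congr perm_mx; apply/permP=> k.
  by rewrite permM !permE enum_rankK actMin.
split.
- by move=> u v; apply/colP=> k; rewrite !mxE ffunE.
- by move=> u v; apply/ffunP=> y; rewrite !ffunE mxE.
- by move=> v; apply/ffunP=> y; rewrite ffunE mxE enum_rankK.
- by move=> c; apply/colP=> k; rewrite mxE ffunE enum_valK.
by move=> g c Gg; apply/ffunP=> y; rewrite !ffunE /rho -row_permE mxE permE enum_rankK.
Qed.

Lemma perm_lattice_gset n (rho : gT -> 'M[int]_n) : is_perm_lattice G rho ->
  exists Y enc dec, @models n rho Y enc dec.
Proof.
move=> [[rho1 rhoM] [B [uB Bperm]]].
have /fin_all_exists[s sE] (g : gT) : exists s : 'S_n,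
    g \in G -> invmx B *m rho g *m B = perm_mx s.
  case: (boolP (g \in G)) => Gg; last by exists 1%g.
  by have /is_perm_mxP[s e] := Bperm g Gg; exists s.
have sM g h : g \in G -> h \in G -> s (g * h)%g = (s g * s h)%g.
  move=> Gg Gh; have : perm_mx (s (g * h)%g) = perm_mx (s g * s h)%g :> 'M[int]_n.
    rewrite perm_mxM -!sE ?groupM // rhoM // !mulmxA; congr (_ *m _).
    by rewrite -!mulmxA; congr (_ *m (_ *m _)); rewrite mulmxA mulmxV // mul1mx.
  move=> e; apply/permP=> i; have := congr1 (fun M : 'M[int]_n => M i (s (g * h)%g i)) e.
  by rewrite !mxE eqxx; case: eqP.
have actS : is_action G (fun (i : 'I_n) g => s g i).
  split=> [g i j /perm_inj // | i g h Gg Gh]; by rewrite sM // permM.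
pose Y := Gset (Action actS).
exists Y, (fun v => B *m \col_i v i), (fun c => [ffun i : 'I_n => (invmx B *m c) i 0]); split.
- by move=> u v; rewrite -mulmxDr; congr (_ *m _); apply/colP=> k; rewrite !mxE ffunE.
- by move=> u v; apply/ffunP=> y; rewrite !ffunE mulmxDr mxE.
- by move=> v; apply/ffunP=> y; rewrite ffunE mulKmx // mxE.
- move=> c; rewrite -[RHS](mulKVmx uB); congr (_ *m _); apply/colP=> k; rewrite mxE ffunE //.
move=> g c Gg; apply/ffunP=> y; rewrite !ffunE /=.
have -> : invmx B *m (rho g *m c) = perm_mx (s g) *m (invmx B *m c).
  by rewrite -sE // !mulmxA -(mulmxA _ B) mulmxV // mulmx1.
by rewrite -row_permE mxE.
Qed.

Section Quotient.
Variables (n : nat) (rho : gT -> 'M[int]_n) (X : gset G) (Pi : {ffun X -> int} -> 'cV[int]_n).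
Hypotheses (PiD : add_map Pi) (PiS : forall c, exists v, Pi v = c)
  (PiG : forall g v, g \in G -> rho g *m Pi v = Pi (ga g v)).

Lemma quotient_is_lattice : is_lattice G rho.
Proof.
split=> [|g h Gg Gh]; apply: mulmx_ext => c; have [v <-] := PiS c.
  by rewrite PiG ?group1 // ga1 mul1mx.
by rewrite -mulmxA !PiG ?groupM // gaM.
Qed.

Lemma resolved_quasi_perm : resolved (fun v => Pi v = 0) -> is_quasi_perm G rho.
Proof.
move=> [Y [W [a [b [aH bH a0 ba bS]]]]]; split; first exact: quotient_is_lattice.
have [aD bD] := (aH.1, bH.1).
have [rhoR [encR [decR [pR mR]]]] := gset_perm_lattice Y.
have [rhoF [encF [decF [pF mF]]]] := gset_perm_lattice W.
have encRG := models_enc mR; have encFG := models_enc mF.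
have [eRD dRD eRK dRK dRG] := mR; have [eFD dFD eFK dFK dFG] := mF.
have /fin_all_exists[t tE] (j : 'I_n) : exists v, Pi v = delta_mx j 0 by apply: PiS.
(* An additive section of [Pi], in general not equivariant; [a o lift] nevertheless is, because [a]
   kills the kernel of [Pi]. *)
pose lift (c : 'cV[int]_n) := \sum_j t j *~ c j 0.
have liftD : add_map lift.
  by move=> u v; rewrite /lift -big_split; apply: eq_bigr => j _; rewrite mxE mulrzDr.
have liftK c : Pi (lift c) = c.
  rewrite (add_map_sum PiD) [RHS]matrix_sum_delta; apply: eq_bigr => j _.
  by rewrite (add_map_int PiD) tE big_ord1 -scaler_int intz.
have a_lift v : a (lift (Pi v)) = a v.
  by apply/subr0_eq; rewrite -(add_mapB aD); apply/a0; rewrite (add_mapB PiD) liftK subrr.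
pose A := mx_of (fun c => encR (a (lift c))).
pose B := mx_of (fun c => encF (b (decR c))).
have AE c : A *m c = encR (a (lift c)).
  by rewrite mx_ofE // => u v; rewrite liftD aD eRD.
have BE c : B *m c = encF (b (decR c)).
  by rewrite mx_ofE // => u v; rewrite dRD bD eFD.
have eR0 := add_map0 eRD; have eF0 := add_map0 eFD.
exists _, _, rhoR, rhoF, A, B; split=> //.
- move=> g Gg; apply: mulmx_ext => c; have [v <-] := PiS c.
  by rewrite -!mulmxA PiG // !AE !a_lift aH.2 // encRG.
- move=> g Gg; apply: mulmx_ext => c; rewrite -!mulmxA !BE dRG // bH.2 //.
  by rewrite encFG.
split.
- move=> c; rewrite AE => /(congr1 decR); rewrite eRK (add_map0 dRD) => /a0.
  by rewrite liftK.
- apply: mulmx_ext => c; rewrite -mulmxA AE BE eRK mul0mx.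
  by rewrite (ba _).2 ?eF0 //; exists (lift c).
- move=> y; rewrite BE => /(congr1 decF); rewrite eFK (add_map0 dFD) => /ba[v vE].
  by exists (Pi v); rewrite AE a_lift -vE dRK.
move=> z; have [w wE] := bS (decF z); exists (encR w).
by rewrite BE eRK wE dFK.
Qed.

Lemma quasi_perm_resolved : is_quasi_perm G rho -> resolved (fun v => Pi v = 0).
Proof.
move=> [_ [r [f [rhoR [rhoF [A [B [pR pF AG BG [A0 BA AB BS]]]]]]]]].
have [Y [encR [decR mR]]] := perm_lattice_gset pR.
have [W [encF [decF mF]]] := perm_lattice_gset pF.
have encRG := models_enc mR.
have [eRD dRD eRK dRK dRG] := mR; have [eFD dFD eFK dFK dFG] := mF.
exists Y, W, (fun v => decR (A *m Pi v)), (fun w => decF (B *m encR w)); split.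
- split=> [u v | g v Gg]; first by rewrite PiD mulmxDr dRD.
  by rewrite -PiG // mulmxA AG // -mulmxA dRG.
- split=> [u v | g v Gg]; first by rewrite eRD mulmxDr dFD.
  by rewrite -encRG // mulmxA BG // -mulmxA dFG.
- move=> v; split=> [/(congr1 encR) | ->]; last by rewrite mulmx0 (add_map0 dRD).
  by rewrite dRK (add_map0 eRD) => /A0.
- move=> w; split=> [/(congr1 encF) | [v ->]].
    rewrite dFK (add_map0 eFD) => /AB[c cE]; have [v vE] := PiS c.
    by exists v; rewrite vE -cE eRK.
  by rewrite dRK mulmxA BA mul0mx (add_map0 dFD).
move=> z; have [y yE] := BS (encF z); exists (decR y).
by rewrite dRK -yE eFK.
Qed.
End Quotient.
End Models.

(** * The G-set of cosets and the lattice J *)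

Section Cosets.
Variables (gT : finGroupType) (G : {group gT}) (calH : {set {group gT}}).
Local Notation CT := (cosetT G calH).

Lemma cosetT_actE g (t : CT) : g \in G ->
  val (cosetT_act g t) = ((val t).1, (g *: (val t).2)%g).
Proof.
move=> Gg; rewrite /cosetT_act val_insubd ifT //.
case: t => [[H A]] /=; rewrite /coset_pred /= => /andP[-> /lcosetsP[x Gx ->]].
by apply/lcosetsP; exists (g * x)%g; rewrite ?groupM // lcosetM.
Qed.

(** The left action on cosets becomes a right action through inverses. Elements outside [G] act
    trivially, as an action must be injective for every group element. *)
Fact cosetT_is_action :
  is_action G (fun (t : CT) g => if g \in G then cosetT_act g^-1%g t else t).
Proof.
have actE g (t : CT) : g \in G -> val (cosetT_act g^-1%g t) = ((val t).1, (g^-1%g *: (val t).2)%g).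
  by move=> Gg; rewrite cosetT_actE ?groupV.
split=> [g t t' /= | t g h Gg Gh].
  case: ifP => // Gg /(congr1 val); rewrite !actE // => -[e1 e2].
  by apply: val_inj; rewrite [LHS]surjective_pairing [RHS]surjective_pairing e1 (lcoset_inj e2).
rewrite groupM // Gg Gh; apply: val_inj; rewrite !actE ?groupM //=.
by rewrite invMg lcosetM.
Qed.
Definition cosets : gset G := @Gset _ G (CT : finType) (Action cosetT_is_action).

Lemma cosets_actE (t : cosets) g : g \in G -> gto cosets t g = cosetT_act g^-1%g t.
Proof. by move=> Gg /=; rewrite Gg. Qed.

Hypothesis sHG : forall H : {group gT}, H \in calH -> H \subset G.

Lemma stab_cosets (t : cosets) : exists2 g, g \in G &
  'C_G[t | gto cosets]%g = ((val t).1 :^ g)%g.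
Proof.
have Ht := valP t; case Dt: (val t) => [H A]; rewrite Dt in Ht.
have /andP[HH /lcosetsP[x Gx defA]] := Ht; rewrite /= in HH defA.
exists x^-1%g; first by rewrite groupV.
apply/setP=> g; rewrite mem_stab.
have [Gg | nGg] := boolP (g \in G); last first.
  apply/esym/negbTE; apply: contra nGg => /imsetP[h Hh ->].
  by rewrite groupJ ?groupV // (subsetP (sHG HH)).
rewrite cosets_actE // -val_eqE cosetT_actE ?groupV // Dt xpair_eqE eqxx /= defA.
rewrite mem_conjg invgK -lcosetM.
rewrite (sameP eqP lcoset_eqP) mem_lcoset.
by rewrite -[RHS]groupV -conjVg conjgE -?mulgA.
Qed.

Lemma exists_coset (H : {group gT}) x : H \in calH -> x \in G ->
  exists t : cosets, val t = (H, (x *: H)%g).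
Proof.
move=> HH Gx; have Ht : coset_pred G calH (H, (x *: H)%g).
  by rewrite /coset_pred /= HH; apply/lcosetsP; exists x.
by exists (exist (coset_pred G calH) _ Ht : CT).
Qed.

Lemma card_stab_cosets (t : cosets) : #|'C_G[t | gto cosets]%g| = #|(val t).1|.
Proof. by have [g _ ->] := stab_cosets t; rewrite cardJg. Qed.

Section J.
Hypothesis calH0 : calH != set0.

Let NP_gt0 : (0 < NP G calH)%N.
Proof.
have [H HH] := set0Pn _ calH0; have [t _] := exists_coset HH (group1 G).
by apply/card_gt0P; exists t.
Qed.

Let ev (k : nat) (lt : (k < NP G calH)%N) : cosets := enum_val (Ordinal lt).

Let lt_succ (i : 'I_(NP G calH).-1) : (i.+1 < NP G calH)%N.
Proof. by rewrite -ltn_predRL. Qed.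

(** The restriction of [v] to I, written in the basis dual to f_i = e_(i+1) - e_0; it identifies
    functions modulo constants with J. *)
Definition Jmap (v : {ffun cosets -> int}) : 'cV[int]_(NP G calH).-1 :=
  \col_i (v (ev (lt_succ i)) - v (ev NP_gt0)).

Lemma JmapD : add_map Jmap.
Proof. by move=> u v; apply/colP=> i; rewrite !mxE !ffunE; ring. Qed.

Lemma Jmap_ker v : Jmap v = 0 <-> is_cst v.
Proof.
split=> [e | [n ->]]; last by apply/colP=> i; rewrite !mxE !ffunE subrr.
exists (v (ev NP_gt0)); apply/ffunP=> t; rewrite ffunE -(enum_rankK t).
case: (enum_rank t) => [[|k] lt]; first by congr (v (enum_val _)); apply: val_inj.
have lt' : (k < (NP G calH).-1)%N by rewrite ltn_predRL.
have := congr1 (fun M : 'cV__ => M (Ordinal lt') 0) e; rewrite !mxE => /subr0_eq <-.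
by congr (v (enum_val _)); apply: val_inj.
Qed.

Lemma Jmap_surj c : exists v, Jmap v = c.
Proof.
pose f (k : nat) : int := if k is k'.+1 then if insub k' :
    option 'I_(NP G calH).-1 is Some i then c i 0 else 0 else 0.
exists [ffun t => f (enum_rank t)]; apply/colP=> i; rewrite !mxE !ffunE /ev !enum_valK /= subr0.
by rewrite valK.
Qed.

Lemma Jmap_act g v : g \in G -> rhoJ G calH g *m Jmap v = Jmap (ga g v).
Proof.
move=> Gg; have GV : g^-1%g \in G by rewrite groupV.
(* [rhoJ g] is built from [g^-1], which permutes cosets on the left as [g] does in the right
   action. *)
have sgE k (lt : (k < NP G calH)%N) :
    sigmaP G calH g^-1%g k = enum_rank (gto cosets (ev lt) g).
  rewrite /sigmaP; case: insubP => [o _ ek | ]; last by rewrite lt.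
  rewrite cosets_actE //; congr (nat_of_ord (enum_rank (cosetT_act _ (enum_val _)))).
  exact: val_inj.
have sumE (t : cosets) : \sum_(j < (NP G calH).-1) ((enum_rank t == j.+1 :> nat) : nat)%:Z *
    (v (ev (lt_succ j)) - v (ev NP_gt0)) = v t - v (ev NP_gt0).
  rewrite -{2}(enum_rankK t); case: (enum_rank t) => [[|k] lt] /=.
    rewrite big1 => [|j _]; last by rewrite mul0r.
    by rewrite (_ : ev NP_gt0 = enum_val (Ordinal lt)) ?subrr //; congr enum_val; apply: val_inj.
  have lt' : (k < (NP G calH).-1)%N by rewrite ltn_predRL.
  rewrite (bigD1 (Ordinal lt')) //= eqxx mul1r big1 ?addr0 => [|j nj].
    by congr (v (enum_val _) - _); apply: val_inj.
  by rewrite eqSS eq_sym -[k]/(val (Ordinal lt')) val_eqE (negPf nj) mul0r.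
apply/colP=> i; rewrite !mxE !ffunE.
rewrite (eq_bigr (fun j : 'I_(NP G calH).-1 =>
   ((enum_rank (gto cosets (ev (lt_succ i)) g) == j.+1 :> nat) :
       nat)%:Z * (v (ev (lt_succ j)) - v (ev NP_gt0)) -
   ((enum_rank (gto cosets (ev NP_gt0) g) == j.+1 :> nat) :
       nat)%:Z * (v (ev (lt_succ j)) - v (ev NP_gt0)))).
  by rewrite sumrB !sumE; ring.
by move=> j _; rewrite !mxE !sgE mulrBl.
Qed.
End J.
End Cosets.

(* J is a direct summand of the functions Y -> J, where Y runs over the cosets of the cyclic
   p-subgroups: constant functions are split off by an invariant weight of total mass 1. *)
Lemma quasi_invertible_of_quotient (gT : finGroupType) (G : {group gT}) (n : nat)
    (rho : gT -> 'M[int]_n) (X : gset G) (x1 : X) (Pi : {ffun X -> int} -> 'cV[int]_n) :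
  Zgroup G -> add_map Pi -> (forall c, exists v, Pi v = c) ->
  (forall g v, g \in G -> rho g *m Pi v = Pi (ga g v)) ->
  (forall v, Pi v = 0 <-> is_cst v) -> is_quasi_invertible G rho.
Proof.
move=> ZG PiD PiS PiG Pi0.
pose calT := [set P : {group gT} | [&& P \subset G, cyclic P & p_group P]].
have calTP P : P \in calT -> [/\ P \subset G, cyclic P & p_group P] by rewrite inE => /and3P.
have sTG P : P \in calT -> P \subset G by case/calTP.
pose Y := cosets G calT.
have stabY (y : Y) : cyclic 'C_G[y | gto Y]%g /\ p_group 'C_G[y | gto Y]%g.
  have [g Gg ->] := stab_cosets sTG y; have /andP[/calTP[_ cP pP] _] := valP y.
  by rewrite cyclicJ /p_group cardJg pgroupJ.
have [u [u1 uG]] : exists u : {ffun Y -> int}, \sum_y u y = 1%:Z /\ forall g, g \in G -> ga g u = u.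
  apply: (exists_invariant_weight ZG) => // p pr_p; have [P sylP] := Sylow_exists p G.
  have PT : P \in calT.
    rewrite inE (pHall_sub sylP) (pgroup_p (pHall_pgroup sylP)) andbT /=.
    by apply: (forall_inP ZG); apply: p_Sylow sylP.
  have [t tE] := exists_coset PT (group1 G).
  exists t; rewrite card_stab_cosets // tE /= (card_Hall sylP) p_part pfactorK //.
  by rewrite logn1 addn0.
split; first exact: (quotient_is_lattice PiS PiG).
pose I := (Y * 'I_n)%type.
pose slice (c : 'cV[int]_#|{: I}|) (y : Y) : 'cV[int]_n := \col_i c (enum_rank (y, i)) 0.
pose glue (f : Y -> 'cV[int]_n) : 'cV[int]_#|{: I}| := \col_k f (enum_val k).1 (enum_val k).2 0.
have glueK f y : slice (glue f) y = f y by apply/colP=> i; rewrite !mxE enum_rankK.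
have sliceK c : glue (slice c) = c.
  by apply/colP=> k; rewrite !mxE -surjective_pairing enum_valK.
have sliceD y : add_map (slice^~ y) by move=> c d; apply/colP=> i; rewrite !mxE.
have glue_ext f h : f =1 h -> glue f = glue h by move=> e; apply/colP=> k; rewrite !mxE e.
have glueD f h : glue (fun y => f y + h y) = glue f + glue h by apply/colP=> k; rewrite !mxE.
(* Functions f from [Y] to the lattice, with (g f)(y) = g f(y g). The lattice embeds as the constant
   functions, and summing against [u] is the retraction. *)
pose F g c := glue (fun y => rho g *m slice c (gto Y y g)).
have FD g : add_map (F g).
  by move=> c d; rewrite /F -glueD; apply: glue_ext => y; rewrite sliceD mulmxDr.
pose rhoL g := mx_of (F g).
have rhoLE g c : rhoL g *m c = F g c by rewrite mx_ofE.
pose row (v : {ffun gprod Y X -> int}) (y : Y) : {ffun X -> int} := [ffun x => v (y, x)].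
pose PiL (v : {ffun gprod Y X -> int}) := glue (fun y => Pi (row v y)).
have PiLD : add_map PiL.
  move=> a b; rewrite /PiL -glueD; apply: glue_ext => y; rewrite -PiD; congr Pi.
  by apply/ffunP=> x; rewrite !ffunE.
have PiLS c : exists v, PiL v = c.
  have /fin_all_exists[v vE] (y : Y) : exists v, Pi v = slice c y by apply: PiS.
  exists [ffun z : Y * X => v z.1 z.2]; rewrite -[RHS]sliceK; apply: glue_ext => y.
  by rewrite -vE; congr Pi; apply/ffunP=> x; rewrite !ffunE.
have PiLG g v : g \in G -> rhoL g *m PiL v = PiL (ga g v).
  move=> Gg; rewrite rhoLE; apply: glue_ext => y; rewrite glueK PiG //; congr Pi.
  by apply/ffunP=> x; rewrite !ffunE.
have iD : add_map (fun c => glue (fun=> c)) by move=> c d; apply: glueD.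
have pD : add_map (fun c => \sum_y slice c y *~ u y).
  by move=> c d; rewrite -big_split; apply: eq_bigr => y _; rewrite sliceD mulrzDl.
exists _, rhoL, (mx_of (fun c => glue (fun=> c))), (mx_of (fun c => \sum_y slice c y *~ u y));
    split.
- apply: (resolved_quasi_perm PiLD PiLS PiLG).
  have [W [W' [a [b [aH bH a0 ba bS]]]]] := resolved_family x1 stabY.
  exists W, W', a, b; split=> // v; rewrite a0; split=> [e | e y x x'].
    rewrite -[RHS](add_map0 PiLD); apply: glue_ext => y; apply/subr0_eq; rewrite -(add_mapB PiD).
    apply/Pi0; exists (v (y, x1)); apply/ffunP=> x; rewrite !ffunE subr0; exact: e.
  have /Pi0[k kE] : Pi (row v y) = 0.
    by have := congr1 (fun c => slice c y) e; rewrite glueK => ->; apply/colP=> i; rewrite !mxE.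
  have rE z : v (y, z) = k by have := congr1 (fun f : {ffun X -> int} => f z) kE; rewrite !ffunE.
  by rewrite !rE.
- move=> g Gg; apply: mulmx_ext => c; rewrite -!mulmxA !mx_ofE //.
  by apply: glue_ext => y; rewrite glueK.
- move=> g Gg; apply: mulmx_ext => c; rewrite -!mulmxA !mx_ofE //.
  have mD : add_map (mulmx (rho g) : 'cV[int]_n -> _) by move=> c1 c2; rewrite mulmxDr.
  rewrite (add_map_sum mD) [RHS](reindex_inj (@act_inj _ _ _ (gto Y) g)); apply: eq_bigr => y _.
  rewrite glueK (add_map_int mD); congr (_ *~ _).
  by have := congr1 (fun f : {ffun Y -> int} => f y) (uG g Gg); rewrite ffunE.
apply: mulmx_ext => c; rewrite -mulmxA !mx_ofE // mul1mx.
under eq_bigr do rewrite glueK.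
have cD : add_map (fun k : int => c *~ k) by move=> k l; rewrite mulrzDr.
by rewrite -(add_map_sum cD) u1 mulr1z.
Qed.

(** * The degree and the bad primes *)

Section Degree.
Variables (gT : finGroupType) (G : {group gT}) (calH : {set {group gT}}).
Hypothesis sHG : forall H : {group gT}, H \in calH -> H \subset G.
Hypothesis calH0 : calH != set0.

Lemma dG_dvd (H : {group gT}) : H \in calH -> (dG G calH %| #|G : H|%g)%N.
Proof. by move=> HH; rewrite /dG; apply: biggcdn_inf (dvdnn _). Qed.

Lemma dG_gt0 : (0 < dG G calH)%N.
Proof. by have [H HH] := set0Pn _ calH0; apply: dvdn_gt0 (dG_dvd HH); rewrite indexg_gt0. Qed.

Lemma dG_logn p : prime p -> exists2 H : {group gT}, H \in calH &
  (logn p #|G| <= logn p #|H| + logn p (dG G calH))%N.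
Proof.
move=> pr_p; have [H1 HH1] := set0Pn _ calH0.
have [H HH Hmin] := @arg_minnP _ H1 (mem calH) (fun H => logn p #|G : H|%g) HH1.
exists H => //; rewrite -(Lagrange (sHG HH)) lognM ?cardG_gt0 // leq_add2l.
rewrite -pfactor_dvdn ?dG_gt0 //; apply/dvdn_biggcdP => K HK.
by rewrite pfactor_dvdn //; apply: Hmin.
Qed.
End Degree.

Lemma Zgroup_of_Sylow (gT : finGroupType) (G : {group gT}) :
  (forall (p : nat) (P : {group gT}), P \in 'Syl_p(G)%g -> cyclic P) -> Zgroup G.
Proof.
move=> cycS; apply/forall_inP=> P /SylowP[p pr_p sylP].
by apply: (cycS p); rewrite inE.
Qed.

(** * Necessity of the condition on primes *)

Section Necessity.
Variables (gT : finGroupType) (G : {group gT}) (calH : {set {group gT}}).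
Hypothesis ZG : Zgroup G.
Hypothesis sHG : forall H : {group gT}, H \in calH -> H \subset G.
Hypothesis calH0 : calH != set0.

Lemma resolved_no_bad_prime p :
  resolved (@is_cst _ _ (cosets G calH)) -> ~ (DG G calH p /\ Pstar G p).
Proof.
move=> res [[pr_p pd] [_ _ [P [sylP nPG card3]]]]; move: sylP; rewrite inE => sylP.
have sPG := pHall_sub sylP; have pP := pHall_pgroup sylP.
have cycP : cyclic P by apply: (forall_inP ZG); apply: p_Sylow sylP.
have [z defP] := cyclicP cycP; have Pz : z \in P by rewrite defP cycle_id.
have oz : #[z]%g = (p ^ logn p #|G|)%N by rewrite orderE -defP (card_Hall sylP) p_part.
have [H1 HH1] := set0Pn _ calH0.
have [H0 HH0 Hmax] := @arg_maxnP _ H1 (mem calH) (fun H => logn p #|H|) HH1.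
set k := logn p #|G| in oz; set h := logn p #|H0| in Hmax.
have lt_hk : (h < k)%N.
  rewrite /k -(Lagrange (sHG HH0)) lognM ?cardG_gt0 // -/h -addn1 leq_add2l.
  by rewrite -pfactor_dvdn // expn1; apply: dvdn_trans pd (dG_dvd _ HH0).
(* p^h is the largest power of p dividing the order of an element of [calH], so an element of order
   p^(h+1) fixes no coset; [P] contains one because p divides every index. *)
pose s := (z ^+ (p ^ (k - h.+1)))%g.
have Ps : s \in P by rewrite groupX.
have Gs := subsetP sPG _ Ps.
have os : #[s]%g = (p ^ h.+1)%N.
  rewrite orderXdiv oz ?dvdn_exp2l ?leq_subr //.
  by rewrite -{1}(subnK lt_hk) expnD mulKn // expn_gt0 prime_gt0.
have osp : #[(s ^+ p)%g]%g = (p ^ h)%N.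
  by rewrite orderXdiv os expnS ?dvdn_mulr // mulKn // prime_gt0.
have [x0 x0E] := exists_coset HH0 (group1 G).
have x0p : gto (cosets G calH) x0 (s ^+ p)%g = x0.
  set S := 'C_G[x0 | gto (cosets G calH)]%G.
  have cS : #|S| = #|H0| by rewrite card_stab_cosets // x0E.
  (* Normality of [P] makes its intersection with the stabilizer a Sylow subgroup there, of order
     p^h, and the cyclic group [P] has only one subgroup of that order. *)
  have sylPS : (p.-Sylow(S) (P :&: S))%g by apply: setI_normal_Hall nPG sylP (subsetIl _ _).
  have : <[(s ^+ p)%g]>%G \subset (P :&: S)%G.
    rewrite -(cardSg_cyclic cycP) ?subsetIl ?cycle_subG ?groupX //.
    by rewrite (card_Hall sylPS) p_part cS -orderE osp.
  rewrite cycle_subG => /setIP[_]; rewrite mem_stab => /andP[_ /eqP]; exact.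
have nofix (x : cosets G calH) : gto (cosets G calH) x s <> x.
  move=> sx; have Ss : s \in 'C_G[x | gto (cosets G calH)]%g by rewrite mem_stab Gs sx eqxx.
  have /andP[HH _] := valP x; have := order_dvdG Ss.
  rewrite card_stab_cosets // os pfactor_dvdn ?cardG_gt0 // ltnNge => /negP[].
  exact: (Hmax _ HH).
have zg g : g \in G -> exists r, (z ^ g = z ^+ r)%g.
  move=> Gg; have : (z ^ g)%g \in P by rewrite memJ_norm // (subsetP (normal_norm nPG)).
  by rewrite defP => /cycleP[r]; exists r.
have ps : (p.-elt s)%g := mem_p_elt pP Ps.
have r2 g r : g \in G -> (z ^ g = z ^+ r)%g -> (r%:R : 'F_p) ^+ 2 = 1.
  move=> Gg zr; apply: (resolved_conj_sqr1 pr_p Gs ps Gg _ x0p nofix res).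
  by rewrite /s conjXg zr -!expgM mulnC.
have NG g : g \in G -> g \in 'N_G(P)%g by move=> Gg; rewrite inE Gg (subsetP (normal_norm nPG)).
have r1C g r : g \in G -> (z ^ g = z ^+ r)%g -> r%:R = 1 :> 'F_p -> conj_aut P g = 1%g.
  move=> Gg zr r1; have Ng : g \in 'N(P)%g by have /setIP[] := NG g Gg.
  suffices : (g \in 'ker (conj_aut P))%g by move/kerP=> ->.
  rewrite ker_conj_aut; apply: (Sylow_norm_cent pr_p sylP defP (NG g Gg) zr).
  have r1' : r%:R = 1%:R :> 'F_p by [].
  have := congr1 (fun x : 'F_p => x : nat) r1'; rewrite !val_Fp_nat //.
pose A := [set conj_aut P (g^-1)%g | g in G]; rewrite -/A in card3.
have [/forall_inP all1 | /forall_inPn[g0 Gg0 ng0]] := boolP [forall g in G, conj_aut P g == 1%g].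
  suffices sA1 : A \subset [set 1%g] by have := leq_trans card3 (subset_leq_card sA1);
      rewrite cards1.
  by apply/subsetP=> _ /imsetP[g Gg ->]; rewrite inE all1 ?groupV.
suffices sA2 : A \subset [set 1%g; conj_aut P g0].
  by have := leq_trans card3 (subset_leq_card sA2); rewrite cards2; case: (_ != _).
(* An element acting nontrivially on [P] has r = -1 in F_p; the product of two such elements has r =
   1 and acts trivially, so the image has at most two elements. *)
have sgn g r : g \in G -> (z ^ g = z ^+ r)%g -> conj_aut P g != 1%g -> r%:R = -1 :> 'F_p.
  move=> Gg zr; have /eqP := r2 g r Gg zr; rewrite sqrf_eq1 => /orP[/eqP r1|/eqP //].
  by rewrite (r1C g r) ?eqxx.
apply/subsetP=> _ /imsetP[g Gg ->]; rewrite !inE.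
have Ng : g \in 'N(P)%g by have /setIP[] := NG g Gg.
have Ng0 : g0 \in 'N(P)%g by have /setIP[] := NG g0 Gg0.
have [c1 | ng] := eqVneq (conj_aut P g) 1%g; first by rewrite morphV //= c1 invg1 eqxx.
have [r zr] := zg g Gg; have [r0 zr0] := zg g0 Gg0.
have : conj_aut P (g * g0)%g = 1%g.
  apply: (@r1C _ (r0 * r)); rewrite ?groupM //.
    by rewrite conjgM zr conjXg zr0 -expgM.
  by rewrite natrM (sgn g r) // (sgn g0 r0) // mulrNN mulr1.
rewrite morphM // => /eqP; rewrite -eq_invg_mul => /eqP <-.
by rewrite morphV // eqxx orbT.
Qed.
End Necessity.

Section CosetSpace.
Variables (gT : finGroupType) (G M : {group gT}).
Hypothesis sMG : M \subset G.
Local Notation Y := (cosets G [set M]).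

Let sYG (H : {group gT}) : H \in [set M] -> H \subset G.
Proof. by rewrite inE => /eqP->. Qed.

Lemma coset1E (t : Y) : exists2 x, x \in G & val t = (M, (x *: M)%g).
Proof.
have /andP[] := valP t; case: (val t) => [H A] /=; rewrite inE => /eqP-> /lcosetsP[x Gx ->].
by exists x.
Qed.

Lemma card_stab_coset1 (t : Y) : #|('C_G[t | gto Y])%g| = #|M|.
Proof. by rewrite card_stab_cosets //; have [x _ ->] := coset1E t. Qed.

Lemma coset1_trans (t t' : Y) : exists2 g, g \in G & t' = gto Y t g.
Proof.
have [x Gx tE] := coset1E t; have [y Gy tE'] := coset1E t'.
exists (x * y^-1)%g; first by rewrite groupM ?groupV.
apply: val_inj; rewrite cosets_actE ?groupM ?groupV // cosetT_actE ?groupV ?groupM ?groupV //.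
by rewrite tE tE' /= invMg invgK -lcosetM mulgKV.
Qed.

Lemma card_coset1 : #|Y| = #|G : M|%g.
Proof.
have MM : M \in [set M] by rewrite inE.
have [t _] := exists_coset MM (group1 G).
have e : orbit (gto Y) G t = [set: Y].
  by apply/setP=> t'; rewrite inE; have [g Gg ->] := coset1_trans t t'; apply: mem_orbit.
rewrite -cardsT -e card_orbit_in //; apply/eqP.
rewrite -(eqn_pmul2l (cardG_gt0 M)) Lagrange // -(card_stab_coset1 t).
by rewrite Lagrange // subsetIl.
Qed.
End CosetSpace.

(** * Sufficiency: resolutions of the two coset spaces *)

Section Sufficiency.
Variables (gT : finGroupType) (G : {group gT}) (calH : {set {group gT}}).
Hypothesis ZG : Zgroup G.
Hypothesis sHG : forall H : {group gT}, H \in calH -> H \subset G.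
Hypothesis calH0 : calH != set0.
Local Notation d := (dG G calH).

Lemma dG_dvd_card : (d %| #|G|)%N.
Proof.
have [H HH] := set0Pn _ calH0.
exact: dvdn_trans (dG_dvd _ HH) (dvdn_indexg _ _).
Qed.

Let pi' : nat_pred := \pi(#|(G^`(1))%g|).

Let Hall' : coprime #|(G^`(1))%g| #|G : (G^`(1))%g|%g.
Proof. by have /andP[] := Zgroup_der1_Hall ZG. Qed.

Let LagG : (#|(G^`(1))%g| * #|G : (G^`(1))%g|%g = #|G|)%N.
Proof. by rewrite Lagrange ?der_sub. Qed.

(** In the cyclic group [G / G'] generated by [X], the subgroup generated by [X ^+ a] has index
    [a]. *)
Lemma exists_abelian_index a : (a %| #|G : (G^`(1))%g|%g)%N ->
  exists M : {group gT}, [/\ (G^`(1))%g \subset M, M \subset G & #|G : M|%g = a].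
Proof.
move=> ai; have nDG : ((G^`(1)) <| G)%g := der_normal 1 G.
have /cyclicP[X defX] : cyclic (G / (G^`(1)))%g.
  by apply: abelian_Zgroup_cyclic; [apply: morphim_Zgroup | exact: (der_abelian 0)].
have oX : #[X]%g = #|G : (G^`(1))%g|%g by rewrite orderE -defX card_quotient ?normal_norm.
have a0 : (0 < a)%N by apply: dvdn_gt0 ai; rewrite indexg_gt0.
have sX : <[(X ^+ a)%g]>%g \subset (G / (G^`(1)))%g by rewrite defX cycle_subG mem_cycle.
have [M defM sDM sMG] := inv_quotientS nDG sX.
exists M; split=> //.
have cM : #|M : (G^`(1))%g|%g = (#|G : (G^`(1))%g|%g %/ a)%N.
  rewrite -card_quotient ?(subset_trans sMG) ?normal_norm // -defM -orderE orderXdiv oX //.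
apply/eqP; rewrite -(eqn_pmul2r (indexg_gt0 M (G^`(1))%g)) Lagrange_index // cM.
by rewrite mulnC divnK.
Qed.

(** [G'] acts trivially on the cosets of [M], so [G] acts on them through the powers of [x]. *)
Lemma resolved_abelian_index (M : {group gT}) : (G^`(1))%g \subset M -> M \subset G ->
  resolved (@is_cst _ _ (cosets G [set M])).
Proof.
move=> sDM sMG; set Y := cosets G [set M].
have sYG (H : {group gT}) : H \in [set M] -> H \subset G by rewrite inE => /eqP->.
have [x Gx defG] := Zgroup_generator ZG.
have MM : M \in [set M] by rewrite inE.
have [t0 _] := exists_coset MM (group1 G).
have nMG : (M <| G)%g by rewrite sub_der1_normal.
have stabD (t : Y) g : g \in (G^`(1))%g -> gto Y t g = t.
  move=> Dg; have [k Gk eS] := stab_cosets sYG t.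
  suffices : g \in 'C_G[t | gto Y]%g by rewrite mem_stab => /andP[_ /eqP].
  have [y _ tE] := coset1E t; rewrite eS tE /=.
  by rewrite (normP (subsetP (normal_norm nMG) _ Gk)) (subsetP sDM).
have sDG := der_sub 1 G.
apply: (resolved_cyclic t0 Gx) => [t t' | g t Gg].
  have [g + ->] := coset1_trans t t'; rewrite {1}defG norm_joinEr; last first.
    by rewrite cycle_subG (subsetP (der_norm 1 G)).
  case/mulsgP=> e _ De /cycleP[i ->] ->; exists i.
  have Ge : e \in G := subsetP sDG e De.
  by rewrite actMin ?groupX // -/Y (stabD t e De).
rewrite -!actMin // [in LHS]commgC [LHS]actMin ?groupM ?groupR ?groupV //.
by rewrite -/Y (stabD _ [~ x, g]%g) //; apply: mem_commg.
Qed.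

Section Inverted.
Variables (x : gT) (b : nat).
Hypotheses (Gx : x \in G) (defG : G :=: ((G^`(1)) <*> <[x]>)%g) (bD : (b %| #|(G^`(1))%g|)%N).
Hypothesis good : forall p, prime p -> (p %| b)%N -> ~ Pstar G p.

Let b_gt0 : (0 < b)%N. Proof. exact: dvdn_gt0 bD. Qed.
Let TI : ('C_(G^`(1))[x] = 1)%g.
Proof.
apply: der1_cent_TI => //; last by rewrite -defG.
exact: cyclic_abelian (Zgroup_der1_cyclic ZG).
Qed.

(* The images of 1, x, x^2 in Aut(P) cannot be distinct, as the image of G has order at most 2. *)
Lemma square_cent_Sylow p (P : {group gT}) : prime p -> (p %| b)%N ->
  (p.-Sylow(G^`(1)) P)%g -> (x ^+ 2)%g \in 'C(P)%g.
Proof.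
move=> pr_p pb sylP.
have sylG : (p.-Sylow(G) P)%g.
  have [sPD pP p'i] := and3P sylP; rewrite /pHall (subset_trans sPD (der_sub 1 G)) pP /=.
  rewrite -(Lagrange_index (der_sub 1 G) sPD) pnatM p'i andbT p'natE //.
  apply: contraL (Hall') => pi; have := dvdn_trans pb bD => pD.
  apply/negP=> /eqP co1; have : (p %| 1)%N by rewrite -co1 dvdn_gcd pi pD.
  by rewrite dvdn1 => /eqP p1; rewrite p1 in pr_p.
have nPG : (P <| G)%g.
  apply: char_normal_trans (der_normal 1 G).
  by rewrite sub_cyclic_char ?(pHall_sub sylP) // Zgroup_der1_cyclic.
have NG g : g \in G -> g \in 'N(P)%g by apply: subsetP (normal_norm nPG) g.
have [//|nx2] := boolP ((x ^+ 2)%g \in 'C(P)%g).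
case: (good pr_p pb); split=> //.
  exact: dvdn_trans (dvdn_trans pb bD) (cardSg (der_sub 1 G)).
exists P; split=> //; first by rewrite inE.
have cE g : g \in G -> (conj_aut P g == 1%g) = (g \in 'C(P)%g).
  move=> Gg; rewrite -ker_conj_aut; apply/eqP/idP=> [e|/mker//].
  by apply/kerP; rewrite ?NG.
have n2 : conj_aut P (x ^+ 2)%g != 1%g by rewrite cE // groupX.
have n1 : conj_aut P x != 1%g.
  by apply: contra n2 => /eqP e; rewrite morphX ?NG //= e expg1n.
have n12 : conj_aut P x != conj_aut P (x ^+ 2)%g.
  apply: contra n1 => /eqP e; apply/eqP; apply: (mulgI (conj_aut P x)).
  by rewrite mulg1 -morphM ?NG //= -expg2 -e.
suffices sA : [set 1%g; conj_aut P x;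
    conj_aut P (x ^+ 2)%g] \subset [set conj_aut P (g^-1)%g | g in G].
  apply: leq_trans (subset_leq_card sA).
  by rewrite setUC cardsU1 cards2 !inE negb_or [_ == 1%g](negPf n2) eq_sym n12 [1%g == _]eq_sym n1.
have im g : g \in G -> conj_aut P g \in [set conj_aut P (g^-1)%g | g in G].
  by move=> Gg; apply/imsetP; exists g^-1%g; rewrite ?groupV ?invgK.
by rewrite !subUset !sub1set -{1}(morph1 (conj_aut P)) !im ?group1 ?groupX.
Qed.

(** [c] generates the part of [G'] at the primes of [b], and [x ^+ 2] centralizes each Sylow
    subgroup of [<[c]>]. Then the product of [c] and [c ^ x] is fixed by [x], hence trivial by [TI];
    an even order would give an involution that [x] inverts, so fixes. *)
Lemma exists_inverted : exists c, [/\ c \in (G^`(1))%g, #[c]%g = (#|(G^`(1))%g|`_(\pi(b)))%N,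
  odd #[c]%g & (c ^ x = c^-1)%g].
Proof.
have cycD := Zgroup_der1_cyclic ZG; have [z defD] := cyclicP cycD.
pose c := (z.`_(\pi(b)))%g.
have Dc : c \in (G^`(1))%g by rewrite defD /c mem_cycle.
have oc : #[c]%g = (#|(G^`(1))%g|`_(\pi(b)))%N by rewrite order_constt orderE -defD.
have abD := cyclic_abelian cycD.
have nDx : x \in 'N(G^`(1))%g := subsetP (der_norm 1 G) _ Gx.
have cx2 : (c ^ (x ^+ 2))%g = c.
  have : <[c]>%g \subset 'C[(x ^+ 2)%g]%g.
    have sC : ('C_(<[c]>)[(x ^+ 2)%g] \subset <[c]>)%g by apply: subsetIl.
    apply/setIidPl/eqP; rewrite eqEcard sC /=; apply: dvdn_leq => //.
    apply/dvdn_partP; rewrite ?cardG_gt0 // => p; rewrite -orderE oc => pc.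
    have [pr_p pb] : prime p /\ (p %| b)%N.
      have : (\pi(b)).-nat p.
        apply: pnat_dvd (part_pnat _ _); move: pc; rewrite mem_primes => /and3P[_ _]; exact.
      have pr_p : prime p by move: pc; rewrite mem_primes => /and3P[].
      by rewrite pnatE // mem_primes => /and3P[].
    have [P sylP] := Sylow_exists p <[c]>%G.
    have sylPD : (p.-Sylow(G^`(1)) P)%g.
      have hallc : ((\pi(b)).-Hall(G^`(1)) <[c]>)%g.
        by rewrite pHallE cycle_subG Dc -orderE oc /=.
      by apply: (subHall_Sylow hallc _ sylP); rewrite mem_primes pr_p b_gt0.
    have <- : #|P| = ((#|(G^`(1))%g|`_\pi(b))`_p)%N by rewrite (card_Hall sylP) -orderE oc.
    rewrite cardSg // subsetI (pHall_sub sylP).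
    by rewrite sub_cent1 (square_cent_Sylow pr_p pb sylPD).
  by rewrite cycle_subG => /cent1P cc; rewrite conjgE cc mulKg.
have fix1 y : y \in (G^`(1))%g -> (y ^ x)%g = y -> y = 1%g.
  move=> Dy yx; apply/set1P; rewrite -[[set 1%g]]TI inE Dy /=.
  by apply/cent1P/commgP/conjg_fixP.
have Dcx : (c ^ x)%g \in (G^`(1))%g by rewrite memJ_norm.
have cx : (c ^ x = c^-1)%g.
  apply/eqP; rewrite eq_sym eq_invg_mul; apply/eqP/fix1; first by rewrite groupM.
  by rewrite conjMg -conjgM -expg2 cx2; apply: (centsP abD).
exists c; split=> //; apply: contraT => ev.
pose m := (#[c]%g)./2; have em : #[c]%g = (m + m)%N.
  by rewrite addnn /m halfK (negPf ev) subn0.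
have t1 : (c ^+ m = 1)%g.
  apply: fix1; first by rewrite groupX.
  by rewrite conjXg cx expgVn; apply/eqP; rewrite eq_invg_mul -expgD -em expg_order.
have m_gt0 : (0 < m)%N by have := order_gt0 c; rewrite em; case: (m).
have : (#[c]%g %| m)%N by rewrite order_dvdn t1.
by move/(dvdn_leq m_gt0); rewrite em -{3}[m]addn0 leq_add2l leqNgt m_gt0.
Qed.

Variable c : gT.
Hypotheses (Dc : c \in (G^`(1))%g) (oc : #[c]%g = (#|(G^`(1))%g|`_(\pi(b)))%N)
  (odd_c : odd #[c]%g) (cx : (c ^ x = c^-1)%g).

Let Gc : c \in G. Proof. exact: (subsetP (der_sub 1 G)). Qed.

Let hallK : ((\pi(b)).-Hall(G) <[c]>)%g.
Proof.
rewrite pHallE cycle_subG Gc -orderE oc -LagG partnM ?cardG_gt0 ?indexg_gt0 //=.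
rewrite [(#|G : _|%g`_ _)%N]part_p'nat ?muln1 //.
apply/pnatP=> [|p pr_p pi]; first exact: indexg_gt0.
rewrite !inE /= mem_primes pr_p b_gt0 /=; apply/negP=> pb.
have : (p %| 1)%N by rewrite -(eqP Hall') dvdn_gcd pi (dvdn_trans pb bD).
by rewrite dvdn1 => /eqP p1; rewrite p1 in pr_p.
Qed.

Let nKG : (<[c]> <| G)%g.
Proof.
apply: char_normal_trans (der_normal 1 G).
by rewrite sub_cyclic_char ?Zgroup_der1_cyclic // cycle_subG.
Qed.

(** For a complement [Q] of the normal Hall subgroup [<[c]>], the subgroup generated by [c ^+ b] and
    [Q] has index [b]. *)
Lemma exists_inverted_index : exists M : {group gT}, M \subset G /\ #|G : M|%g = b.
Proof.
have bc : (b %| #[c]%g)%N.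
  rewrite oc -{1}(part_pnat_id (pnat_pi b_gt0)); exact: partn_dvd.
have /splitsP[Q /complP[tiKQ defKQ]] := SchurZassenhaus_split (pHall_Hall hallK) nKG.
pose K1 := <[(c ^+ b)%g]>%G.
have sK1 : K1 \subset <[c]>%g by rewrite cycle_subG mem_cycle.
have nK1G : (K1 <| G)%g.
  by apply: char_normal_trans nKG; rewrite sub_cyclic_char ?cycle_cyclic.
have sQG : Q \subset G by rewrite -defKQ mulG_subr.
have nK1Q : Q \subset 'N(K1)%g := subset_trans sQG (normal_norm nK1G).
have tiK1Q : (K1 :&: Q = 1)%g by apply/trivgP; rewrite -tiKQ setSI.
exists (K1 <*> Q)%G; split; first by rewrite join_subG normal_sub.
have sMG : (K1 <*> Q)%G \subset G by rewrite join_subG normal_sub.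
have cM : #|K1 <*> Q|%g = (#|K1| * #|Q|)%N by rewrite norm_joinEr // TI_cardMg.
have cG : #|G| = (#[c]%g * #|Q|)%N by rewrite -defKQ TI_cardMg.
apply/eqP; rewrite -(eqn_pmul2l (cardG_gt0 (K1 <*> Q)%G)) Lagrange //= cM cG.
by rewrite -orderE orderXdiv // mulnAC divnK.
Qed.

(** A point stabilizer has index [b], coprime to the index of [<[c]>], so [<[c]>] is transitive.
    Conjugation by [G'] fixes [c] and conjugation by [x] inverts it, which gives the dihedral
    action. *)
Lemma resolved_inverted_index (M : {group gT}) : M \subset G -> #|G : M|%g = b ->
  resolved (@is_cst _ _ (cosets G [set M])).
Proof.
move=> sMG iM; have sYG (H : {group gT}) : H \in [set M] -> H \subset G by rewrite inE => /eqP->.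
have MM : M \in [set M] by rewrite inE.
have [t0 _] := exists_coset MM (group1 G).
apply: (resolved_dihedral t0 Gc odd_c) => [t t' | g Gg].
  have [g Gg ->] := coset1_trans t t'.
  set S := 'C_G[t | gto (cosets G [set M])]%G.
  have sSG : S \subset G by apply: subsetIl.
  have iS : #|G : S|%g = b.
    apply/eqP; rewrite -(eqn_pmul2l (cardG_gt0 S)) Lagrange // (card_stab_coset1 sMG).
    by rewrite -iM Lagrange.
  have defSK : (S * <[c]>)%g = G.
    have nSK : (S \subset 'N(<[c]>))%g := subset_trans sSG (normal_norm nKG).
    rewrite -norm_joinEl //; apply/eqP; rewrite eqEsubset join_subG sSG cycle_subG Gc /=.
    rewrite -indexg_eq1 -dvdn1.
    have co : coprime b #|G : <[c]>|%g.
      have /and3P[_ _ p'i] := hallK; exact: pnat_coprime (pnat_pi b_gt0) p'i.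
    rewrite -(eqP co) dvdn_gcd -{1}iS (indexgS _ (joing_subl _ _)) /=.
    exact: (indexgS _ (joing_subr _ _)).
  move: Gg; rewrite -{1}defSK => /mulsgP[s _ Ss /cycleP[i ->] ->]; exists i.
  have := Ss; rewrite mem_stab => /andP[Gs /eqP ts].
  by rewrite actMin ?groupX // ts.
have cg : (c ^ g = c \/ c ^ g = c^-1)%g.
  have : g \in ((G^`(1)) * <[x]>)%g.
    by rewrite -norm_joinEr -?defG // cycle_subG (subsetP (der_norm 1 G)).
  case/mulsgP=> e _ De /cycleP[i ->] ->; rewrite conjgM.
  have -> : (c ^ e)%g = c.
    apply/conjg_fixP/commgP; apply: (centsP (cyclic_abelian (Zgroup_der1_cyclic ZG))) => //.
  elim: i => [|i [IHi | IHi]]; first by left; rewrite conjg1.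
    by right; rewrite expgSr conjgM IHi.
  by left; rewrite expgSr conjgM IHi conjVg cx invgK.
have eg t : gto (cosets G [set M]) (gto (cosets G [set M]) t c) g =
    gto (cosets G [set M]) (gto (cosets G [set M]) t g) (c ^ g)%g.
  by rewrite -!actMin ?groupJ // -conjgC.
by case: cg => e; [left | right] => t; rewrite eg e.
Qed.
End Inverted.

Lemma resolved_cosets : (forall p, ~ (DG G calH p /\ Pstar G p)) ->
  resolved (@is_cst _ _ (cosets G calH)).
Proof.
move=> good; have [x Gx defG] := Zgroup_generator ZG.
have d0 := dG_gt0 G calH0; have dvG := dG_dvd_card.
(* [b] is the part of the degree at the primes dividing [#|G'|], and [a] is the rest; since [G'] is
   a Hall subgroup, [b] divides [#|G'|] and [a] divides its index. *)
pose b := (d`_pi')%N; pose a := (d`_pi'^')%N.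
have ab : (a * b = d)%N by rewrite mulnC partnC.
have b0 : (0 < b)%N := part_gt0 _ _; have a0 : (0 < a)%N := part_gt0 _ _.
have piD : pi'.-nat #|(G^`(1))%g| by apply: pnat_pi; rewrite cardG_gt0.
have pi'I : pi'^'.-nat #|G : (G^`(1))%g|%g.
  by rewrite -coprime_pi' ?cardG_gt0.
have bD : (b %| #|(G^`(1))%g|)%N.
  rewrite -(Gauss_dvdl _ (pnat_coprime (part_pnat pi' d) pi'I)) LagG.
  exact: dvdn_trans (dvdn_part _ _) dvG.
have aI : (a %| #|G : (G^`(1))%g|%g)%N.
  rewrite -(@Gauss_dvdr _ #|(G^`(1))%g|) ?LagG; first exact: dvdn_trans (dvdn_part _ _) dvG.
  by rewrite coprime_sym; apply: pnat_coprime piD (part_pnat _ _).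
have goodb p : prime p -> (p %| b)%N -> ~ Pstar G p.
  move=> pr_p pb Pp; apply: (good p); split=> //; split=> //.
  exact: dvdn_trans pb (dvdn_part _ _).
have [MA [sDA sAG iA]] := exists_abelian_index aI.
have [c [Dc oc odd_c cx]] := exists_inverted Gx defG bD goodb.
have [MB [sBG iB]] := exists_inverted_index bD Dc oc.
pose A := cosets G [set MA]; pose B := cosets G [set MB].
have cA : #|A| = a by rewrite card_coset1.
have cB : #|B| = b by rewrite card_coset1.
apply: (@resolved_coprime _ G ZG _ A B).
- by move=> t; rewrite card_stab_coset1 // card_coset1 // Lagrange.
- by move=> t; rewrite card_stab_coset1 // card_coset1 // Lagrange.
- by rewrite cA.
- by rewrite cB.
- rewrite cA cB coprime_sym; exact: pnat_coprime (part_pnat _ _) (part_pnat _ _).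
- move=> t p pr_p; rewrite cA cB ab card_stab_cosets //.
  have /andP[HH _] := valP t.
  rewrite -(Lagrange (sHG HH)) lognM ?cardG_gt0 // leq_add2l.
  exact: dvdn_leq_log (dG_dvd _ HH).
- move=> p pr_p; have [H HH le] := dG_logn sHG calH0 pr_p.
  have [t tE] := exists_coset HH (group1 G); exists t.
  by rewrite cA cB ab card_stab_cosets // tE.
- exact: resolved_abelian_index.
exact: (resolved_inverted_index Gx defG bD Dc oc odd_c cx sBG iB).
Qed.
End Sufficiency.

Theorem theorem6p7 (gT : finGroupType) (G : {group gT})
  (calH : {set {group gT}}) :
  (forall (p : nat) (P : {group gT}), P \in 'Syl_p(G)%g -> cyclic P) ->
  (forall H : {group gT}, H \in calH -> H \subset G) ->
  calH != set0 ->
  reduced_set calH ->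
  is_quasi_invertible G (rhoJ G calH) /\
  (is_quasi_perm G (rhoJ G calH) <->
     (forall p : nat, ~ (DG G calH p /\ Pstar G p))).
Proof.
move=> /Zgroup_of_Sylow ZG sHG calH0 _.
have [H1 HH1] := set0Pn _ calH0; have [t1 _] := exists_coset HH1 (group1 G).
split.
  apply: (quasi_invertible_of_quotient t1 ZG (JmapD calH0) (Jmap_surj calH0)).
    by move=> g v Gg; apply: Jmap_act.
  exact: Jmap_ker.
split=> [qp p | good].
  apply: (resolved_no_bad_prime ZG sHG calH0).
  have [Y [W [a [b [aH bH a0 ba bS]]]]] := quasi_perm_resolved (JmapD calH0) (Jmap_surj calH0)
    (fun g v Gg => Jmap_act calH0 v Gg) qp.
  by exists Y, W, a, b; split=> // v; rewrite a0 Jmap_ker.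
apply: (resolved_quasi_perm (JmapD calH0) (Jmap_surj calH0) (fun g v Gg => Jmap_act calH0 v Gg)).
have [Y [W [a [b [aH bH a0 ba bS]]]]] := resolved_cosets ZG sHG calH0 good.
by exists Y, W, a, b; split=> // v; rewrite a0 Jmap_ker.
Qed.
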